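(* Let $Q$ be a string of length $u$ compressed using ZL78 or ZLW into a compressed string $Z$ of length $n$, and let $R$ be a regular expression of length $m$. Given $Z$, $R$, and a parameter $\tau \geq 1$, all ending positions $j$ in $Q$ of substrings $Q[i,j]$ that belong to the language $L(R)$ can be found in $O(nm(m + \tau) + \mathit{occ}\cdot m \log m)$ time and $O(nm^2/\tau + nm)$ space, where $\mathit{occ}$ is the number of such ending positions.
   Context: Computation model: unit-cost RAM. A ZL78 compressed string is a sequence $Z = (r_1,\alpha_1)\cdots(r_n,\alpha_n)$ with $r_i\in\{0,\dots,i-1\}$ and $\alpha_i$ a character, with an implicit element $z_0$ whose phrase is the empty string; the phrase of $z_i=(r_i,\alpha_i)$ is $\mathrm{phrase}(z_{r_i})\cdot\alpha_i$, and $Z$ represents the concatenation of the phrases $\mathrm{phrase}(z_1)\cdots\mathrm{phrase}(z_n)$; ZL78 compression produces this by greedy left-to-right parsing, each new phrase being the longest prefix of the remaining text equal to an existing phrase, extended by one character. ZLW is the variant in which the characters (labels) are not stored explicitly: each compression element stores only a reference to a previous phrase, and the label appended to a phrase is defined to be the first character of the next phrase. Regular expressions over an alphabet $\Sigma$ are built from single characters by concatenation, union and Kleene star, with the usual language $L(R)$; the length of $R$ is its number of symbols. *)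

(* Defs.v *)
From mathcomp Require Import all_boot.

Set Implicit Arguments.
Unset Strict Implicit.
Unset Printing Implicit Defensive.

(** * Unit-cost RAM

    The memory is an array of cells X_0, X_1, ... holding words, all initially
    0. The input is a random-access read-only array of words, and the output
    is a write-only stream; neither is part of the memory. *)

Inductive arith_op := OpAdd | OpSub | OpMul | OpDiv | OpMod.

Definition eval_op (o : arith_op) : nat -> nat -> nat :=
  match o with
  | OpAdd => addn
  | OpSub => subn
  | OpMul => muln
  | OpDiv => divn
  | OpMod => modn
  end.

(* In the comments below, I is the input array. *)
Inductive instr :=
  | Const (i c : nat)                    (* X_i := c *)
  | Arith (o : arith_op) (i j k : nat)   (* X_i := X_j o X_k *)
  | LoadInd (i j : nat)                  (* X_i := X_(X_j) *)
  | StoreInd (i j : nat)                 (* X_(X_i) := X_j *)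
  | ReadInput (i j : nat)                (* X_i := I_(X_j) *)
  | Write (i : nat)                      (* append X_i to the output *)
  | Jump (l : nat)                       (* goto l *)
  | JumpZ (i l : nat)                    (* if X_i = 0 then goto l *)
  | Halt.

Definition program := seq instr.

Record config := Config {
  pc : nat;
  mem : nat -> nat;
  output : seq nat
}.

Definition init_config : config := Config 0 (fun=> 0) [::].

Section Execution.

(* [space] is the number of memory cells and [word] the number of values that
   a cell can hold. Using an address >= space, or storing a value >= word, is
   an error: no configuration follows. Hence "P runs within space s" says
   that s cells of memory suffice. Taking word polynomial in the input size and
   in the numbers in the input makes a word consist of logarithmically many
   bits, so that neither space nor unit-cost arithmetic is distorted by packing
   data into huge integers. *)
Variables (space word : nat) (P : program) (input : seq nat).

Definition read_cell (c : config) (a : nat) : option nat :=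
  if a < space then Some (mem c a) else None.

Definition write_cell (c : config) (a v : nat) : option config :=
  if (a < space) && (v < word)
  then Some (Config (pc c).+1 (fun b => if b == a then v else mem c b)
                    (output c))
  else None.

Definition exec (ins : instr) (c : config) : option config :=
  match ins with
  | Const i v => write_cell c i v
  | Arith o i j k =>
      obind (fun x =>
      obind (fun y => write_cell c i (eval_op o x y)) (read_cell c k))
        (read_cell c j)
  | LoadInd i j =>
      obind (fun a =>
      obind (fun v => write_cell c i v) (read_cell c a)) (read_cell c j)
  | StoreInd i j =>
      obind (fun a =>
      obind (fun v => write_cell c a v) (read_cell c j)) (read_cell c i)
  | ReadInput i j =>
      obind (fun a => write_cell c i (nth 0 input a)) (read_cell c j)
  | Write i =>
      obind (fun v => Some (Config (pc c).+1 (mem c) (rcons (output c) v)))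
        (read_cell c i)
  | Jump l => Some (Config l (mem c) (output c))
  | JumpZ i l =>
      obind (fun v => Some (Config (if v == 0 then l else (pc c).+1)
                                   (mem c) (output c)))
        (read_cell c i)
  | Halt => None
  end.

Definition step (c : config) : option config :=
  obind (fun ins => exec ins c) (onth P (pc c)).

(* P reaches a Halt instruction after exactly t unit-cost steps, having
   written out. *)
Definition ram_run (t : nat) (out : seq nat) : Prop :=
  exists c : config,
    [/\ iter t (obind step) (Some init_config) = Some c,
        onth P (pc c) = Some Halt
      & output c = out].

End Execution.

(** * Regular expressions *)

Inductive regexp (A : Type) :=
  | Char of A
  | Cat of regexp A & regexp A
  | Alt of regexp A & regexp A
  | Star of regexp A.

(* Characters and operators all count, including the concatenation operator;
   leaving the latter out would change the length by less than a factor 2. *)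
Fixpoint re_length (A : Type) (R : regexp A) : nat :=
  match R with
  | Char _ => 1
  | Cat R1 R2 | Alt R1 R2 => (re_length R1 + re_length R2).+1
  | Star R1 => (re_length R1).+1
  end.

Fixpoint lang (A : eqType) (R : regexp A) (w : seq A) : Prop :=
  match R with
  | Char a => w = [:: a]
  | Cat R1 R2 => exists w1 w2, [/\ w = w1 ++ w2, lang R1 w1 & lang R2 w2]
  | Alt R1 R2 => lang R1 w \/ lang R2 w
  | Star R1 =>
      exists ws : seq (seq A),
        w = flatten ws /\ forall v, v \in ws -> lang R1 v
  end.

(* Positions are numbered from 1, so drop i.-1 (take j Q) is Q[i,j]; it is
   nonempty because i <= j. *)
Definition ending_position (A : eqType) (R : regexp A) (Q : seq A) (j : nat) :
    Prop :=
  exists i : nat, 1 <= i <= j /\ j <= size Q /\ lang R (drop i.-1 (take j Q)).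

(** * Ziv-Lempel compression, over the alphabet {0, ..., sigma - 1} *)

Section Compression.

Variable sigma : nat.
Implicit Types (Q w : seq 'I_sigma).

(* The phrases of z_0, z_1, ..., z_n, in this order. *)
Definition zl78_phrases (Z : seq (nat * 'I_sigma)) : seq (seq 'I_sigma) :=
  foldl (fun ps z => rcons ps (rcons (nth [::] ps z.1) z.2)) [:: [::]] Z.

Definition zl78_wf (Z : seq (nat * 'I_sigma)) : Prop :=
  forall i : nat, i < size Z -> nth 0 (unzip1 Z) i < i.+1.

(* z_(i+1) extends the longest existing phrase that is a prefix of the
   remaining text. The prefix must be proper, to leave a character to extend
   it by; this only matters for the last phrase. *)
Definition zl78_greedy (Z : seq (nat * 'I_sigma)) : Prop :=
  let ps := zl78_phrases Z in
  forall i k : nat, i < size Z -> k <= i ->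
    let rest := flatten (drop i.+1 ps) in
    prefix (nth [::] ps k) rest -> size (nth [::] ps k) < size rest ->
    size (nth [::] ps k) <= size (nth [::] ps (nth 0 (unzip1 Z) i)).

Definition zl78_compressed Q (Z : seq (nat * 'I_sigma)) : Prop :=
  [/\ zl78_wf Z, flatten (zl78_phrases Z) = Q & zl78_greedy Z].

(* In ZLW the dictionary initially contains the single characters, with codes
   0, ..., sigma - 1. Element number k (from 0), referring to the phrase
   ps_k, adds the entry with code sigma + k: the phrase ps_k extended by the
   first character of ps_(k+1). [zlw_entry ps i c w]: code c denotes w in the
   dictionary available to element i. The entry of element i - 1 is included,
   although its label is the first character of ps_i itself. *)
Definition zlw_entry (ps : seq (seq 'I_sigma)) (i c : nat) w : Prop :=
  (exists a : 'I_sigma, c = a /\ w = [:: a]) \/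
  (exists k : nat,
    [/\ k < i, c = sigma + k
      & w = nth [::] ps k ++ take 1 (nth [::] ps k.+1)]).

Definition zlw_compressed Q (Z : seq nat) : Prop :=
  exists ps : seq (seq 'I_sigma),
    [/\ size ps = size Z,
        forall i, i < size Z -> zlw_entry ps i (nth 0 Z i) (nth [::] ps i),
        flatten ps = Q
      & forall i c w, i < size Z -> zlw_entry ps i c w ->
          prefix w (flatten (drop i ps)) -> size w <= size (nth [::] ps i)].

Inductive compressed :=
  | ZL78 of seq (nat * 'I_sigma)
  | ZLW of seq nat.

Definition compressed_into Q (Z : compressed) : Prop :=
  match Z with
  | ZL78 Z => zl78_compressed Q Z
  | ZLW Z => zlw_compressed Q Z
  end.

Definition compressed_length (Z : compressed) : nat :=
  match Z with
  | ZL78 Z => size Z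
  | ZLW Z => size Z
  end.

(** * Presentation of the input to the RAM *)

Definition encode_compressed (Z : compressed) : seq nat :=
  match Z with
  | ZL78 Z => flatten [seq [:: z.1; val z.2] | z <- Z]
  | ZLW Z => Z
  end.

Definition scheme_tag (Z : compressed) : nat :=
  if Z is ZL78 _ then 0 else 1.

(* Reverse Polish notation, one word for each symbol. *)
Fixpoint encode_regexp (R : regexp 'I_sigma) : seq nat :=
  match R with
  | Char a => [:: a.+3]
  | Cat R1 R2 => encode_regexp R1 ++ encode_regexp R2 ++ [:: 0]
  | Alt R1 R2 => encode_regexp R1 ++ encode_regexp R2 ++ [:: 1]
  | Star R1 => encode_regexp R1 ++ [:: 2]
  end.

Definition encode_input (Z : compressed) (R : regexp 'I_sigma) (tau : nat) :
    seq nat :=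
  [:: scheme_tag Z; sigma; compressed_length Z; re_length R; tau]
    ++ encode_compressed Z ++ encode_regexp R.

End Compression.

(* The binary logarithm, rounded up, with the usual asymptotic convention that
   it is at least 1. *)
Definition log (m : nat) : nat := maxn 1 (up_log 2 m).

(* Main.v *)
(* The elements of Z are the nodes of a trie, the phrase of a node being the
   word on its path from the root; for ZLW, the label of an element is the
   first letter of the phrase after the one that it refers to. A set of active
   positions of R (its Glushkov automaton) is advanced by one letter in O(m)
   time with two passes over the Reverse Polish notation of R: bottom up, to
   find which subexpressions may just have ended, and top down, to find which
   may begin now. The same passes with the two children of a concatenation
   exchanged compute predecessors, and the two are adjoint to each other. A
   start state with a loop on every letter turns the search for substrings into
   one run over Q.

   Let t = min(tau, n + 1). Some residue r modulo t contains at most n / t of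
   the depths of the n nodes; only the nodes at these depths store the
   transition matrix of their phrase. Every other node is fewer than t letters
   below one of them or below the root, so the active states after a phrase,
   and, running backwards, the states from which a phrase leads to acceptance,
   cost O(m^2 + m t) time. For each node v and state s, a table holds the lowest
   node on the path from v to the root whose phrase leads from s to acceptance.
   The largest entry over the active states is the last ending position in a
   phrase; continuing from its parent gives the others in O(m) time each, so no
   priority queue (and no factor log m) is needed.

   Words remain polynomial because an assignment exceeds the values stored
   before it by at most a constant, except for the text position, which is at
   most n^2. *)
From mathcomp Require Import all_boot zify.
Require Import Defs.

Set Implicit Arguments.
Unset Strict Implicit.
Unset Printing Implicit Defensive.

(** * A structured language and its compilation to the RAM *)

(** The cost of a matrix explains the balance. Running one state set along at most t labels takes
    O(mt) time, and each row of a matrix takes one such run. A matrix thus costs O(m^2 t), which is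
    affordable because it is paid at most n / t times, O(nm^2) in all. Every other node avoids
    matrix products: the active set is first sent through the rows of the base, in O(m^2), and then
    along the remaining labels. For the table, a single backward run along these labels serves all m
    + 1 states, and its result is paired with each row of the base. Adjointness is what makes this
    agree with m + 1 forward runs.

    The theorem demands a concrete RAM program. The algorithm is therefore written in a small
    imperative language whose semantics carries a clock, it is verified there, and [comp_ok]
    transfers the result at a constant number of machine steps per tick. The same clock bounds the
    stored values, so a bound on the time is at once a bound on the word size. *)

Inductive expr :=
  | EV (x : nat)
  | EC (c : nat)
  | EIn (e : expr)
  | EArr (a : nat) (e : expr)
  | EOp (o : arith_op) (e1 e2 : expr)
  | EOr (e1 e2 : expr)
  | EAnd (e1 e2 : expr)
  | EEq (e1 e2 : expr)
  | ELt (e1 e2 : expr).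

Inductive cmd :=
  | Skip
  | Assign (x : nat) (e : expr)
  | Store (a : nat) (i e : expr)
  | Out (e : expr)
  | Seq (c1 c2 : cmd)
  | If (e : expr) (c1 c2 : cmd)
  | While (e : expr) (c : cmd).

Notation "x <:- e" := (Assign x e) (at level 60, no associativity).
Notation "c1 ;; c2" := (Seq c1 c2) (at level 61, right associativity).

(* tm is a ghost component that counts the commands executed so far, so that
   postconditions can bound the running time. *)
Record state := State {
  sv : nat -> nat;
  sa : nat -> nat -> nat;
  so : seq nat;
  tm : nat
}.

Definition tick (s : state) : state := State (sv s) (sa s) (so s) (tm s).+1.
(** Names of variables and arrays are compared with [eqn], which [/=] evaluates on numerals, so that
    looking up a variable after an update is a computation. Array indices are symbolic and use
    [==]. *)
Definition setv (s : state) (x v : nat) : state :=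
  State (fun y => if eqn y x then v else sv s y) (sa s) (so s) (tm s).+1.
Definition seta (s : state) (a i v : nat) : state :=
  State (sv s)
        (fun b => if eqn b a then fun j => if j == i then v else sa s a j
                  else sa s b)
        (so s) (tm s).+1.
Definition outs (s : state) (v : nat) : state :=
  State (sv s) (sa s) (rcons (so s) v) (tm s).+1.

(* An upper bound on how much [e] can exceed the largest stored value. *)
Fixpoint growth (e : expr) : option nat :=
  match e with
  | EV _ | EIn _ | EArr _ _ => Some 0
  | EC c => Some c
  | EOp OpAdd e1 (EC c) => omap (addn c) (growth e1)
  | EOp OpSub e1 _ | EOp OpDiv e1 _ | EOp OpMod e1 _ => growth e1
  | EOr _ _ | EAnd _ _ | EEq _ _ | ELt _ _ => Some 1
  | _ => None
  end.

Definition small (e : expr) : bool :=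
  if growth e is Some k then k <= 8 else false.

(** * Big-step semantics with a clock, and rules for total correctness *)

Section Semantics.

Variables (inp : seq nat) (L B : nat).

Fixpoint eval (s : state) (e : expr) : nat :=
  match e with
  | EV x => sv s x
  | EC c => c
  | EIn e => nth 0 inp (eval s e)
  | EArr a e => sa s a (eval s e)
  | EOp o e1 e2 => eval_op o (eval s e1) (eval s e2)
  | EOr e1 e2 => (0 < eval s e1) || (0 < eval s e2)
  | EAnd e1 e2 => (0 < eval s e1) && (0 < eval s e2)
  | EEq e1 e2 => eval s e1 == eval s e2
  | ELt e1 e2 => eval s e1 < eval s e2
  end.

Fixpoint esafe (s : state) (e : expr) : Prop :=
  match e with
  | EV _ | EC _ => True
  | EIn e => esafe s e
  | EArr _ e => esafe s e /\ eval s e < L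
  | EOp _ e1 e2 | EOr e1 e2 | EAnd e1 e2 | EEq e1 e2 | ELt e1 e2 =>
      esafe s e1 /\ esafe s e2
  end.

(* A stored value is at most B or exceeds the values stored before by at most
   8, so that all values are at most B + 8 * tm. *)
Definition okval (s : state) (e : expr) : Prop :=
  if small e then True else eval s e <= B.

(** [bs_out] has no [okval] premise: a value that is only written out is never stored, so it cannot
    feed later growth; as an intermediate value it fits into a word by [eval_weight]. *)
Inductive bigstep : cmd -> state -> state -> Prop :=
  | bs_skip s : bigstep Skip s (tick s)
  | bs_assign x e s : esafe s e -> okval s e ->
      bigstep (x <:- e) s (setv s x (eval s e))
  | bs_store a i e s : esafe s i -> esafe s e -> eval s i < L -> okval s e ->
      bigstep (Store a i e) s (seta s a (eval s i) (eval s e))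
  | bs_out e s : esafe s e -> bigstep (Out e) s (outs s (eval s e))
  | bs_seq c1 c2 s1 s2 s3 : bigstep c1 s1 s2 -> bigstep c2 s2 s3 ->
      bigstep (c1 ;; c2) s1 s3
  | bs_if e c1 c2 s s' : esafe s e ->
      bigstep (if eval s e == 0 then c2 else c1) (tick s) s' ->
      bigstep (If e c1 c2) s s'
  | bs_while_stop e c s : esafe s e -> eval s e = 0 ->
      bigstep (While e c) s (tick s)
  | bs_while_loop e c s s1 s2 : esafe s e -> eval s e != 0 ->
      bigstep c (tick s) s1 -> bigstep (While e c) s1 s2 ->
      bigstep (While e c) s s2.

Definition spec (c : cmd) (s : state) (Q : state -> Prop) : Prop :=
  exists s', bigstep c s s' /\ Q s'.

Lemma spec_skip s (Q : state -> Prop) : Q (tick s) -> spec Skip s Q.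
Proof. by move=> q; exists (tick s); split=> //; constructor. Qed.

Lemma spec_assign x e s (Q : state -> Prop) :
  esafe s e -> okval s e -> Q (setv s x (eval s e)) -> spec (x <:- e) s Q.
Proof. by move=> es ok q; eexists; split; [constructor|]. Qed.

Lemma spec_store a i e s (Q : state -> Prop) :
  esafe s i -> esafe s e -> eval s i < L -> okval s e ->
  Q (seta s a (eval s i) (eval s e)) -> spec (Store a i e) s Q.
Proof. by move=> *; eexists; split; [constructor|]. Qed.

Lemma spec_out e s (Q : state -> Prop) :
  esafe s e -> Q (outs s (eval s e)) -> spec (Out e) s Q.
Proof. by move=> *; eexists; split; [constructor|]. Qed.

Lemma spec_seq c1 c2 s (Q : state -> Prop) :
  spec c1 s (fun s' => spec c2 s' Q) -> spec (c1 ;; c2) s Q.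
Proof.
by move=> [s1 [b1 [s2 [b2 q]]]]; exists s2; split=> //; apply: bs_seq b1 b2.
Qed.

Lemma spec_if e c1 c2 s (Q : state -> Prop) :
  esafe s e ->
  (eval s e != 0 -> spec c1 (tick s) Q) ->
  (eval s e = 0 -> spec c2 (tick s) Q) ->
  spec (If e c1 c2) s Q.
Proof.
move=> es t f; case: (eqVneq (eval s e) 0) => h.
  by have [s' [b q]] := f h; exists s'; split=> //; apply: bs_if; rewrite ?h.
have [s' [b q]] := t h; exists s'; split=> //; apply: bs_if => //.
by rewrite (negPf h).
Qed.

Lemma spec_conseq c s (Q Q' : state -> Prop) :
  spec c s Q -> (forall s', Q s' -> Q' s') -> spec c s Q'.
Proof. by move=> [s' [b q]] h; exists s'; split=> //; apply: h. Qed.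

(** The index of the invariant is a variant; its strict decrease yields termination. *)
Lemma spec_while e c (I : nat -> state -> Prop) j s (Q : state -> Prop) :
  I j s ->
  (forall j s, I j s ->
     [/\ esafe s e, eval s e = 0 -> Q (tick s) &
         eval s e != 0 -> spec c (tick s) (fun s' => exists2 j', j' < j & I j' s')]) ->
  spec (While e c) s Q.
Proof.
move=> + h; elim/ltn_ind: j s => j IH s i.
have [es q l] := h _ _ i.
case: (eqVneq (eval s e) 0) => ne.
  by exists (tick s); split; [apply: bs_while_stop|apply: q].
have [s1 [b1 [j' lt i']]] := l ne.
have [s2 [b2 q2]] := IH _ lt _ i'.
by exists s2; split=> //; apply: bs_while_loop b1 b2.
Qed.

Fixpoint modv (c : cmd) : seq nat :=
  match c with
  | Assign x _ => [:: x]
  | Seq c1 c2 | If _ c1 c2 => modv c1 ++ modv c2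
  | While _ c => modv c
  | _ => [::]
  end.

Fixpoint moda (c : cmd) : seq nat :=
  match c with
  | Store a _ _ => [:: a]
  | Seq c1 c2 | If _ c1 c2 => moda c1 ++ moda c2
  | While _ c => moda c
  | _ => [::]
  end.

Fixpoint silent (c : cmd) : bool :=
  match c with
  | Out _ => false
  | Seq c1 c2 | If _ c1 c2 => silent c1 && silent c2
  | While _ c => silent c
  | _ => true
  end.

(** The footprint of a command is read off its syntax. For a concrete program a frame condition is
    then a closed boolean, proved by [isT] or [//]. *)
Definition same (c : cmd) (s s' : state) : Prop :=
  [/\ forall x, x \notin modv c -> sv s' x = sv s x,
      forall a, a \notin moda c -> sa s' a = sa s a &
      silent c -> so s' = so s].

Lemma same_tick c s : same c s (tick s).
Proof. by []. Qed.

Lemma same_trans c s1 s2 s3 : same c s1 s2 -> same c s2 s3 -> same c s1 s3.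
Proof.
move=> [v1 a1 o1] [v2 a2 o2]; split=> [x h|a h|h].
- by rewrite v2 // v1.
- by rewrite a2 // a1.
- by rewrite o2 // o1.
Qed.

Lemma same_setv c s x v : x \in modv c -> same c s (setv s x v).
Proof.
move=> h; split=> //= y; rewrite eqnE; case: eqP => // ->.
by rewrite h.
Qed.

Lemma same_seta c s a i v : a \in moda c -> same c s (seta s a i v).
Proof.
move=> h; split=> //= b; rewrite eqnE; case: eqP => // ->.
by rewrite h.
Qed.

Lemma same_sub c c' s s' :
  {subset modv c <= modv c'} -> {subset moda c <= moda c'} ->
  (silent c' -> silent c) -> same c s s' -> same c' s s'.
Proof.
move=> sv sa so [v a o]; split=> [x h|b h|h].
- by apply: v; apply: contra h => /sv.
- by apply: a; apply: contra h => /sa.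
- by apply/o/so.
Qed.

Lemma same_incl c c' s s' :
  all (in_mem^~ (ssrbool.mem (modv c'))) (modv c) ->
  all (in_mem^~ (ssrbool.mem (moda c'))) (moda c) ->
  silent c' ==> silent c -> same c s s' -> same c' s s'.
Proof. by move=> /allP hv /allP ha /implyP ho; apply: same_sub. Qed.

Lemma same_bigstep c s s' : bigstep c s s' -> same c s s'.
Proof.
elim=> {c s s'} //=.
- by move=> x e s _ _; split=> //= y; rewrite inE => /negPf; rewrite -eqnE => ->.
- move=> a i e s _ _ _ _; split=> //= b.
  by rewrite inE => /negPf; rewrite -eqnE => ->.
- move=> c1 c2 s1 s2 s3 _ h1 _ h2; apply: same_trans.
    apply: same_sub h1 => [x|x|] /=; rewrite ?mem_cat; try by move=> ->.
    by case/andP.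
  apply: same_sub h2 => [x|x|] /=; rewrite ?mem_cat; try by move=> ->; rewrite orbT.
  by case/andP.
- move=> e c1 c2 s s' _ _; case: ifP => _ h; apply: same_trans (same_tick _ _) _.
    apply: same_sub h => [x|x|] /=; rewrite ?mem_cat; try by move=> ->; rewrite orbT.
    by case/andP.
  apply: same_sub h => [x|x|] /=; rewrite ?mem_cat; try by move=> ->.
  by case/andP.
- move=> e c s s1 s2 _ _ _ h1 _ h2.
  by apply: same_trans (same_tick _ _) _; apply: same_trans h2.
Qed.

Lemma spec_frame c s (Q : state -> Prop) :
  spec c s (fun s' => same c s s' -> Q s') -> spec c s Q.
Proof. by move=> [s' [b q]]; exists s'; split=> //; apply/q/same_bigstep. Qed.

Definition For (x : nat) (e : expr) (c : cmd) : cmd :=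
  x <:- EC 0 ;; While (ELt (EV x) e) (c ;; x <:- EOp OpAdd (EV x) (EC 1)).

(** The state after the increment of the loop counter, with [k.+1] in place of the stored value plus
    1: that the body leaves the counter alone is settled once, in [spec_for]. *)
Definition next (s : state) (x k : nat) : state :=
  State (fun y => if eqn y x then k.+1 else sv s y) (sa s) (so s) (tm s).+1.

(** The bound [e] is evaluated again at every test, hence the hypothesis that it keeps its value in
    all states that differ from [s] within the footprint. The facts [same] handed to the body
    replace the frame part of an invariant, so [J] need only speak of what changes. *)
Lemma spec_for x e c N (J : nat -> state -> Prop) s (Q : state -> Prop) :
  (forall s', same (For x e c) s s' -> esafe s' e /\ eval s' e = N) ->
  x \notin modv c ->
  J 0 (setv s x 0) ->
  (forall k s', k < N -> same (For x e c) s s' -> sv s' x = k -> J k s' ->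
     spec c (tick s') (fun s'' => J k.+1 (next s'' x k))) ->
  (forall s', same (For x e c) s s' -> sv s' x = N -> J N s' -> Q (tick s')) ->
  spec (For x e c) s Q.
Proof.
move=> he hx j0 hb hq; apply: spec_seq; apply: spec_assign => //=.
pose I j s' := [/\ same (For x e c) s s', sv s' x <= N, j = N - sv s' x &
                   J (sv s' x) s'].
apply: (@spec_while _ _ I N).
  split=> //=; rewrite ?eqxx ?subn0 //.
  - split=> //= y; rewrite inE negb_or => /andP[/negPf + _].
    by rewrite eqnE => ->.
  - by rewrite eqnE eqxx.
  - by rewrite eqnE eqxx subn0.
  - by rewrite eqnE eqxx.
move=> j s' [sm le -> Js]; have [ese eve] := he _ sm.
rewrite /= eve; split=> //.
  move=> h; have eN : sv s' x = N by lia.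
  by apply: hq => //; rewrite -eN.
move=> h; have lt : sv s' x < N by lia.
apply: spec_seq; apply: spec_frame.
apply: spec_conseq (hb _ _ lt sm erefl Js) _ => s'' J'' sm''.
have ex : sv s'' x = sv s' x by case: sm'' => -> //=.
apply: spec_assign => //=.
exists (N - (sv s' x).+1); first by lia.
have eqs : setv s'' x (sv s'' x + 1) = next s'' x (sv s' x).
  by rewrite /setv /next ex addn1.
have sm2 : same (For x e c) s (next s'' x (sv s' x)).
  apply: same_trans sm _; apply: same_trans (same_tick _ _) _.
  apply: (@same_trans _ _ s'').
    apply: same_sub sm'' => [y|a|] /=; rewrite ?inE ?mem_cat ?andbT //.
      by move=> ->; rewrite orbT.
    by move=> ->.
  split=> //= y; rewrite inE negb_or => /andP[/negPf + _].
  by rewrite eqnE => ->.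
by rewrite eqs; split=> //=; rewrite eqnE eqxx.
Qed.

Definition bounded (s : state) : Prop :=
  [/\ forall x, sv s x <= B + 8 * tm s & forall a i, sa s a i <= B + 8 * tm s].

Lemma eval_growth s e k A : growth e = Some k ->
  (forall x, sv s x <= A) -> (forall a i, sa s a i <= A) ->
  (forall i, nth 0 inp i <= A) -> eval s e <= A + k.
Proof.
move=> + hv ha hi; elim: e k => //=.
- by move=> x k [<-]; rewrite addn0.
- by move=> c k [<-]; rewrite leq_addl.
- by move=> e _ k [<-]; rewrite addn0.
- by move=> a e _ k [<-]; rewrite addn0.
- case=> e1 IH1 e2 _ k //=.
  + case: e2 => //= c; case: (growth e1) IH1 => //= g IH1 [<-].
    by have := IH1 _ erefl; lia.
  + by move/IH1; apply: leq_trans; apply: leq_subr.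
  + by move/IH1; apply: leq_trans; apply: leq_div.
  + by move/IH1; apply: leq_trans; apply: leq_mod.
- by move=> e1 _ e2 _ k [<-]; lia.
- by move=> e1 _ e2 _ k [<-]; lia.
- by move=> e1 _ e2 _ k [<-]; lia.
- by move=> e1 _ e2 _ k [<-]; lia.
Qed.

Hypothesis inp_le : forall i, nth 0 inp i <= B.

Lemma okval_le s e : okval s e -> bounded s ->
  eval s e <= B + 8 * (tm s).+1.
Proof.
rewrite /okval /small => ok [hv ha].
case gr: growth ok => [k|]; last by lia.
case: ifP => [le _|_]; last by lia.
have hi i : nth 0 inp i <= B + 8 * tm s by have := inp_le i; lia.
by have := eval_growth gr hv ha hi; lia.
Qed.

Lemma bigstep_tm c s s' : bigstep c s s' -> tm s <= tm s'.
Proof. elim=> {c s s'} //=; lia. Qed.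

Lemma bigstep_bounded c s s' : bigstep c s s' -> bounded s -> bounded s'.
Proof.
have T s0 : bounded s0 -> bounded (tick s0).
  by move=> [h1 h2]; split=> [x|a i] /=; [have := h1 x|have := h2 a i]; lia.
elim=> {c s s'} //=; eauto.
- move=> x e s _ ok b; have := okval_le ok b; case: b => hv ha le.
  by split=> [y|a i] /=; [case: ifP => _ //; have := hv y|have := ha a i]; lia.
- move=> a i e s _ _ _ ok b; have := okval_le ok b; case: b => hv ha le.
  split=> [y|b j] /=; first by have := hv y; lia.
  by case: ifP => _; [case: ifP => _ //; have := ha a j|have := ha b j]; lia.
- by move=> e s _ /T.
Qed.

End Semantics.

(** * Compilation to the RAM: results, time and word size *)

Section Compiler.

(* Variable x lives in cell x < NV, cell NV always contains 0, the cells from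
   NV + 1 to K - 1 are temporaries, and entry i of array a < K is in cell
   K * i.+1 + a. *)
Variables (NV K : nat).

(** Subtraction is truncated, so 1 - (1 - x) is 0 for x = 0 and 1 otherwise. *)
Definition normalize (d : nat) : program :=
  [:: Const d.+1 1; Arith OpSub d d.+1 d; Arith OpSub d d.+1 d].

Definition caddr (a d : nat) : program :=
  [:: Const d.+1 K; Arith OpMul d d d.+1; Const d.+1 (K + a);
      Arith OpAdd d d d.+1].

(** The value is left in cell [d], and operands are stacked in the cells after it. Adding cell [NV],
    which is 0, serves as a move. Equality is tested by 1 - ((x - y) + (y - x)) with truncated
    subtraction. *)
Fixpoint cexp (e : expr) (d : nat) : program :=
  match e with
  | EV x => [:: Arith OpAdd d x NV]
  | EC c => [:: Const d c]
  | EIn e => cexp e d ++ [:: ReadInput d d]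
  | EArr a e => cexp e d ++ caddr a d ++ [:: LoadInd d d]
  | EOp o e1 e2 => cexp e1 d ++ cexp e2 d.+1 ++ [:: Arith o d d d.+1]
  | EOr e1 e2 =>
      cexp e1 d ++ cexp e2 d.+1 ++ Arith OpAdd d d d.+1 :: normalize d
  | EAnd e1 e2 =>
      cexp e1 d ++ cexp e2 d.+1 ++ Arith OpMul d d d.+1 :: normalize d
  | EEq e1 e2 =>
      cexp e1 d ++ cexp e2 d.+1 ++
        [:: Arith OpSub d.+2 d d.+1; Arith OpSub d d.+1 d;
            Arith OpAdd d d d.+2; Const d.+1 1; Arith OpSub d d.+1 d]
  | ELt e1 e2 =>
      cexp e1 d ++ cexp e2 d.+1 ++ Arith OpSub d d.+1 d :: normalize d
  end.

Fixpoint comp (c : cmd) (pc : nat) : program :=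
  match c with
  | Skip => [::]
  | Assign x e => cexp e NV.+1 ++ [:: Arith OpAdd x NV.+1 NV]
  | Store a i e =>
      cexp i NV.+1 ++ caddr a NV.+1 ++ cexp e NV.+2 ++ [:: StoreInd NV.+1 NV.+2]
  | Out e => cexp e NV.+1 ++ [:: Write NV.+1]
  | Seq c1 c2 => let p1 := comp c1 pc in p1 ++ comp c2 (pc + size p1)
  | If e c1 c2 =>
      let pe := cexp e NV.+1 in
      let p1 := comp c1 (pc + size pe).+1 in
      let l2 := (pc + size pe + size p1).+2 in
      let p2 := comp c2 l2 in
      pe ++ JumpZ NV.+1 l2 :: p1 ++ Jump (l2 + size p2) :: p2
  | While e c1 =>
      let pe := cexp e NV.+1 in
      let p1 := comp c1 (pc + size pe).+1 in
      pe ++ JumpZ NV.+1 (pc + size pe + size p1).+2 :: p1 ++ [:: Jump pc]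
  end.

(** The number of cells needed from [d] on: an address computation takes a second cell, the equality
    test a third. *)
Fixpoint depth (e : expr) : nat :=
  match e with
  | EV _ | EC _ => 1
  | EIn e => depth e
  | EArr _ e => maxn 2 (depth e)
  | EOp _ e1 e2 | EOr e1 e2 | EAnd e1 e2 | EEq e1 e2 | ELt e1 e2 =>
      maxn 3 (maxn (depth e1) (depth e2).+1)
  end.

(* Intermediate values are at most A ^ weight e if stored values are at most A. *)
Fixpoint weight (e : expr) : nat :=
  match e with
  | EV _ | EC _ => 1
  | EIn e | EArr _ e => weight e
  | EOp _ e1 e2 | EOr e1 e2 | EAnd e1 e2 | EEq e1 e2 | ELt e1 e2 =>
      weight e1 + weight e2
  end.

Variables (D M : nat).

Fixpoint ewf0 (e : expr) : bool :=
  match e with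
  | EV x => x < NV
  | EC c => c <= M
  | EIn e => ewf0 e
  | EArr a e => (a < K) && ewf0 e
  | EOp _ e1 e2 | EOr e1 e2 | EAnd e1 e2 | EEq e1 e2 | ELt e1 e2 =>
      ewf0 e1 && ewf0 e2
  end.

(** Expressions are compiled at [NV.+1] or, for the value of a [Store], at [NV.+2]; hence the offset
    2. *)
Definition ewf (e : expr) : bool :=
  [&& ewf0 e, weight e <= D & depth e + NV + 2 < K].

Fixpoint cwf (c : cmd) : bool :=
  match c with
  | Skip => true
  | Assign x e => (x < NV) && ewf e
  | Store a i e => [&& a < K, ewf i & ewf e]
  | Out e => ewf e
  | Seq c1 c2 => cwf c1 && cwf c2
  | If e c1 c2 => [&& ewf e, cwf c1 & cwf c2]
  | While e c => ewf e && cwf c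
  end.

Variables (inp : seq nat) (L B A space word : nat).
Hypotheses (NVK : NV + 3 <= K) (A2 : 1 < A) (MA : M <= A) (LA : K * L.+1 <= A)
  (inpA : forall i, nth 0 inp i <= A)
  (spaceP : K * L.+1 <= space) (wordP : A ^ D < word).

Notation exec := (exec space word inp).

Definition lrun (l : program) (oc : option config) : option config :=
  foldl (fun oc ins => obind (exec ins) oc) oc l.

Lemma lrun_cat l1 l2 oc : lrun (l1 ++ l2) oc = lrun l2 (lrun l1 oc).
Proof. exact: foldl_cat. Qed.

Definition upd (mem : nat -> nat) (a v : nat) : nat -> nat :=
  fun b => if b == a then v else mem b.

Lemma K_space x : x < K -> x < space.
Proof. by move=> h; nia. Qed.

Lemma const_ok i v p mem o : i < K -> v < word ->
  exec (Const i v) (Config p mem o) = Some (Config p.+1 (upd mem i v) o).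
Proof. by move=> /K_space h1 h2; rewrite /= /write_cell h1 h2. Qed.

Lemma arith_ok op i j k p mem o : i < K -> j < K -> k < K ->
  eval_op op (mem j) (mem k) < word ->
  exec (Arith op i j k) (Config p mem o) =
    Some (Config p.+1 (upd mem i (eval_op op (mem j) (mem k))) o).
Proof.
move=> /K_space h1 /K_space h2 /K_space h3 h4.
by rewrite /= /read_cell h2 h3 /= /write_cell h1 h4.
Qed.

Lemma A_word e v : 0 < e -> e <= D -> v <= A ^ e -> v < word.
Proof.
move=> e0 eD h; apply: leq_ltn_trans wordP; apply: leq_trans h _.
by rewrite leq_pexp2l //; lia.
Qed.

Lemma A_exp_add p q x y : 0 < p -> 0 < q -> x <= A ^ p -> y <= A ^ q ->
  x + y <= A ^ (p + q).
Proof.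
move=> p0 q0 hx hy; rewrite expnD.
have : 2 <= A ^ p by apply: leq_trans A2 _; rewrite -{1}(expn1 A) leq_pexp2l //; lia.
have : 2 <= A ^ q by apply: leq_trans A2 _; rewrite -{1}(expn1 A) leq_pexp2l //; lia.
by nia.
Qed.

Lemma A_exp_op o p q x y : 0 < p -> 0 < q -> x <= A ^ p -> y <= A ^ q ->
  eval_op o x y <= A ^ (p + q).
Proof.
move=> p0 q0 hx hy.
have hA : A ^ p <= A ^ (p + q) by rewrite leq_pexp2l ?leq_addr //; lia.
case: o => /=.
- exact: A_exp_add.
- by apply: leq_trans (leq_subr _ _) _; apply: leq_trans hA.
- by rewrite expnD leq_mul.
- by apply: leq_trans (leq_div _ _) _; apply: leq_trans hA.
- by apply: leq_trans (leq_mod _ _) _; apply: leq_trans hA.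
Qed.

Lemma weight_gt0 e : 0 < weight e.
Proof. by elim: e => //= *; lia. Qed.

Definition stored (s : state) : Prop :=
  (forall x, sv s x <= A) /\ (forall a i, sa s a i <= A).

Lemma A_pow p x : 0 < p -> x <= A -> x <= A ^ p.
Proof.
by move=> p0 h; apply: leq_trans h _; rewrite -{1}(expn1 A) leq_pexp2l //; lia.
Qed.

Lemma eval_weight s e : ewf0 e -> stored s -> eval inp s e <= A ^ weight e.
Proof.
move=> + [hv ha]; elim: e => //=.
- by move=> c h; apply: leq_trans h _.
- by move=> e IH h; apply: A_pow; rewrite ?weight_gt0.
- by move=> a e IH h; apply: A_pow; rewrite ?weight_gt0.
- by move=> o e1 IH1 e2 IH2 /andP[h1 h2]; apply: A_exp_op; rewrite ?weight_gt0 ?IH1 ?IH2.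
all: move=> e1 _ e2 _ _; apply: A_pow; [by have := weight_gt0 e1; lia | by lia].
Qed.

Definition represents (s : state) (mem : nat -> nat) : Prop :=
  [/\ forall x, x < NV -> mem x = sv s x,
      forall a i, a < K -> i < L -> mem (K * i.+1 + a) = sa s a i &
      mem NV = 0].

Lemma represents_agree s mem mem' :
  (forall a, (a <= NV) || (K <= a) -> mem' a = mem a) ->
  represents s mem -> represents s mem'.
Proof.
move=> ag [h1 h2 h3]; split=> [x lt|a i ha hi|].
- by rewrite ag ?h1 // ltnW.
- rewrite ag ?h2 //; have : K <= K * i.+1 by rewrite leq_pmulr.
  by lia.
- by rewrite ag ?h3 ?leqnn.
Qed.

(** The frame clause protects the variables, the zero cell and the operands already computed, all
    below [d], as well as the arrays, which begin at [K]. *)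
Definition computes (l : program) (p : nat) (mem : nat -> nat) (o : seq nat)
    (d v : nat) : Prop :=
  exists mem', [/\ lrun l (Some (Config p mem o)) =
                     Some (Config (p + size l) mem' o),
    mem' d = v & forall a, (a < d) || (K <= a) -> mem' a = mem a].

Lemma computes_cat l1 l2 p mem o d v1 v2 :
  computes l1 p mem o d v1 ->
  (forall mem', mem' d = v1 -> (forall a, (a < d) || (K <= a) -> mem' a = mem a) ->
    computes l2 (p + size l1) mem' o d v2) ->
  computes (l1 ++ l2) p mem o d v2.
Proof.
move=> [m1 [r1 e1 a1]] h; have [m2 [r2 e2 a2]] := h _ e1 a1.
exists m2; split=> // [|a ha]; last by rewrite a2 ?a1.
by rewrite lrun_cat r1 r2 size_cat addnA.
Qed.

(* The second operand is computed one cell higher and leaves the first alone. *)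
Lemma computes_cat2 l1 l2 l3 p mem o d v1 v2 v3 : d < K ->
  computes l1 p mem o d v1 ->
  (forall mem', (forall a, (a < d) || (K <= a) -> mem' a = mem a) ->
    computes l2 (p + size l1) mem' o d.+1 v2) ->
  (forall mem', mem' d = v1 -> mem' d.+1 = v2 ->
    computes l3 (p + size (l1 ++ l2)) mem' o d v3) ->
  computes (l1 ++ l2 ++ l3) p mem o d v3.
Proof.
move=> dK [m1 [r1 e1 a1]] h2 h3; have [m2 [r2 e2 a2]] := h2 _ a1.
have e1' : m2 d = v1 by rewrite a2 ?ltnSn.
have [m3 [r3 e3 a3]] := h3 _ e1' e2.
exists m3; split=> // [|a ha].
  by rewrite catA lrun_cat lrun_cat r1 r2 -addnA -size_cat r3 !size_cat !addnA.
rewrite a3 // a2 ?a1 //; case/orP: ha => [ha|->]; last by rewrite orbT.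
by rewrite ltnW.
Qed.

Lemma computes_nil p mem o d : computes [::] p mem o d (mem d).
Proof. by exists mem; rewrite addn0. Qed.

Lemma computes_step ins l p mem o d e w v :
  d <= e < K ->
  exec ins (Config p mem o) = Some (Config p.+1 (upd mem e w) o) ->
  computes l p.+1 (upd mem e w) o d v ->
  computes (ins :: l) p mem o d v.
Proof.
move=> /andP[de eK] h [m' [r e' a']]; exists m'; split=> //.
  by rewrite /= h r addSnnS.
move=> a ha; rewrite a' // /upd; case: eqVneq ha => // ->; lia.
Qed.

Lemma upd_same mem a v : upd mem a v a = v.
Proof. by rewrite /upd eqxx. Qed.

Lemma upd_shift mem d v :
  (upd mem d.+1 v d = mem d) * (upd mem d.+2 v d = mem d) *
  (upd mem d v d.+1 = mem d.+1) * (upd mem d.+2 v d.+1 = mem d.+1) *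
  (upd mem d v d.+2 = mem d.+2) * (upd mem d.+1 v d.+2 = mem d.+2).
Proof. by rewrite /upd; do !split; case: eqP => //; lia. Qed.

Definition updE := (upd_same, upd_shift).

Lemma computes_arith op i j k l p mem o d v : d <= i -> i < K -> j < K -> k < K ->
  eval_op op (mem j) (mem k) < word ->
  computes l p.+1 (upd mem i (eval_op op (mem j) (mem k))) o d v ->
  computes (Arith op i j k :: l) p mem o d v.
Proof.
move=> di iK jK kK w; apply: computes_step; first by rewrite di iK.
exact: arith_ok.
Qed.

Lemma computes_const i c l p mem o d v : d <= i -> i < K -> c < word ->
  computes l p.+1 (upd mem i c) o d v ->
  computes (Const i c :: l) p mem o d v.
Proof.
move=> di iK w; apply: computes_step; first by rewrite di iK.
exact: const_ok.
Qed.

Lemma computes_eq l p mem o d v v' :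
  computes l p mem o d v -> v = v' -> computes l p mem o d v'.
Proof. by move=> h <-. Qed.

Lemma computes_normalize p mem o d : d.+1 < K -> 1 < word ->
  computes (normalize d) p mem o d (0 < mem d).
Proof.
move=> dK w1.
apply: computes_const => //; try lia.
apply: computes_arith; rewrite ?updE /=; try lia.
apply: computes_arith; rewrite ?updE /=; try lia.
by apply: computes_eq (computes_nil _ _ _ _) _; rewrite ?updE; lia.
Qed.

Lemma computes_caddr a p mem o d i : d.+1 < K -> a < K -> A < word ->
  mem d = i -> i < L ->
  computes (caddr a d) p mem o d (K * i.+1 + a).
Proof.
move=> dK aK Aw di iL; have hA : K * i + (K + a) <= A by nia.
have hK : K * i <= A by lia.
apply: computes_const; try lia.
apply: computes_arith; rewrite ?updE /=; try lia.
apply: computes_const; rewrite ?updE /=; try lia.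
apply: computes_arith; rewrite ?updE /=; try lia.
by apply: computes_eq (computes_nil _ _ _ _) _; rewrite ?updE /= di; lia.
Qed.

Lemma cexp_ok e s d p mem o :
  ewf0 e -> weight e <= D -> NV < d -> d + depth e < K ->
  represents s mem -> stored s -> esafe inp L s e ->
  computes (cexp e d) p mem o d (eval inp s e).
Proof.
move=> + + + + + st; have w1 (x : nat) : x <= A -> 0 < D -> x < word.
  by move=> h D0; apply: (@A_word 1); rewrite ?expn1.
have ag d' mem' mem'' : NV < d' ->
    (forall a, (a < d') || (K <= a) -> mem'' a = mem' a) ->
    represents s mem' -> represents s mem''.
  by move=> dd h; apply: represents_agree => a ha; apply: h; lia.
elim: e d p mem => /=.
- move=> x d p mem hx D1 dd dK [rv ra r0] _.
  apply: computes_arith; rewrite ?r0 ?(rv _ hx) /=; try lia.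
    by apply: w1 => //; case: st => h _; have := h x; lia.
  by apply: computes_eq (computes_nil _ _ _ _) _; rewrite ?updE; lia.
- move=> c d p mem hc D1 dd dK r _.
  apply: computes_const; try lia.
    by apply: w1 => //; lia.
  by apply: computes_eq (computes_nil _ _ _ _) _; rewrite ?updE.
- move=> e IH d p mem wf D1 dd dK r es; have D0 := weight_gt0 e.
  apply: computes_cat (IH d p mem _ _ _ _ _ _) _ => // mem' e' a'.
  apply: (@computes_step _ _ _ _ _ _ d (nth 0 inp (eval inp s e))); first lia.
    rewrite /= /read_cell (K_space _) /=; last by lia.
    rewrite /write_cell (K_space _) /= ?e' ?w1 //; lia.
  by apply: computes_eq (computes_nil _ _ _ _) _; rewrite ?updE.
- move=> a e IH d p mem /andP[aK wf] D1 dd dK r [es iL]; have D0 := weight_gt0 e.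
  apply: computes_cat (IH d p mem _ _ _ _ _ _) _ => //; first lia.
  move=> mem' e' a'.
  apply: computes_cat (computes_caddr _ _ _ _ _ e' _) _ => //; try lia.
    by apply: w1 => //; lia.
  move=> mem'' e'' a''.
  have r' : represents s mem''.
    apply: ag dd _ r => b hb; rewrite a'' ?a' //.
  case: (r') => _ ra _.
  apply: (@computes_step _ _ _ _ _ _ d (sa s a (eval inp s e))); first lia.
    rewrite /= /read_cell (K_space _) /= ?e''; last by lia.
    have -> : K * (eval inp s e).+1 + a < space by nia.
    rewrite /= ra // /write_cell (K_space _) /=; last by lia.
    by rewrite w1 //; [case: st|lia].
  by apply: computes_eq (computes_nil _ _ _ _) _; rewrite ?updE.
(* The binary cases are treated together. [EOp] is rotated to the end, since it alone has an
   operator to introduce. *)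
all: cycle 1.
5: move=> o0.
all: move=> e1 IH1 e2 IH2 d p mem /andP[wf1 wf2] D1 dd dK r [es1 es2].
all: have W1 := weight_gt0 e1; have W2 := weight_gt0 e2.
all: have v1 := eval_weight wf1 st; have v2 := eval_weight wf2 st.
all: have lw x : x <= A ^ (weight e1 + weight e2) -> x < word
       by apply: A_word; lia.
all: apply: (computes_cat2 _ (IH1 d p mem _ _ _ _ _ _)) => //; try lia;
  [by move=> mem' a'; apply: IH2 => //; try lia; apply: ag dd a' r|].
all: move=> mem' e1' e2'.
- apply: computes_arith; rewrite ?e1' ?e2' /=; try lia.
    by apply/lw/A_exp_add.
  apply: computes_eq (computes_normalize _ _ _ _ _) _; rewrite ?updE; try lia; try (by apply: w1; lia).
- apply: computes_arith; rewrite ?e1' ?e2' /=; try lia.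
    by apply/lw; rewrite expnD leq_mul.
  apply: computes_eq (computes_normalize _ _ _ _ _) _; rewrite ?updE; try lia; try (by apply: w1; lia).
- have hs : eval inp s e1 + eval inp s e2 < word by apply/lw/A_exp_add.
  apply: computes_arith; rewrite ?updE ?e1' ?e2' /=; try lia.
  apply: computes_arith; rewrite ?updE ?e1' ?e2' /=; try lia.
  apply: computes_arith; rewrite ?updE ?e1' ?e2' /=; try lia.
  apply: computes_const; rewrite ?updE ?e1' ?e2' /=; try lia; try (by apply: w1; lia).
  apply: computes_arith; rewrite ?updE ?e1' ?e2' /=; try lia; try (by apply: w1; lia).
  apply: computes_eq (computes_nil _ _ _ _) _; rewrite ?updE ?e1' ?e2'.
  by lia.
- have hs : eval inp s e1 + eval inp s e2 < word by apply/lw/A_exp_add.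
  apply: computes_arith; rewrite ?updE ?e1' ?e2' /=; try lia.
  apply: computes_eq (computes_normalize _ _ _ _ _) _; rewrite ?updE; try lia; try (by apply: w1; lia).
- apply: computes_arith; rewrite ?updE ?e1' ?e2' /=; try lia.
    by apply/lw/A_exp_op.
  by apply: computes_eq (computes_nil _ _ _ _) _; rewrite ?updE.
Qed.

Definition straight (ins : instr) : bool :=
  match ins with Jump _ | JumpZ _ _ | Halt => false | _ => true end.

Lemma straight_cexp e d : all straight (cexp e d).
Proof.
elim: e d => //= [e IH|a e IH|o e IH e' IH'|e IH e' IH'|e IH e' IH'|e IH e' IH'|
  e IH e' IH'] d.
all: by rewrite !all_cat IH ?IH'.
Qed.

Lemma exec_pc ins c c' : straight ins -> exec ins c = Some c' -> pc c' = (pc c).+1.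
Proof.
have w a v : write_cell space word c a v = Some c' -> pc c' = (pc c).+1.
  by rewrite /write_cell; case: ifP => // _ [<-].
case: ins => //= [i v|o i j k|i j|i j|i j|i] _; rewrite /read_cell;
  do ?(case: ifP => //= _); try exact: w.
by case=> <-.
Qed.

Definition code_at (P : program) (p : nat) (l : program) : Prop :=
  exists pre post, P = pre ++ l ++ post /\ size pre = p.

Lemma code_at_cat P p l1 l2 : code_at P p (l1 ++ l2) ->
  code_at P p l1 /\ code_at P (p + size l1) l2.
Proof.
move=> [pre [post [-> sz]]]; split.
  by exists pre, (l2 ++ post); rewrite -catA.
by exists (pre ++ l1), post; rewrite size_cat sz -!catA.
Qed.

Lemma code_at_cons P p ins l : code_at P p (ins :: l) ->
  onth P p = Some ins /\ code_at P p.+1 l.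
Proof.
move=> [pre [post [-> sz]]]; split.
  by rewrite onth_cat sz ltnn subnn.
by exists (rcons pre ins), post; rewrite size_rcons sz -cats1 -catA.
Qed.

Variable P : program.

Definition runs (t : nat) (c c' : config) : Prop :=
  iter t (obind (step space word P inp)) (Some c) = Some c'.

Lemma runs_trans t1 t2 c1 c2 c3 :
  runs t1 c1 c2 -> runs t2 c2 c3 -> runs (t2 + t1) c1 c3.
Proof. by rewrite /runs iterD => ->. Qed.

Lemma runs1 ins c c' : onth P (pc c) = Some ins -> exec ins c = Some c' ->
  runs 1 c c'.
Proof. by move=> h1 h2; rewrite /runs /= /step h1. Qed.

Lemma runs_lrun l c c' : all straight l -> code_at P (pc c) l ->
  lrun l (Some c) = Some c' -> runs (size l) c c'.
Proof.
elim: l c => [c _ _ [<-] //|ins l IH c /= /andP[si sl] /code_at_cons[hi hl]].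
have none l' : lrun l' None = None by elim: l'.
case ex : (exec ins c) => [c1|] /=; last by rewrite none.
move=> r; rewrite -addn1; apply: runs_trans (runs1 hi ex) _.
by apply: IH => //; rewrite (exec_pc si ex).
Qed.

Lemma runs_cexp e s p mem o d : code_at P p (cexp e d) ->
  ewf e -> NV < d <= NV.+2 -> represents s mem -> stored s -> esafe inp L s e ->
  exists mem', [/\ runs (size (cexp e d)) (Config p mem o)
                     (Config (p + size (cexp e d)) mem' o),
    mem' d = eval inp s e, represents s mem' &
    forall a, (a < d) || (K <= a) -> mem' a = mem a].
Proof.
move=> at_e /and3P[wf wD dK] hd r st es.
have [mem' [l e' a']] : computes (cexp e d) p mem o d (eval inp s e).
  by apply: cexp_ok => //; lia.
exists mem'; split=> //; first by apply: runs_lrun l; rewrite ?straight_cexp.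
by apply: represents_agree r => a ha; apply: a'; lia.
Qed.

Hypothesis inpB : forall i, nth 0 inp i <= B.

Lemma represents_setv s mem x v : x < NV -> represents s mem ->
  represents (setv s x v) (upd mem x v).
Proof.
move=> xN [rv ra r0]; split=> [y yN|a i aK iL|] /=; rewrite /upd.
- by rewrite rv // eqnE.
- case: eqP => [h|_]; last exact: ra.
  have : K <= K * i.+1 by rewrite leq_pmulr.
  by lia.
- by case: eqP => [h|//]; lia.
Qed.

Lemma represents_seta s mem a i v : a < K -> represents s mem ->
  represents (seta s a i v) (upd mem (K * i.+1 + a) v).
Proof.
move=> aK [rv ra r0].
have hK : K <= K * i.+1 by rewrite leq_pmulr.
split=> [y yN|b j bK jL|] /=; rewrite /upd.
- by case: eqP => [h|_]; [lia|apply: rv].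
- rewrite eqnE; case: (eqVneq b a) => [->|ne].
    by rewrite eqn_add2r eqn_pmul2l ?eqSS ?ra //; lia.
  case: eqP => [h|_]; last exact: ra.
  (* The arrays are interleaved: cells of different arrays differ modulo [K]. *)
  have := congr1 (modn^~ K) h.
  by rewrite /= !(mulnC K) !modnMDl !modn_small // => /eqP; rewrite (negPf ne).
- by case: eqP => [h|//]; lia.
Qed.

Lemma represents_state s s' mem : sv s = sv s' -> sa s = sa s' -> represents s mem -> represents s' mem.
Proof. by rewrite /represents => -> ->. Qed.

Lemma straight_caddr a d : all straight (caddr a d).
Proof. by []. Qed.

#[local] Opaque caddr.

(** Every tick pays for [kappa] machine steps. The steps charged to one tick are distinct
    instructions of a single command, so any [kappa] that is at least the length of its code will
    do; quantifying over it lets inner commands be charged at the rate of the whole program. *)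
Lemma comp_ok c s s' : bigstep inp L B c s s' ->
  forall p mem kappa, code_at P p (comp c p) -> size (comp c p) <= kappa -> cwf c ->
    represents s mem -> bounded B s -> B + 8 * tm s' <= A ->
  exists t mem', [/\ runs t (Config p mem (so s))
                       (Config (p + size (comp c p)) mem' (so s')),
    t + kappa * tm s <= kappa * tm s' & represents s' mem'].
Proof.
have stoS s0 : bounded B s0 -> B + 8 * tm s0 <= A -> stored s0.
  by move=> [hv ha] le; split=> [x|a i]; [apply: leq_trans (hv x) le|
    apply: leq_trans (ha a i) le].
have bT s0 : bounded B s0 -> bounded B (tick s0).
  by move=> [h1 h2]; split=> [x|a i] /=; [have := h1 x|have := h2 a i]; lia.
elim=> {c s s'} /=.
- move=> s p mem kappa _ _ _ r _ _; exists 0, mem; rewrite addn0; split=> //.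
  by lia.
- move=> x e s es ok p mem kappa; rewrite size_cat => /code_at_cat[at1 at2] sz.
  move=> /andP[xN wf] r b le.
  have sto : stored s by apply: stoS => //; lia.
  have Ne : NV < NV.+1 <= NV.+2 by lia.
  have [mem' [r1 e1 rel1 _]] := runs_cexp (so s) at1 wf Ne r sto es.
  exists (1 + size (cexp e NV.+1)), (upd mem' x (eval inp s e)).
  split; [|by rewrite mulnS /=; move: sz => /=; lia|exact: represents_setv].
  apply: runs_trans r1 _; rewrite addnA addn1.
  apply: (@runs1 (Arith OpAdd x NV.+1 NV)); first by case: (code_at_cons at2).
  case: (rel1) => _ _ z0.
  case/and3P: wf => wf0 wD _; have w0 := weight_gt0 e.
  rewrite arith_ok /= ?e1 ?z0 ?addn0 //; try lia.
  by apply: A_word wD _ => //; apply: eval_weight.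
- move=> a i e s esi ese iL ok p mem kappa.
  rewrite !size_cat => /code_at_cat[at1 /code_at_cat[at2 /code_at_cat[at3 at4]]] sz.
  move=> /and3P[aK wfi wfe] r b le.
  have sto : stored s by apply: stoS => //; lia.
  have Ne : NV < NV.+1 <= NV.+2 by lia.
  have Ne2 : NV < NV.+2 <= NV.+2 by lia.
  have [mem1 [r1 e1 rel1 _]] := runs_cexp (so s) at1 wfi Ne r sto esi.
  have wi := weight_gt0 i.
  have A_lt : A < word.
    by apply: (@A_word 1); rewrite ?expn1 //; case/and3P: wfi; lia.
  have N1K : NV.+2 < K by lia.
  have [mem2 [l2 e2 a2]] :=
    computes_caddr (p + size (cexp i NV.+1)) (so s) N1K aK A_lt e1 iL.
  have r2 := @runs_lrun _ (Config (p + size (cexp i NV.+1)) mem1 (so s)) _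
    (straight_caddr a NV.+1) at2 l2.
  have rel2 : represents s mem2.
    by apply: represents_agree rel1 => b' hb; apply: a2; lia.
  have [mem3 [r3 e3 rel3 a3]] := runs_cexp (so s) at3 wfe Ne2 rel2 sto ese.
  exists (1 + (size (cexp e NV.+2) + (size (caddr a NV.+1) + size (cexp i NV.+1)))).
  exists (upd mem3 (K * (eval inp s i).+1 + a) (eval inp s e)).
  split; [|by rewrite mulnS /=; move: sz => /=; lia|exact: represents_seta].
  apply: runs_trans; first exact: runs_trans (runs_trans r1 r2) r3.
  have -> : p + (size (cexp i NV.+1) + (size (caddr a NV.+1) + (size (cexp e NV.+2) + 1))) =
    (p + size (cexp i NV.+1) + size (caddr a NV.+1) + size (cexp e NV.+2)).+1.
    by lia.
  apply: (@runs1 (StoreInd NV.+1 NV.+2)); first by case: (code_at_cons at4).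
  rewrite /= /read_cell !K_space //=; try lia.
  rewrite e3 a3 ?e2; last by rewrite ltnSn.
  rewrite /= /write_cell.
  have -> : K * (eval inp s i).+1 + a < space by nia.
  case/and3P: wfe => wf0 wD _.
  by rewrite (A_word _ wD (eval_weight wf0 sto)) ?weight_gt0.
- move=> e s es p mem kappa; rewrite size_cat => /code_at_cat[at1 at2] sz wf r b le.
  have sto : stored s by apply: stoS => //; lia.
  have Ne : NV < NV.+1 <= NV.+2 by lia.
  have [mem' [r1 e1 rel1 _]] := runs_cexp (so s) at1 wf Ne r sto es.
  exists (1 + size (cexp e NV.+1)), mem'; split; [|by rewrite mulnS /=; move: sz => /=; lia|by []].
  apply: runs_trans r1 _; rewrite addnA addn1.
  apply: (@runs1 (Write NV.+1)); first by case: (code_at_cons at2).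
  by rewrite /= /read_cell K_space /= ?e1 //; lia.
- move=> c1 c2 s1 s2 s3 b1 IH1 b2 IH2 p mem kappa.
  rewrite size_cat => /code_at_cat[at1 at2] sz /andP[wf1 wf2] r b le.
  have t12 := bigstep_tm b1; have t23 := bigstep_tm b2.
  have le2 : B + 8 * tm s2 <= A by lia.
  have sz1 : size (comp c1 p) <= kappa by lia.
  have sz2 : size (comp c2 (p + size (comp c1 p))) <= kappa by lia.
  have [ta [mem1 [ra la rel1]]] := IH1 p mem kappa at1 sz1 wf1 r b le2.
  have [tb [mem2 [rb lb rel2]]] :=
    IH2 _ mem1 kappa at2 sz2 wf2 rel1 (bigstep_bounded inpB b1 b) le.
  exists (tb + ta), mem2; split=> //; last by lia.
  by rewrite addnA; apply: runs_trans ra rb.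
- move=> e c1 c2 s s' es bs IH p mem kappa.
  set pe := cexp e NV.+1; set p1 := comp c1 _; set l2 := (_ + size p1).+2.
  set p2 := comp c2 l2.
  rewrite size_cat /= size_cat /= => /code_at_cat[at1 /code_at_cons[at2 /code_at_cat[at3]]].
  move=> /code_at_cons[at4 at5] sz /and3P[wf wf1 wf2] r b le.
  have ts : (tm s).+1 <= tm s' := bigstep_tm bs.
  have sto : stored s by apply: stoS => //; lia.
  have Ne : NV < NV.+1 <= NV.+2 by lia.
  have [mem' [r1 e1 rel1 _]] := runs_cexp (so s) at1 wf Ne r sto es.
  have relt : represents (tick s) mem' by exact: represents_state rel1.
  have N1s : NV.+1 < space by apply: K_space; lia.
  have rj : runs 1 (Config (p + size pe) mem' (so s))
      (Config (if eval inp s e == 0 then l2 else (p + size pe).+1) mem' (so s)).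
    by apply: runs1; first exact: at2; rewrite /= /read_cell N1s /= e1.
  move: bs IH rj; case: ifP => _ bs IH rj.
    have sz2 : size p2 <= kappa by lia.
    have at5' : code_at P l2 p2.
      by move: at5; congr code_at; rewrite /l2; lia.
    have [t [mem2 [r2 l r3]]] := IH _ mem' kappa at5' sz2 wf2 relt (bT _ b) le.
    exists (t + (1 + size pe)), mem2; split=> //.
      have -> : p + (size pe + (size p1 + (size p2).+1).+1) = l2 + size p2.
        by rewrite /l2; lia.
      exact: runs_trans (runs_trans r1 rj) r2.
    by move: l; rewrite /= mulnS; lia.
  have sz1 : size p1 <= kappa by lia.
  have [t [mem2 [r2 l r3]]] := IH _ mem' kappa at3 sz1 wf1 relt (bT _ b) le.
  exists (1 + (t + (1 + size pe))), mem2; split=> //.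
    apply: runs_trans (runs_trans (runs_trans r1 rj) r2) _.
    apply: runs1; first exact: at4.
    rewrite /=; congr (Some (Config _ _ _)).
    by rewrite /l2; lia.
  by move: l; rewrite /= mulnS; lia.
- move=> e c s es e0 p mem kappa.
  set pe := cexp e NV.+1; set p1 := comp c _.
  rewrite size_cat /= size_cat /= => /code_at_cat[at1 /code_at_cons[at2 /code_at_cat[at3 at4]]].
  move=> sz /andP[wf wf1] r b le.
  have sto : stored s by apply: stoS => //; lia.
  have Ne : NV < NV.+1 <= NV.+2 by lia.
  have [mem' [r1 e1 rel1 _]] := runs_cexp (so s) at1 wf Ne r sto es.
  have N1s : NV.+1 < space by apply: K_space; lia.
  exists (1 + size pe), mem'; split=> //; last by rewrite mulnS; lia.
  apply: runs_trans r1 _.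
  apply: runs1; first exact: at2; rewrite /= /read_cell N1s /= e1 e0 /=.
  by congr (Some (Config _ _ _)); lia.
- move=> e c s s1 s2 es ne b1 IH1 b2 IH2 p mem kappa.
  move: (IH2 p); rewrite /=.
  set pe := cexp e NV.+1; set p1 := comp c _ => IH2' at0 sz wf0 r b le.
  have [at1 /code_at_cons[at2 /code_at_cat[at3 /code_at_cons[at4 _]]]] := code_at_cat at0.
  have [wf wf1] := andP wf0.
  have szx := sz; rewrite size_cat /= size_cat /= in szx.
  have ts1 : (tm s).+1 <= tm s1 := bigstep_tm b1.
  have ts2 : tm s1 <= tm s2 := bigstep_tm b2.
  have sto : stored s by apply: stoS => //; lia.
  have Ne : NV < NV.+1 <= NV.+2 by lia.
  have [mem' [r1 e1 rel1 _]] := runs_cexp (so s) at1 wf Ne r sto es.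
  have relt : represents (tick s) mem' by exact: represents_state rel1.
  have N1s : NV.+1 < space by apply: K_space; lia.
  have sz1 : size p1 <= kappa by lia.
  have le1 : B + 8 * tm s1 <= A by lia.
  have [t [mem1 [r2 l rel2]]] := IH1 _ mem' kappa at3 sz1 wf1 relt (bT _ b) le1.
  have [t' [mem2 [r3 l' rel3]]] :=
    IH2' mem1 kappa at0 sz wf0 rel2 (bigstep_bounded inpB b1 (bT _ b)) le.
  exists (t' + (1 + (t + (1 + size pe)))), mem2; split=> //; last first.
    by move: l; rewrite /= mulnS; lia.
  have rj : runs 1 (Config (p + size pe) mem' (so s))
      (Config (p + size pe).+1 mem' (so s)).
    apply: runs1; first exact: at2.
    by rewrite /= /read_cell N1s /= e1 (negPf ne).
  apply: runs_trans _ r3; apply: runs_trans (runs_trans (runs_trans r1 rj) r2) _.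
  by apply: runs1; first exact: at4.
Qed.

End Compiler.

Definition init_state : state := State (fun=> 0) (fun _ _ => 0) [::] 0.

Lemma ram_run_comp NV K D M inp L B A space word c s' :
  NV + 3 <= K -> 1 < A -> M <= A -> K * L.+1 <= A ->
  (forall i, nth 0 inp i <= B) -> K * L.+1 <= space -> A ^ D < word ->
  cwf NV K D M c -> B + 8 * tm s' <= A ->
  bigstep inp L B c init_state s' ->
  exists2 t, ram_run space word (comp NV K c 0 ++ [:: Halt]) inp t (so s') &
             t <= size (comp NV K c 0) * tm s'.
Proof.
move=> h1 h2 h3 h4 h5 h6 h7 h8 h9 b.
have h5' i : nth 0 inp i <= A by have := h5 i; lia.
have at0 : code_at (comp NV K c 0 ++ [:: Halt]) 0 (comp NV K c 0) by exists [::], [:: Halt].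
have r0 : represents NV K L init_state (fun=> 0) by [].
have b0 : bounded B init_state by [].
have [t [mem [r l _]]] :=
  comp_ok h1 h2 h3 h4 h5' h6 h7 h5 b at0 (leqnn _) h8 r0 b0 h9.
exists t; last by move: l; rewrite /= muln0 addn0.
exists (Config (size (comp NV K c 0)) mem (so s')); split=> //.
by rewrite onth_cat ltnn subnn.
Qed.

(** * Marked regular expressions *)

Section Marks.

Variable sigma : nat.
Notation re := (regexp 'I_sigma).
Notation marks := (nat -> bool).
Notation "'#' R" := (re_length R) (at level 1, format "# R").
Implicit Types (R : re) (V T : marks).

Lemma re_length_gt0 R : 0 < #R.
Proof. by case: R. Qed.

Lemma size_encode R : size (encode_regexp R) = #R.
Proof.
by elim: R => //= [R1 IH1 R2 IH2|R1 IH1 R2 IH2|R1 IH1]; rewrite !size_cat /= ?IH1 ?IH2; lia.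
Qed.

Fixpoint nullable R : bool :=
  match R with
  | Char _ => false
  | Cat R1 R2 => nullable R1 && nullable R2
  | Alt R1 R2 => nullable R1 || nullable R2
  | Star _ => true
  end.

(* [V] marks leaves of the subexpression R, whose nodes have the positions
   o, ..., o + #R - 1 in Reverse Polish notation. [fend true R o V]: some
   marked leaf can be the last letter of a word of R; [fend false]: the first
   letter. *)
Fixpoint fend (d : bool) R (o : nat) V : bool :=
  match R with
  | Char _ => V o
  | Cat R1 R2 =>
      let e1 := fend d R1 o V in let e2 := fend d R2 (o + #R1) V in
      if d then e2 || nullable R2 && e1 else e1 || nullable R1 && e2
  | Alt R1 R2 => fend d R1 o V || fend d R2 (o + #R1) V
  | Star R1 => fend d R1 o V
  end.

(* The leaves that can follow (if d) or precede (if ~~ d) a marked leaf in a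
   word of R and, if b, those that can come first or last, respectively. *)
Fixpoint fol (d : bool) R (o : nat) V (b : bool) (k : nat) : bool :=
  match R with
  | Char _ => b && (k == o)
  | Cat R1 R2 =>
      let e1 := fend d R1 o V in let e2 := fend d R2 (o + #R1) V in
      let b1 := if d then b else e2 || nullable R2 && b in
      let b2 := if d then e1 || nullable R1 && b else b in
      if k < o + #R1 then fol d R1 o V b1 k else fol d R2 (o + #R1) V b2 k
  | Alt R1 R2 =>
      if k < o + #R1 then fol d R1 o V b k else fol d R2 (o + #R1) V b k
  | Star R1 => fol d R1 o V (b || fend d R1 o V) k
  end.

Lemma fol_out d R o V b k : o + #R <= k -> fol d R o V b k = false.
Proof.
elim: R o b => /= [a|R1 IH1 R2 IH2|R1 IH1 R2 IH2|R1 IH1] o b h.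
- by case: eqP => [|_]; [lia|rewrite andbF].
- by rewrite ltnNge IH2 ?ifN //; lia.
- by rewrite ltnNge IH2 ?ifN //; lia.
- by rewrite IH1 //; lia.
Qed.

Definition dot V T (o n : nat) : bool := has (fun k => V k && T k) (iota o n).

Lemma dotC V T o n : dot V T o n = dot T V o n.
Proof. by apply: eq_has => k; rewrite andbC. Qed.

Lemma dotD V T o n1 n2 :
  dot V T o (n1 + n2) = dot V T o n1 || dot V T (o + n1) n2.
Proof. by rewrite /dot iotaD has_cat. Qed.

Lemma eq_dot V T V' T' o n :
  (forall k, o <= k < o + n -> V k && T k = V' k && T' k) ->
  dot V T o n = dot V' T' o n.
Proof.
by move=> h; apply: eq_in_has => k; rewrite mem_iota; apply: h.
Qed.

(** The operator itself has position [o + n1 + n2], after both operands, and is never marked; this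
    accounts for the successor in the length. *)
Lemma dot_fol_split (W : marks) (U F1 F2 : marks) o n1 n2 :
  (forall k, W k = if k < o + n1 then F1 k else F2 k) ->
  F2 (o + n1 + n2) = false ->
  dot U W o (n1 + n2).+1 = dot U F1 o n1 || dot U F2 (o + n1) n2.
Proof.
move=> hW h0.
have last0 : dot U W (o + (n1 + n2)) 1 = false.
  by rewrite /dot /= orbF addnA hW ifN ?h0 ?andbF //; lia.
rewrite -addn1 !dotD last0 orbF; congr (_ || _); apply: eq_dot => k hk; rewrite hW; congr (_ && _).
  by rewrite ifT //; lia.
by rewrite ifN //; lia.
Qed.

Ltac bool_cases :=
  repeat match goal with
  | |- context [dot ?a ?b ?c ?d] =>
      let x := fresh in generalize (dot a b c d); intro x
  | |- context [fend ?a ?b ?c ?d] =>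
      let x := fresh in generalize (fend a b c d); intro x
  | |- context [nullable ?a] =>
      let x := fresh in generalize (nullable a); intro x
  end;
  repeat match goal with x : bool |- _ => destruct x end.

(** [fol] is affine in its flag: setting [b] adds the leaves that can come first (last, for the
    other direction), and such a leaf is in [T] exactly when [fend (~~ d)] holds. *)
Lemma dot_fol_b d R o V T b :
  dot T (fol d R o V b) o #R =
    dot T (fol d R o V false) o #R || b && fend (~~ d) R o T.
Proof.
elim: R o b => /= [a|R1 IH1 R2 IH2|R1 IH1 R2 IH2|R1 IH1] o b.
- by rewrite /dot /= eqxx !andbF !andbT !orbF andbC.
- rewrite !(@dot_fol_split _ _ _ _ _ _ _ (fun=> erefl)) ?fol_out //.
  rewrite (IH1 o (if d then b else _)) (IH1 o (if d then false else _)).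
  rewrite (IH2 (o + #R1) (if d then _ else b)).
  rewrite (IH2 (o + #R1) (if d then _ else false)).
  by case: d {IH1 IH2} => /=; bool_cases.
- rewrite !(@dot_fol_split _ _ _ _ _ _ _ (fun=> erefl)) ?fol_out //.
  rewrite (IH1 o) (IH2 (o + #R1)).
  by clear IH1 IH2; bool_cases.
- rewrite -addn1 !dotD (IH1 o (b || _)) (IH1 o (fend d R1 o V)).
  rewrite [dot _ _ _ 1]/dot [dot _ _ _ 1]/dot /= !fol_out ?andbF ?orbF //=.
  by clear IH1; bool_cases.
Qed.

(** Both sides ask whether some leaf of [V] and some leaf of [T] are adjacent in a word. Pairs
    across the two operands of a concatenation, or across two rounds of a star, enter through the
    flags only, and [dot_fol_b] isolates these contributions. *)
Lemma dot_fol_adj d R o V T e :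
  dot V (fol (~~ d) R o T e) o #R =
    dot T (fol d R o V false) o #R || e && fend d R o V.
Proof.
elim: R o e => /= [a|R1 IH1 R2 IH2|R1 IH1 R2 IH2|R1 IH1] o e.
- by rewrite /dot /= eqxx !andbF !andbT !orbF andbC.
- rewrite !(@dot_fol_split _ _ _ _ _ _ _ (fun=> erefl)) ?fol_out //.
  rewrite (IH1 o) (IH2 (o + #R1)).
  (* After this all pairings are unflagged, and a propositional identity remains. *)
  rewrite [in RHS](dot_fol_b _ R1) [in RHS](dot_fol_b _ R2).
  by case: d {IH1 IH2} => /=; bool_cases.
- rewrite !(@dot_fol_split _ _ _ _ _ _ _ (fun=> erefl)) ?fol_out //.
  rewrite (IH1 o) (IH2 (o + #R1)).
  by clear IH1 IH2; bool_cases.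
- rewrite -addn1 !dotD (IH1 o) (dot_fol_b _ _ _ _ _ (fend d R1 o V)).
  rewrite [dot _ _ _ 1]/dot [dot _ _ _ 1]/dot /= !fol_out ?andbF ?orbF //=.
  by clear IH1; bool_cases.
Qed.

(** The words that may still follow when a marked leaf has just been read, so as to complete a word
    of [R]. This residual language gives the marks their meaning. *)
Fixpoint post R (o : nat) V (w : seq 'I_sigma) : Prop :=
  match R with
  | Char _ => V o /\ w = [::]
  | Cat R1 R2 =>
      (exists w1 w2, [/\ w = w1 ++ w2, post R1 o V w1 & lang R2 w2]) \/
      post R2 (o + #R1) V w
  | Alt R1 R2 => post R1 o V w \/ post R2 (o + #R1) V w
  | Star R1 => exists w1 w2, [/\ w = w1 ++ w2, post R1 o V w1 & lang (Star R1) w2]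
  end.

Lemma eq_post R o V V' w : (forall k, o <= k < o + #R -> V k = V' k) ->
  post R o V w <-> post R o V' w.
Proof.
elim: R o w => /= [a|R1 IH1 R2 IH2|R1 IH1 R2 IH2|R1 IH1] o w h.
- by rewrite h //; lia.
- have IH1' w1 : post R1 o V w1 <-> post R1 o V' w1.
    by apply: IH1 => k hk; apply: h; lia.
  rewrite (IH2 (o + #R1)); last by move=> k hk; apply: h; lia.
  split; case=> [[w1 [w2 [e /IH1' p l]]]|]; try by right.
    by left; exists w1, w2.
  by left; exists w1, w2.
- rewrite (IH1 o); last by move=> k hk; apply: h; lia.
  by rewrite (IH2 (o + #R1)) //; move=> k hk; apply: h; lia.
- have IH1' w1 : post R1 o V w1 <-> post R1 o V' w1.
    by apply: IH1 => k hk; apply: h; lia.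
  by split; case=> w1 [w2 [e /IH1' p l]]; exists w1, w2.
Qed.

Lemma star_nil R : lang (Star R) [::].
Proof. by exists [::]. Qed.

(** Empty factors in front are discarded until one begins with [c]. *)
Lemma star_cons R c w : lang (Star R) (c :: w) <->
  exists w1 w2, [/\ w = w1 ++ w2, lang R (c :: w1) & lang (Star R) w2].
Proof.
split=> [[ws [e h]]|[w1 [w2 [-> h1 [ws [-> h2]]]]]]; last first.
  exists ((c :: w1) :: ws); split=> // v; rewrite inE => /orP[/eqP -> //|].
  exact: h2.
elim: ws e h => //= -[|c' w1] ws IH e h.
  by apply: IH => // v hv; apply: h; rewrite inE hv orbT.
case: e => -> ->; exists w1, (flatten ws); split=> //.
  by apply: h; rewrite inE eqxx.
by exists ws; split=> // v hv; apply: h; rewrite inE hv orbT.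
Qed.

Lemma nullableP R : nullable R <-> lang R [::].
Proof.
elim: R => /= [a|R1 IH1 R2 IH2|R1 IH1 R2 IH2|R1 IH1] //.
- split=> [/andP[/IH1 h1 /IH2 h2]|[w1 [w2 [e]]]].
    by exists [::], [::].
  by case: w1 e => // e; case: w2 e => // _ /IH1 -> /IH2 ->.
- by rewrite -IH1 -IH2; split=> [/orP|h]; last apply/orP.
- by split=> // _; exists [::].
Qed.

Lemma fend_post R o V : fend true R o V <-> post R o V [::].
Proof.
elim: R o => /= [a|R1 IH1 R2 IH2|R1 IH1 R2 IH2|R1 IH1] o.
- by split=> [|[]].
- rewrite -IH2; split=> [/orP[|/andP[/nullableP n /IH1 h]]|]; first by right.
    by left; exists [::], [::].
  case=> [[w1 [w2 [e + ]]]|->//]; case: w1 e => // e; case: w2 e => // _.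
  by move=> /IH1 -> /nullableP ->; rewrite orbT.
- by rewrite -IH1 -IH2; split=> [/orP|h]; last apply/orP.
- rewrite IH1; split=> [h|[w1 [w2 [+ + _]]]]; last by case: w1.
  by exists [::], [::]; split=> //; apply: star_nil.
Qed.

Variable code : nat -> nat.

Definition codes R (o : nat) : Prop :=
  forall k, k < #R -> code (o + k) = nth 0 (encode_regexp R) k.

Lemma codes_cat1 R1 R2 x o :
  (forall k, k < (#R1 + #R2).+1 ->
     code (o + k) = nth 0 (encode_regexp R1 ++ encode_regexp R2 ++ [:: x]) k) ->
  codes R1 o /\ codes R2 (o + #R1).
Proof.
move=> h; split=> k hk.
  by rewrite h; [rewrite nth_cat size_encode hk|lia].
rewrite -addnA h; last by lia.
rewrite nth_cat size_encode ifN; last by lia.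
by rewrite addKn nth_cat size_encode hk.
Qed.

Lemma codes_star R1 o : codes (Star R1) o -> codes R1 o.
Proof.
by move=> h k hk; rewrite h /=; [rewrite nth_cat size_encode hk|lia].
Qed.

Definition filt (c : nat) V : marks := fun k => V k && (code k == c.+3).

Lemma dot_filt c V T o n : dot (filt c V) T o n = dot V (filt c T) o n.
Proof. by apply: eq_has => k; rewrite /filt -andbA [_ && T k]andbC. Qed.

(** Induction on [R], following where [c] is read. In a concatenation the right operand may start
    after a marked end of the left one, or at once if the left one is nullable, which is its flag in
    [fol]. In a star, [c] continues the current factor or opens a new one, hence the flag
    [b || fend]. *)
Lemma post_step R o V b (c : 'I_sigma) w : codes R o ->
  post R o (filt c (fol true R o V b)) w <->
  post R o V (c :: w) \/ b /\ lang R (c :: w).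
Proof.
elim: R o b w => [a|R1 IH1 R2 IH2|R1 IH1 R2 IH2|R1 IH1] o b w hc.
- rewrite /= /filt /= eqxx andbT -[o in code o]addn0 hc //=.
  split=> [[/andP[-> /eqP[/val_inj ->]] ->]|]; first by right.
  by case=> [[]//|[-> [-> ->]]]; rewrite eqxx.
- have [hc1 hc2] := codes_cat1 hc; rewrite /=.
  have F1 w1 : post R1 o (filt c (fol true (Cat R1 R2) o V b)) w1 <->
      post R1 o V (c :: w1) \/ b /\ lang R1 (c :: w1).
    rewrite -IH1 //; apply: eq_post => k hk.
    by rewrite /filt /= ifT //; lia.
  have F2 : post R2 (o + #R1) (filt c (fol true (Cat R1 R2) o V b)) w <->
      post R2 (o + #R1) V (c :: w) \/
      fend true R1 o V || nullable R1 && b /\ lang R2 (c :: w).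
    rewrite -IH2 //; apply: eq_post => k hk.
    by rewrite /filt /= ifN //; lia.
  split.
    case=> [[w1 [w2 [-> /F1 [h1|[hb h1]] h2]]]|/F2[h|[/orP[h1|/andP[n hb]] h]]].
    + by left; left; exists (c :: w1), w2.
    + by right; split=> //; exists (c :: w1), w2.
    + by left; right.
    + by left; left; exists [::], (c :: w); split=> //; apply/fend_post.
    + by right; split=> //; exists [::], (c :: w); split=> //; apply/nullableP.
  case=> [[[[|c' w1] [w2 [/= e h1 h2]]]|h]|[hb [[|c' w1] [w2 [/= e h1 h2]]]]].
  + by right; apply/F2; right; rewrite e; split=> //; move/fend_post: h1 => ->.
  + by case: e h1 => <- -> h1; left; exists w1, w2; split=> //; apply/F1; left.
  + by right; apply/F2; left.
  + right; apply/F2; right; rewrite e; split=> //.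
    by move/nullableP: h1 => ->; rewrite hb orbT.
  + by case: e h1 => <- -> h1; left; exists w1, w2; split=> //; apply/F1; right.
- have [hc1 hc2] := codes_cat1 hc; rewrite /=.
  have F1 : post R1 o (filt c (fol true (Alt R1 R2) o V b)) w <->
      post R1 o V (c :: w) \/ b /\ lang R1 (c :: w).
    by rewrite -IH1 //; apply: eq_post => k hk; rewrite /filt /= ifT //; lia.
  have F2 : post R2 (o + #R1) (filt c (fol true (Alt R1 R2) o V b)) w <->
      post R2 (o + #R1) V (c :: w) \/ b /\ lang R2 (c :: w).
    by rewrite -IH2 //; apply: eq_post => k hk; rewrite /filt /= ifN //; lia.
  by rewrite F1 F2; tauto.
- have hc1 := codes_star hc; rewrite [fol _ _ _ _ _]/=.
  have F1 w1 := IH1 o (b || fend true R1 o V) w1 hc1.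
  split.
    move=> [w1 [w2 [-> /F1 [h1|[/orP[hb|h1'] h1]] h2]]].
    + by left; exists (c :: w1), w2.
    + by right; split=> //; apply/star_cons; exists w1, w2.
    + left; exists [::], (c :: w1 ++ w2); split=> //; first exact/fend_post.
      by apply/star_cons; exists w1, w2.
  case=> [[[|c' w1] [w2 [/= e h1 h2]]]|[hb /star_cons[w1 [w2 [e h1 h2]]]]].
  + move: h2; rewrite -e => /star_cons[u1 [u2 [eu l1 l2]]].
    exists u1, u2; split=> //; apply/F1; right; split=> //.
    by move/fend_post: h1 => ->; rewrite orbT.
  + case: e h1 => <- -> h1; exists w1, w2; split=> //.
    by apply/F1; left.
  + by exists w1, w2; split=> //; apply/F1; right; rewrite hb.
Qed.

Lemma post0 R o w : ~ post R o (fun=> false) w.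
Proof.
elim: R o w => /= [a|R1 IH1 R2 IH2|R1 IH1 R2 IH2|R1 IH1] o w.
- by case.
- by case=> [[w1 [w2 [_ /IH1]]]|/IH2].
- by case=> [/IH1|/IH2].
- by move=> [w1 [w2 [_ /IH1]]].
Qed.

(* The subexpression whose root has position k, with the position of its first
   leaf. *)
Fixpoint node R (o k : nat) : re * nat :=
  if k == (o + #R).-1 then (R, o) else
  match R with
  | Char _ => (R, o)
  | Cat R1 R2 | Alt R1 R2 =>
      if k < o + #R1 then node R1 o k else node R2 (o + #R1) k
  | Star R1 => node R1 o k
  end.

Lemma node_root R o : node R o (o + #R).-1 = (R, o).
Proof. by case: R => * /=; rewrite eqxx. Qed.

Lemma node_size R o k : o <= k < o + #R ->
  o <= (node R o k).2 /\ (node R o k).2 + #((node R o k).1) = k.+1.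
Proof.
elim: R o => /= [a|R1 IH1 R2 IH2|R1 IH1 R2 IH2|R1 IH1] o h; case: eqP => [|e] /=; try lia.
- by case: ifP => lt; [have := IH1 o | have := IH2 (o + #R1)]; lia.
- by case: ifP => lt; [have := IH1 o | have := IH2 (o + #R1)]; lia.
- by have := IH1 o; lia.
Qed.

Lemma node_trans R o k j : o <= k < o + #R -> (node R o k).2 <= j <= k ->
  node R o j = node (node R o k).1 (node R o k).2 j.
Proof.
elim: R o => [a|R1 IH1 R2 IH2|R1 IH1 R2 IH2|R1 IH1] o h.
- by move=> /= _; rewrite !if_same /= if_same.
- case: (eqVneq k (o + #(Cat R1 R2)).-1) => [->|ne]; first by rewrite node_root.
  move: (h) (ne) => /= h' ne'.
  rewrite [node _ _ k]/= ifN //; case: ifP => lt hj.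
    rewrite -IH1 //=; last lia.
    by rewrite ifN ?ifT //=; lia.
  have [|h1 h2] := @node_size R2 (o + #R1) k; first by lia.
  rewrite -IH2 //=; last by lia.
  by rewrite ifN ?ifN //=; lia.
- case: (eqVneq k (o + #(Alt R1 R2)).-1) => [->|ne]; first by rewrite node_root.
  move: (h) (ne) => /= h' ne'.
  rewrite [node _ _ k]/= ifN //; case: ifP => lt hj.
    rewrite -IH1 //=; last lia.
    by rewrite ifN ?ifT //=; lia.
  have [|h1 h2] := @node_size R2 (o + #R1) k; first by lia.
  rewrite -IH2 //=; last by lia.
  by rewrite ifN ?ifN //=; lia.
- case: (eqVneq k (o + #(Star R1)).-1) => [->|ne]; first by rewrite node_root.
  move: (h) (ne) => /= h' ne'.
  rewrite [node _ _ k]/= ifN // => hj.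
  rewrite -IH1 //=; last by lia.
  by rewrite ifN //=; lia.
Qed.

Lemma codes_node R o k : codes R o -> codes (node R o k).1 (node R o k).2.
Proof.
elim: R o => [a|R1 IH1 R2 IH2|R1 IH1 R2 IH2|R1 IH1] o hc.
- by rewrite /= if_same.
- have [hc1 hc2] := codes_cat1 hc; rewrite /=; case: ifP => // _.
  by case: ifP => _; auto.
- have [hc1 hc2] := codes_cat1 hc; rewrite /=; case: ifP => // _.
  by case: ifP => _; auto.
- by have hc1 := codes_star hc; rewrite /=; case: ifP => // _; auto.
Qed.

Definition symbol R : nat :=
  match R with Char a => a.+3 | Cat _ _ => 0 | Alt _ _ => 1 | Star _ => 2 end.

Lemma codes_symbol R o : codes R o -> code (o + #R).-1 = symbol R.
Proof.
have -> : (o + #R).-1 = o + #R.-1 by have := re_length_gt0 R; lia.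
move=> ->; last by have := re_length_gt0 R; lia.
case: R => //= [R1 R2|R1 R2|R1]; rewrite !nth_cat !size_encode /=.
- by rewrite ifN ?addKn ?ltnn ?subnn //; lia.
- by rewrite ifN ?addKn ?ltnn ?subnn //; lia.
- by rewrite ltnn subnn.
Qed.

Lemma code_node R o k : codes R o -> o <= k < o + #R ->
  code k = symbol (node R o k).1.
Proof.
move=> hc hk; rewrite -(codes_symbol (codes_node (k := k) hc)).
by have [_ ->] := node_size hk.
Qed.

Definition child (n : re * nat) (j : nat) : Prop :=
  match n.1 with
  | Char _ => False
  | Cat R1 R2 | Alt R1 R2 =>
      j = (n.2 + #R1).-1 \/ j = (n.2 + #R1 + #R2).-1
  | Star R1 => j = (n.2 + #R1).-1
  end.

(** In Reverse Polish notation a parent comes after its children. The downward pass, which visits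
    positions in decreasing order, has therefore set the flag of [j] before it gets there. *)
Lemma parent R o j : o <= j < (o + #R).-1 ->
  exists k, j < k < o + #R /\ child (node R o k) j.
Proof.
have cat_case R1 R2 R' : (forall o, o <= j < (o + #R1).-1 ->
      exists k, j < k < o + #R1 /\ child (node R1 o k) j) ->
    (forall o, o <= j < (o + #R2).-1 ->
      exists k, j < k < o + #R2 /\ child (node R2 o k) j) ->
    R' = Cat R1 R2 \/ R' = Alt R1 R2 -> forall o', o' <= j < (o' + #R').-1 ->
    exists k, j < k < o' + #R' /\ child (node R' o' k) j.
  move=> IH1 IH2 e o'.
  have -> : #R' = (#R1 + #R2).+1 by case: e => ->.
  move=> h; case: (ltnP j (o' + #R1)) => lt.
    case: (eqVneq j (o' + #R1).-1) => [ej|ne].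
      exists (o' + (#R1 + #R2).+1).-1; split; first by lia.
      by case: e => ->; rewrite node_root /child /=; left.
    have [|k [hk c]] := IH1 o'; first lia.
    exists k; split; first lia.
    by case: e => -> /=; rewrite ifN ?ifT //; lia.
  case: (eqVneq j (o' + #R1 + #R2).-1) => [ej|ne].
    exists (o' + (#R1 + #R2).+1).-1; split; first by lia.
    by case: e => ->; rewrite node_root /child /=; right.
  have [|k [hk c]] := IH2 (o' + #R1); first lia.
  exists k; split; first lia.
  by case: e => -> /=; rewrite ifN ?ifN //; lia.
elim: R o => [a|R1 IH1 R2 IH2|R1 IH1 R2 IH2|R1 IH1] o.
- by move=> /=; lia.
- by apply: (cat_case R1 R2) => //; left.
- by apply: (cat_case R1 R2) => //; right.
- move=> /= h; case: (eqVneq j (o + #R1).-1) => [ej|ne].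
    exists (o + #R1.+1).-1; split; first by lia.
    by rewrite eqxx.
  have [|k [hk c]] := IH1 o; first lia.
  exists k; split; first lia.
  by rewrite ifN //; lia.
Qed.

(* The value of the flag b of [fol] at the subexpression with root k. *)
Fixpoint flag (d : bool) R (o : nat) V (b : bool) (k : nat) : bool :=
  if k == (o + #R).-1 then b else
  match R with
  | Char _ => b
  | Cat R1 R2 =>
      let e1 := fend d R1 o V in let e2 := fend d R2 (o + #R1) V in
      let b1 := if d then b else e2 || nullable R2 && b in
      let b2 := if d then e1 || nullable R1 && b else b in
      if k < o + #R1 then flag d R1 o V b1 k else flag d R2 (o + #R1) V b2 k
  | Alt R1 R2 =>
      if k < o + #R1 then flag d R1 o V b k else flag d R2 (o + #R1) V b k
  | Star R1 => flag d R1 o V (b || fend d R1 o V) k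
  end.

Lemma flag_root d R o V b : flag d R o V b (o + #R).-1 = b.
Proof. by case: R => * /=; rewrite eqxx. Qed.

(** Below [k] the flags depend on the context only through the flag at [k]; this is what allows the
    downward pass to work locally. *)
Lemma flag_node d R o V b k j : o <= k < o + #R -> (node R o k).2 <= j <= k ->
  flag d R o V b j =
    flag d (node R o k).1 (node R o k).2 V (flag d R o V b k) j.
Proof.
elim: R o b => [a|R1 IH1 R2 IH2|R1 IH1 R2 IH2|R1 IH1] o b h.
- by move=> /= _; rewrite !if_same /= if_same.
- case: (eqVneq k (o + #(Cat R1 R2)).-1) => [->|ne].
    by rewrite node_root flag_root.
  move: (h) (ne) => /= h' ne'.
  rewrite [node _ _ k]/= [flag d _ _ _ _ k]/= ifN // (ifN _ _ ne); case: ifP => lt hj.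
    rewrite -IH1 //=; last lia.
    by case: eqP => [|_]; [lia|case: ltnP => [_ //|]; lia].
  have [|h1 h2] := @node_size R2 (o + #R1) k; first by lia.
  rewrite -IH2 //=; last by lia.
  by case: eqP => [|_]; [lia|case: ltnP => [|_ //]; lia].
- case: (eqVneq k (o + #(Alt R1 R2)).-1) => [->|ne].
    by rewrite node_root flag_root.
  move: (h) (ne) => /= h' ne'.
  rewrite [node _ _ k]/= [flag d _ _ _ _ k]/= ifN // (ifN _ _ ne); case: ifP => lt hj.
    rewrite -IH1 //=; last lia.
    by case: eqP => [|_]; [lia|case: ltnP => [_ //|]; lia].
  have [|h1 h2] := @node_size R2 (o + #R1) k; first by lia.
  rewrite -IH2 //=; last by lia.
  by case: eqP => [|_]; [lia|case: ltnP => [|_ //]; lia].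
- case: (eqVneq k (o + #(Star R1)).-1) => [->|ne].
    by rewrite node_root flag_root.
  move: (h) (ne) => /= h' ne'.
  rewrite [node _ _ k]/= [flag d _ _ _ _ k]/= ifN // (ifN _ _ ne) => hj.
  rewrite -IH1 //=; last by lia.
  by case: eqP => [|_ //]; lia.
Qed.

(** Letters have symbols above 2, so the first factor says that [k] is a leaf. *)
Lemma fol_flag d R o V b k : o <= k < o + #R ->
  fol d R o V b k = (2 < symbol (node R o k).1) && flag d R o V b k.
Proof.
elim: R o b => [a|R1 IH1 R2 IH2|R1 IH1 R2 IH2|R1 IH1] o b h /=.
- by rewrite !if_same /= (_ : k == o) ?andbT //; move: h => /=; lia.
- case: eqP => [->|ne] /=.
    by rewrite ifN ?fol_out //; have := re_length_gt0 R2; lia.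
  by case: ifP => lt; [apply: IH1|apply: IH2]; move: h ne => /=; lia.
- case: eqP => [->|ne] /=.
    by rewrite ifN ?fol_out //; have := re_length_gt0 R2; lia.
  by case: ifP => lt; [apply: IH1|apply: IH2]; move: h ne => /=; lia.
- case: eqP => [->|ne] /=.
    by rewrite fol_out //; lia.
  by apply: IH1; move: h ne => /=; lia.
Qed.

Lemma node_star R o k R1 o' : o <= k < o + #R -> node R o k = (Star R1, o') ->
  node R o k.-1 = (R1, o') /\
  forall d V b, flag d R o V b k.-1 = flag d R o V b k || fend d R1 o' V.
Proof.
move=> hk e; have := node_size hk; rewrite e /= => -[h1 h2].
have s1 := re_length_gt0 R1; have ek : k.-1 = (o' + #R1).-1 by lia.
have hj : (node R o k).2 <= k.-1 <= k by rewrite e /=; lia.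
split=> [|d V b]; rewrite ?(node_trans hk hj) ?(flag_node _ _ _ hk hj) e /= ek.
  by rewrite ifN ?node_root //; lia.
by rewrite ifN ?flag_root //; lia.
Qed.

(** The right operand ends just before the operator, and the left one just before the first leaf of
    the right one; [children] finds them in this way. The last clause is the local rule that the
    downward pass applies. *)
Lemma node_cat_alt R o k R' R1 R2 o' : o <= k < o + #R ->
  node R o k = (R', o') -> R' = Cat R1 R2 \/ R' = Alt R1 R2 ->
  [/\ node R o k.-1 = (R2, o' + #R1), node R o (o' + #R1).-1 = (R1, o') &
    forall d V b,
      let e1 := fend d R1 o' V in let e2 := fend d R2 (o' + #R1) V in
      let f := flag d R o V b k in
      flag d R o V b (o' + #R1).-1 =
        (if R' is Cat _ _ then if d then f else e2 || nullable R2 && f else f) /\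
      flag d R o V b k.-1 =
        (if R' is Cat _ _ then if d then e1 || nullable R1 && f else f else f)].
Proof.
move=> hk e e'; have := node_size hk; rewrite e /= => -[h1 h2].
have sz : #R' = (#R1 + #R2).+1 by case: e' => ->.
have s1 := re_length_gt0 R1; have s2 := re_length_gt0 R2.
have ek : k.-1 = (o' + #R1 + #R2).-1 by lia.
have hj : (node R o k).2 <= k.-1 <= k by rewrite e /=; lia.
have hi : (node R o k).2 <= (o' + #R1).-1 <= k by rewrite e /=; lia.
split=> [||d V b /=].
- rewrite (node_trans hk hj) e ek.
  by case: e' => -> /=; rewrite ifN ?ifN ?node_root //; lia.
- rewrite (node_trans hk hi) e.
  by case: e' => -> /=; rewrite ifN ?ifT ?node_root //; lia.
rewrite (flag_node _ _ _ hk hj) (flag_node _ _ _ hk hi) e ek.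
split; case: e' => -> /=.
- by case: eqP => [|_]; [lia|case: ltnP => [_|]; [rewrite flag_root|lia]].
- by case: eqP => [|_]; [lia|case: ltnP => [_|]; [rewrite flag_root|lia]].
- by case: eqP => [|_]; [lia|case: ltnP => [|_]; [lia|rewrite flag_root]].
- by case: eqP => [|_]; [lia|case: ltnP => [|_]; [lia|rewrite flag_root]].
Qed.

End Marks.

(** * Runs over words, forward and backward, as Boolean linear algebra *)

Section Words.

Variables (sigma : nat) (R : regexp 'I_sigma).
Notation marks := (nat -> bool).
Notation m := (re_length R).
Notation code := (nth 0 (encode_regexp R)).
Implicit Types (V T : marks) (w : seq nat) (Tt : marks * bool).

Definition fstep (b : bool) V c : marks := filt code c (fol true R 0 V b).
Definition fwd b V w : marks := foldl (fstep b) V w.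

(** Predecessors of the targets with letter [c]. The start state becomes a target when such a target
    can come first, and stays one because of its loop. *)
Definition bstep Tt c : marks * bool :=
  let T := filt code c Tt.1 in
  (fol false R 0 T false, Tt.2 || fend false R 0 T).
Definition bwd Tt w : marks * bool := foldl bstep Tt w.

(* State m is a start state with a loop on every letter; b tells whether it is
   active, the second component of Tt whether it is one of the targets. *)
Definition pairing V b Tt : bool := dot V Tt.1 0 m || b && Tt.2.

Lemma codes_R : codes code R 0.
Proof. by []. Qed.

Lemma pairing_step V b Tt c :
  pairing (fstep b V c) b Tt = pairing V b (bstep Tt c).
Proof.
rewrite /pairing /fstep /bstep /= dot_filt dotC dot_fol_b /=.
rewrite (dot_fol_adj true) /= orbF -!orbA; congr (_ || _).
by case: b => //=; rewrite orbC.
Qed.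

Lemma pairing_fwd V b Tt w :
  pairing (fwd b V w) b Tt = pairing V b (bwd Tt (rev w)).
Proof.
elim/last_ind: w V Tt => // w c IH V Tt.
by rewrite /fwd foldl_rcons rev_rcons pairing_step IH.
Qed.

Definition single (s : nat) : marks := fun k => k == s.

Lemma dot_single s T : dot (single s) T 0 m = (s < m) && T s.
Proof.
apply/hasP/andP => [[k]|[lt t]].
  by rewrite mem_iota => /andP[_ lt] /andP[/eqP <- ->].
by exists s; rewrite ?mem_iota // /single eqxx.
Qed.

Lemma pairing_single s Tt : s <= m ->
  pairing (single s) (s == m) Tt = if s < m then Tt.1 s else Tt.2.
Proof.
move=> le; rewrite /pairing dot_single; case: ltnP => h /=.
  by rewrite (_ : s == m = false) ?orbF //; lia.
by rewrite (_ : s == m) //; lia.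
Qed.

Lemma pairing_linear V b Tt :
  pairing V b Tt =
    has (fun s => V s && pairing (single s) (s == m) Tt) (iota 0 m) ||
    b && pairing (single m) true Tt.
Proof.
congr (_ || _).
  apply: eq_in_has => s; rewrite mem_iota => /andP[_ lt].
  by rewrite pairing_single ?lt // ltnW.
by have := pairing_single Tt (leqnn m); rewrite eqxx ltnn => ->.
Qed.

(** Row [s] of the transition matrix of [w]. For [s = m] the mark lies outside the positions of [R],
    and only the flag of the start state has an effect. *)
Definition reach (s : nat) w : marks := fwd (s == m) (single s) w.

Lemma pairing_reach s w Tt :
  pairing (reach s w) (s == m) Tt = pairing (single s) (s == m) (bwd Tt (rev w)).
Proof. exact: pairing_fwd. Qed.

(** Linearity of the forward run comes without a separate induction: by adjunction the run turns
    into a pairing of [V] with a fixed backward vector, and this is a union over the states of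
    [V]. *)
Lemma pairing_fwd_reach b V w Tt :
  pairing (fwd b V w) b Tt =
    has (fun s => V s && pairing (reach s w) (s == m) Tt) (iota 0 m) ||
    b && pairing (reach m w) true Tt.
Proof.
rewrite pairing_fwd pairing_linear; congr (_ || _).
  by apply: eq_has => s; rewrite pairing_reach.
by congr (_ && _); rewrite /reach -[true in RHS](eqxx m) pairing_reach eqxx.
Qed.

Lemma pairing_singler k V b : k < m -> pairing V b (single k, false) = V k.
Proof. by move=> lt; rewrite /pairing dotC dot_single lt andbF orbF. Qed.

Lemma fwd_reach b V w k : k < m ->
  fwd b V w k = has (fun s => V s && reach s w k) (iota 0 m) || b && reach m w k.
Proof.
move=> lt; rewrite -(@pairing_singler k _ b) // pairing_fwd_reach.
rewrite pairing_singler //; congr (_ || _).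
by apply: eq_has => s; rewrite pairing_singler.
Qed.

Lemma reach_cat s u w : reach s (u ++ w) = fwd (s == m) (reach s u) w.
Proof. exact: foldl_cat. Qed.

Lemma fwd_cat b V u w : fwd b V (u ++ w) = fwd b (fwd b V u) w.
Proof. exact: foldl_cat. Qed.

(** With nothing marked and the flag set, the backward direction of [fol] leaves exactly the leaves
    that can end a word of [R]. *)
Definition lasts : marks := fol false R 0 (fun=> false) true.

Lemma fend_pairing V b : fend true R 0 V = pairing V b (lasts, false).
Proof.
rewrite /pairing (dot_fol_adj true) /= andbF orbF [X in X || _](_ : _ = false) //.
by apply/hasP => -[].
Qed.

Definition acc (s : nat) w : bool := fend true R 0 (reach s w).

(** The identity behind [table]: with [u] the phrase of the base and [w] the labels below it, the
    backward vector of [w] does not depend on [s]. *)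
Lemma acc_bwd s u w :
  acc s (u ++ w) = pairing (reach s u) (s == m) (bwd (lasts, false) (rev w)).
Proof. by rewrite /acc reach_cat (fend_pairing _ (s == m)) pairing_fwd. Qed.

Lemma fend_fwd b V w :
  fend true R 0 (fwd b V w) =
    has (fun s => V s && acc s w) (iota 0 m) || b && acc m w.
Proof.
rewrite (fend_pairing _ b) pairing_fwd_reach; congr (_ || _).
  by apply: eq_has => s; rewrite -fend_pairing.
by rewrite -fend_pairing.
Qed.

Notation none := (fun _ : nat => false).

Definition ends (w : seq 'I_sigma) : bool :=
  fend true R 0 (fwd true none (map val w)).

(** The flag of the start state is set at every letter, so a match [w2] may begin anywhere. It is
    nonempty because a mark appears only once a letter has been read. *)
Lemma post_fwd (w v : seq 'I_sigma) :
  post R 0 (fwd true none (map val w)) v <->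
  exists w1 w2 : seq 'I_sigma, [/\ w = w1 ++ w2, w2 != [::] & lang R (w2 ++ v)].
Proof.
elim/last_ind: w v => [|w c IH] v.
  split=> [/post0//|[w1 [w2 [e ne _]]]].
  by case: w2 ne e => // a w2 _; case: w1.
rewrite map_rcons /fwd foldl_rcons post_step; last exact: codes_R.
split=> [[/IH [w1 [w2 [-> ne l]]]|[_ l]]|].
- exists w1, (rcons w2 c); rewrite rcons_cat cat_rcons; split=> //.
  by case: w2 {ne l}.
- by exists w, [:: c]; rewrite cats1.
move=> [w1 [w2 [+ ne l]]]; case: (lastP w2) ne l => // w2' c' _ l.
rewrite -rcons_cat => /rcons_inj[e ec]; move: l; rewrite cat_rcons -{}ec => l.
case: w2' e l => [|a w2'] e l; first by right.
by left; apply/IH; exists w1, (a :: w2').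
Qed.

Lemma ends_ending_position (Q : seq 'I_sigma) j : 1 <= j <= size Q ->
  ends (take j Q) <-> ending_position R Q j.
Proof.
move=> hj; rewrite /ends fend_post post_fwd.
split=> [[w1 [w2 [e ne l]]]|[i [hi [_ l]]]].
  have sz : size w1 + size w2 = j.
    by rewrite -size_cat -e size_take_min; lia.
  have s2 : 0 < size w2 by case: w2 ne {e l sz}.
  exists (size w1).+1; split; first lia; split; first by case/andP: hj.
  by rewrite e /= drop_size_cat // -[w2]cats0.
exists (take i.-1 (take j Q)), (drop i.-1 (take j Q)).
rewrite cat_take_drop cats0; split=> //.
by case/andP: hj => _ jQ; rewrite -size_eq0 size_drop size_takel //; lia.
Qed.

End Words.

(** * Paths to the root in a trie, and the nodes chosen as bases *)

Section Trie.

Variables (par lab : nat -> nat).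
Hypothesis par_lt : forall v, 0 < v -> par v < v.

(* The nodes on the path from v up to the root, without the root. *)
Fixpoint chain_rec (f v : nat) : seq nat :=
  if f is f'.+1 then if v == 0 then [::] else v :: chain_rec f' (par v)
  else [::].
Definition chain (v : nat) : seq nat := chain_rec v v.

Lemma chain_recE f v : v <= f -> chain_rec f v = chain v.
Proof.
elim/ltn_ind: v f => v IH [|f] le; first by case: v le {IH}.
rewrite /chain; case: v le IH => // v le IH /=; congr (_ :: _).
have lt := par_lt (ltn0Sn v).
by rewrite !IH //; lia.
Qed.

Lemma chainE v : 0 < v -> chain v = v :: chain (par v).
Proof.
by case: v => // v _; rewrite {1}/chain /= chain_recE //; have := par_lt (ltn0Sn v); lia.
Qed.

Lemma chain_ind (P : nat -> Prop) :
  P 0 -> (forall v, 0 < v -> P (par v) -> P v) -> forall v, P v.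
Proof.
move=> h0 hS; elim/ltn_ind => -[//|v] IH.
by apply: hS => //; apply: IH; apply: par_lt.
Qed.

Definition dep v := size (chain v).

Lemma depE v : 0 < v -> dep v = (dep (par v)).+1.
Proof. by move=> v0; rewrite /dep chainE. Qed.

Lemma dep_le v : dep v <= v.
Proof.
by elim/chain_ind: v => [|v v0 IH] //; rewrite depE //; have := par_lt v0; lia.
Qed.

(** The nodes above [v] thus correspond one to one to the positions inside the phrase of [v]. *)
Lemma map_dep_chain v : map dep (chain v) = rev (iota 1 (dep v)).
Proof.
elim/chain_ind: v => [|v v0 IH] //.
rewrite chainE //= IH (depE v0) -[(dep (par v)).+1 in RHS]addn1 iotaD rev_cat /=.
by rewrite add1n.
Qed.

Definition phrase v : seq nat := rev (map lab (chain v)).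

Lemma phraseE v : 0 < v -> phrase v = rcons (phrase (par v)) (lab v).
Proof. by move=> v0; rewrite /phrase chainE //= rev_cons. Qed.

Lemma size_phrase v : size (phrase v) = dep v.
Proof. by rewrite /phrase size_rev size_map. Qed.

Lemma phrase_prefix v x : x \in chain v -> phrase x = take (dep x) (phrase v).
Proof.
elim/chain_ind: v => [|v v0 IH] //; rewrite chainE // inE => /orP[/eqP ->|hx].
  by rewrite -size_phrase take_size.
rewrite (phraseE v0) -cats1 takel_cat ?IH // size_phrase.
elim/chain_ind: (par v) hx => [|u u0 IHu] //; rewrite chainE // inE.
by case/orP => [/eqP -> //|/IHu]; rewrite (depE u0); lia.
Qed.

(** The default 0 of [head] is the root, which is not in the chain and so encodes that no node
    satisfies [p]. *)
Definition lowest (p : pred nat) v : nat := head 0 (filter p (chain v)).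

Lemma lowest0 p : lowest p 0 = 0. Proof. by []. Qed.

Lemma lowestE p v : 0 < v -> lowest p v = if p v then v else lowest p (par v).
Proof. by move=> v0; rewrite /lowest chainE //=; case: ifP. Qed.

Lemma lowest_le p v : lowest p v <= v.
Proof.
elim/chain_ind: v => [|v v0 IH] //; rewrite lowestE //; case: ifP => // _.
by have := par_lt v0; lia.
Qed.

Lemma eq_lowest p q v : p =1 q -> lowest p v = lowest q v.
Proof. by move=> e; rewrite /lowest (eq_filter e). Qed.

(** Node numbers increase along every path down, so the lower of two nodes on a path is the one with
    the larger number. Comparing numbers therefore suffices in [best_match]. *)
Lemma lowestU p q v :
  lowest (predU p q) v = maxn (lowest p v) (lowest q v).
Proof.
elim/chain_ind: v => [|v v0 IH]; first by rewrite !lowest0.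
rewrite (lowestE _ v0) (lowestE p v0) (lowestE q v0) IH /=.
have hp := lowest_le p (par v); have hq := lowest_le q (par v).
have := par_lt v0.
by case: (p v) => /=; case: (q v) => /=; lia.
Qed.

(** All solutions on a path are enumerated by taking the lowest and resuming at its parent, as
    [report] does. *)
Lemma filter_chain p v : filter p (chain v) =
  if lowest p v == 0 then [::]
  else lowest p v :: filter p (chain (par (lowest p v))).
Proof.
elim/chain_ind: v => [|v v0 IH] //; rewrite lowestE // chainE //=.
by case: ifP => [_|_ //]; rewrite ifN //; lia.
Qed.

Variables (t r : nat).
Hypothesis r_lt : r < t.

(* Nodes at depths congruent to r modulo t keep the transition matrix of their
   phrase; for the root it is the identity. *)
Definition base v : bool := (v == 0) || (dep v %% t == r).

(* The number of steps from v up to a base is at most dist v. *)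
Definition dist v : nat := (dep v + (t - r)) %% t.

(** [dist v] is the depth minus [r] modulo [t], with [t - r] added to stay within the natural
    numbers. It drops by one towards the root unless it is 0, and 0 means that the depth has residue
    [r]. *)
Lemma dist_par v : 0 < v -> ~~ base v -> dist v = (dist (par v)).+1.
Proof.
rewrite /base /dist => v0; rewrite eqn0Ngt v0 depE //=.
set x := dep (par v) => h.
have e : (x.+1 + (t - r)) = (x + (t - r)).+1 by lia.
rewrite e modnS; case: ifP => // hd; case/negP: h.
have ex : t %| x.+1 + (t - r) by rewrite e.
have : x.+1 + (t - r) + r = r %[mod t].
  by rewrite -modnDml (eqP ex) add0n.
rewrite -addnA subnK; last by lia.
by rewrite modnDr => ->; rewrite modn_small.
Qed.

End Trie.

(** * The trie of the phrases *)

Section Input.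

Variable sigma : nat.
Implicit Types (Q : seq 'I_sigma) (Z : compressed sigma).

(* The trie whose nodes 1, ..., n have the phrases of the n elements of Z; for
   ZLW, fst v is the first letter of the phrase of v. *)
Record trie_of Q Z (par lab fst : nat -> nat) : Prop := TrieOf {
  trie_par0 : par 0 = 0;
  trie_par : forall v, 0 < v -> par v < v;
  trie_Q : exists ps, [/\ size ps = compressed_length Z, flatten ps = Q &
    forall i, i < size ps -> map val (nth [::] ps i) = phrase par lab i.+1];
  trie_enc : forall i, i < compressed_length Z ->
    let e := nth 0 (encode_compressed Z) in
    if Z is ZL78 _ then e (2 * i) = par i.+1 /\ e (2 * i).+1 = lab i.+1
    else if e i < sigma then [/\ par i.+1 = 0, lab i.+1 = e i & fst i.+1 = e i]
    else [/\ par i.+1 = (e i - sigma).+1, fst i.+1 = fst (par i.+1) &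
             lab i.+1 = fst (par i.+1).+1];
  trie_bound : forall i, nth 0 (encode_compressed Z) i < compressed_length Z + sigma + 1
}.

Lemma size_zl78_phrases (Z : seq (nat * 'I_sigma)) :
  size (zl78_phrases Z) = (size Z).+1.
Proof.
elim/last_ind: Z => // Z z IH.
by rewrite /zl78_phrases foldl_rcons !size_rcons IH.
Qed.

Lemma nth_zl78_phrases (Z : seq (nat * 'I_sigma)) z0 i : i < size Z ->
  nth [::] (zl78_phrases Z) i.+1 =
    rcons (nth [::] (take i.+1 (zl78_phrases Z)) (nth z0 Z i).1) (nth z0 Z i).2.
Proof.
elim/last_ind: Z => // Z z IH; have sz := size_zl78_phrases Z.
have -> : zl78_phrases (rcons Z z) =
    rcons (zl78_phrases Z) (rcons (nth [::] (zl78_phrases Z) z.1) z.2).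
  by rewrite /zl78_phrases foldl_rcons.
have tk j x : j <= (size Z).+1 ->
    take j (rcons (zl78_phrases Z) x) = take j (zl78_phrases Z).
  by move=> le; rewrite -cats1 takel_cat ?sz.
rewrite size_rcons ltnS leq_eqVlt => /orP[/eqP ->|lt].
  by rewrite tk // !nth_rcons sz !ltnn !eqxx -sz take_size.
by rewrite tk 1?ltnW // !nth_rcons sz ltnS lt IH.
Qed.

Lemma nth_pairs (Z : seq (nat * 'I_sigma)) i :
  nth 0 (flatten [seq [:: z.1; val z.2] | z <- Z]) (2 * i) = nth 0 (unzip1 Z) i /\
  nth 0 (flatten [seq [:: z.1; val z.2] | z <- Z]) (2 * i).+1 =
    nth 0 [seq val z.2 | z <- Z] i.
Proof.
elim: Z i => [|z Z IH] [|i]; rewrite ?nth_nil //.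
by rewrite (_ : 2 * i.+1 = (2 * i).+2); [apply: IH|lia].
Qed.

Lemma trie_zl78 Q (Z : seq (nat * 'I_sigma)) : zl78_compressed Q Z ->
  exists par lab fst, trie_of Q (ZL78 Z) par lab fst.
Proof.
move=> [wf hQ _].
pose par v := if v is i.+1 then nth 0 (unzip1 Z) i else 0.
pose lab v := if v is i.+1 then nth 0 [seq val z.2 | z <- Z] i else 0.
have par_lt v : 0 < v -> par v < v.
  case: v => // i _ /=; case: (ltnP i (size Z)) => lt; first exact: wf.
  by rewrite nth_default // size_map.
have sz := size_zl78_phrases Z.
have head0 : nth [::] (zl78_phrases Z) 0 = [::].
  elim/last_ind: {wf hQ par lab par_lt sz} Z => // Z z IH.
  by rewrite /zl78_phrases foldl_rcons nth_rcons size_zl78_phrases IH.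
have ph v : v <= size Z ->
    map val (nth [::] (zl78_phrases Z) v) = phrase par lab v.
  elim/(chain_ind par_lt): v => [|v v0 IH] le; first by rewrite head0.
  rewrite phraseE // -IH; last by have := par_lt _ v0; lia.
  case: v v0 le IH => // i _ lt _.
  have [z0 _] : exists z0 : nat * 'I_sigma, True.
    by case: (Z) lt => // z0 _ _; exists z0.
  have e1 : nth 0 (unzip1 Z) i = (nth z0 Z i).1 by apply: nth_map.
  have e2 : lab i.+1 = (nth z0 Z i).2.
    by apply: (nth_map z0 0 (fun z : nat * 'I_sigma => val z.2)).
  rewrite (nth_zl78_phrases z0) // map_rcons e2; congr rcons.
  by rewrite /par e1 nth_take // -e1; apply: wf.
exists par, lab, (fun=> 0); split=> //.
- exists (behead (zl78_phrases Z)); split.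
  + by rewrite size_behead sz.
  + by rewrite -hQ; case: (zl78_phrases Z) head0 => //= p ps ->.
  + by move=> i; rewrite size_behead sz nth_behead => lt; apply: ph.
- by move=> i lt /=; apply: nth_pairs.
(* Entry [k] of the encoding is a reference for even [k] and a letter for odd [k]. *)
- move=> k; rewrite /= -(odd_double_half k) -muln2 mulnC.
  case: (nth_pairs Z k./2) => e1 e2; case: (ltnP k./2 (size Z)) => lt.
    have [z0 _] : exists z0 : nat * 'I_sigma, True.
      by case: (Z) lt => // z0 _ _; exists z0.
    case: (odd k); rewrite ?add0n ?add1n ?e1 ?e2.
      by rewrite (nth_map z0) //; have := ltn_ord (nth z0 Z k./2).2; rewrite /=; lia.
    by have := wf _ lt; lia.
  by case: (odd k); rewrite ?add0n ?add1n ?e1 ?e2 nth_default ?size_map //; lia.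
Qed.

(** Code [sigma + k] denotes the entry made by element [k], whose phrase belongs to node [k.+1]. The
    label is the first letter of the phrase after it, that of node [k.+2]; this may be the very node
    being defined, whose first letter then comes from its parent. *)
Lemma trie_zlw Q (Z : seq nat) : zlw_compressed Q Z ->
  exists par lab fst, trie_of Q (ZLW sigma Z) par lab fst.
Proof.
move=> [ps [sz he hQ _]].
pose par v := if v is i.+1 then
  let c := nth 0 Z i in
  if (i < size Z) && (sigma <= c) then (c - sigma).+1 else 0 else 0.
pose fst v := if v is i.+1 then nth 0 (map val (nth [::] ps i)) 0 else 0.
pose lab v := if v is i.+1 then
  let c := nth 0 Z i in if c < sigma then c else fst (par v).+1 else 0.
have par_lt v : 0 < v -> par v < v.
  case: v => // i _ /=; case: ifP => // /andP[lt ge].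
  case: (he _ lt) => [[a [e _]]|[k [lk e _]]]; last by rewrite e; lia.
  by have := ltn_ord a; lia.
(* Nonempty phrases guarantee that [take 1] in [zlw_entry] yields a letter. *)
have ne i : i < size Z -> nth [::] ps i != [::].
  elim/ltn_ind: i => i IH lt.
  case: (he _ lt) => [[a [_ ->]]//|[k [lk _ ->]]].
  by have := IH k lk (ltn_trans lk lt); case: (nth _ _ k).
have eqs i : i < size Z ->
    if nth 0 Z i < sigma then
      [/\ par i.+1 = 0, lab i.+1 = nth 0 Z i, fst i.+1 = nth 0 Z i &
          map val (nth [::] ps i) = [:: nth 0 Z i]]
    else [/\ par i.+1 = (nth 0 Z i - sigma).+1, fst i.+1 = fst (par i.+1),
           lab i.+1 = fst (par i.+1).+1 &
           map val (nth [::] ps i) =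
             rcons (map val (nth [::] ps (nth 0 Z i - sigma))) (lab i.+1)].
  move=> lt; case: (he _ lt) => [[a [e ep]]|[k [lk e ep]]].
    have la := ltn_ord a; have la' : (sigma <= a) = false by lia.
    by rewrite /par /lab /fst ep e la la' andbF.
  have kge : (nth 0 Z i < sigma) = false by rewrite e; lia.
  have hp : par i.+1 = k.+1 by rewrite /par lt leqNgt kge /= e addKn.
  have hl : lab i.+1 = fst k.+2 by rewrite /lab kge hp.
  have lk1 := leq_ltn_trans lk lt.
  have := ne _ (ltn_trans lk lt); have := ne _ lk1.
  rewrite kge hp hl /fst e addKn ep.
  case: (nth _ ps k) => // a w; case: (nth _ ps k.+1) => // b w' _ _.
  by split=> //=; rewrite take0 map_cat cats1.
exists par, lab, fst; split=> //.
- exists ps; split=> // i; rewrite sz => lt.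
  elim/ltn_ind: i lt => i IH lt; rewrite phraseE //.
  have := eqs _ lt; have := par_lt i.+1 isT; case: ifP => _ hp.
    by case=> -> -> _ ->.
  case=> ep _ _ ->; rewrite {1}ep -IH //; lia.
- by move=> i lt /=; have := eqs _ lt; case: ifP => _ [e1 e2 e3 _]; split.
- move=> i /=; case: (ltnP i (size Z)) => lt; last by rewrite nth_default //; lia.
  case: (he _ lt) => [[a [-> _]]|[k [lk -> _]]]; last by lia.
  by have := ltn_ord a; lia.
Qed.

Lemma compressed_trie Q Z : compressed_into Q Z ->
  exists par lab fst, trie_of Q Z par lab fst.
Proof. by case: Z => Z; [apply: trie_zl78|apply: trie_zlw]. Qed.

End Input.

(** * The algorithm *)

Notation vTag := 0 (only parsing).
Notation vSig := 1 (only parsing).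
Notation vN := 2 (only parsing).
Notation vM := 3 (only parsing).
Notation vTau := 4 (only parsing).
Notation vStep := 5 (only parsing).
Notation vRes := 6 (only parsing).
Notation vI := 7 (only parsing).
Notation vK := 8 (only parsing).
Notation vK' := 9 (only parsing).
Notation vX := 10 (only parsing).
Notation vP := 11 (only parsing).
Notation vQ := 12 (only parsing).
Notation vF := 13 (only parsing).
Notation vS := 14 (only parsing).
Notation vD := 15 (only parsing).
Notation vB := 16 (only parsing).
Notation vE := 17 (only parsing).
Notation vBase := 18 (only parsing).
Notation vLen := 19 (only parsing).
Notation vJ := 20 (only parsing).
Notation vC := 21 (only parsing).
Notation vRow := 22 (only parsing).
Notation vT := 23 (only parsing).
Notation vBest := 24 (only parsing).
Notation vCur := 25 (only parsing).
Notation vCnt := 26 (only parsing).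
Notation vPos := 27 (only parsing).
Notation vG := 28 (only parsing).
Notation vA := 29 (only parsing).
Notation vNode := 30 (only parsing).

(** For each position of [R], [aLo] and [aNul] hold the first leaf and the nullability of its
    subexpression, and [aF] the flags. [aV] holds marks and, between the two passes, the values of
    [fend]; [aLst] holds [lasts]. [aPath] has the labels up to the base, [aMid] the number of a
    node's matrix in [aMat], [aM] the table of lowest accepting nodes, and [aS] the active states
    before the current phrase. [aFst] gives first letters of phrases in the case of ZLW. *)
Notation aPar := 0 (only parsing).
Notation aLab := 1 (only parsing).
Notation aDep := 2 (only parsing).
Notation aFst := 3 (only parsing).
Notation aLo := 4 (only parsing).
Notation aNul := 5 (only parsing).
Notation aV := 6 (only parsing).
Notation aF := 7 (only parsing).
Notation aLst := 8 (only parsing).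
Notation aPath := 9 (only parsing).
Notation aMid := 10 (only parsing).
Notation aMat := 11 (only parsing).
Notation aM := 12 (only parsing).
Notation aS := 13 (only parsing).

Notation "e1 [+] e2" := (EOp OpAdd e1 e2) (at level 50, left associativity).
Notation "e1 [-] e2" := (EOp OpSub e1 e2) (at level 50, left associativity).
Notation "e1 [*] e2" := (EOp OpMul e1 e2) (at level 40, left associativity).
Notation "e1 [%] e2" := (EOp OpMod e1 e2) (at level 40, left associativity).

(* The position in the input of symbol e of the regular expression. *)
Definition rpos (e : expr) : expr :=
  EC 5 [+] EV vN [*] (EC 2 [-] EV vTag) [+] e.

(* The right child vP and the left child vQ of node vK; in the direction given
   by vD, words pass through vF first and vS second. *)
Definition children : cmd :=
  vP <:- EV vK [-] EC 1 ;; vQ <:- EArr aLo (EV vP) [-] EC 1 ;;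
  If (EV vD) (vF <:- EV vQ ;; vS <:- EV vP) (vF <:- EV vP ;; vS <:- EV vQ).

Definition up_body : cmd :=
  vX <:- EIn (rpos (EV vK)) ;;
  If (ELt (EC 2) (EV vX)) Skip (
    children ;;
    If (EEq (EV vX) (EC 2))
      (Store aV (EV vK) (EArr aV (EV vP)))
      (If (EV vX)
        (Store aV (EV vK) (EOr (EArr aV (EV vP)) (EArr aV (EV vQ))))
        (Store aV (EV vK) (EOr (EArr aV (EV vS))
          (EAnd (EArr aNul (EV vS)) (EArr aV (EV vF))))))).

(** The children of [vK] still hold results of the upward pass in [aV]. The cell of [vK] itself has
    already been read by its parent, so the final mark can replace it, which is 0 for an
    operator. *)
Definition down_body : cmd :=
  vK <:- EV vM [-] EV vK' [-] EC 1 ;;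
  vX <:- EIn (rpos (EV vK)) ;;
  If (ELt (EC 2) (EV vX)) (Store aV (EV vK) (EArr aF (EV vK))) (
    children ;;
    If (EEq (EV vX) (EC 2))
      (Store aF (EV vP) (EOr (EArr aF (EV vK)) (EArr aV (EV vP))))
      (If (EV vX)
        (Store aF (EV vP) (EArr aF (EV vK)) ;; Store aF (EV vQ) (EArr aF (EV vK)))
        (Store aF (EV vF) (EArr aF (EV vK)) ;;
         Store aF (EV vS) (EOr (EArr aV (EV vF))
           (EAnd (EArr aNul (EV vF)) (EArr aF (EV vK)))))) ;;
    Store aV (EV vK) (EC 0)).

(** [vE] saves the value at the root, [fend] of the whole expression, before the downward pass
    overwrites it. *)
Definition follow : cmd :=
  For vK (EV vM) up_body ;;
  vE <:- EArr aV (EV vM [-] EC 1) ;;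
  Store aF (EV vM [-] EC 1) (EV vB) ;;
  For vK' (EV vM) down_body.

Definition filter_letter : cmd :=
  For vK (EV vM)
    (Store aV (EV vK) (EAnd (EArr aV (EV vK))
      (EEq (EIn (rpos (EV vK))) (EV vC [+] EC 3)))).

(* Clearing the hypotheses that are not comparisons makes lia much faster. *)
Ltac nlia :=
  repeat match goal with
  | H : @eq bool _ _ |- _ => clear H
  | H : @eq nat _ (if _ then _ else _) |- _ => clear H
  | H : _ |- _ =>
      lazymatch type of H with
      | is_true _ => fail
      | @eq nat _ _ => fail
      | @eq (Equality.sort _) _ _ => fail
      | _ <= _ => fail
      | _ => clear H
      end
  end; lia.

Lemma same_v x c s s' : same c s s' -> x \notin modv c -> sv s' x = sv s x.
Proof. by case=> h _ _; apply: h. Qed.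

Lemma same_a a c s s' : same c s s' -> a \notin moda c -> sa s' a = sa s a.
Proof. by case=> _ h _; apply: h. Qed.

(** * Correctness of the two passes *)

Section Follow.

Variables (sigma : nat) (R : regexp 'I_sigma) (inp : seq nat) (L B n tag : nat).
Notation m := (re_length R).
Notation nd k := (node R 0 k).
Notation spec := (spec inp L B).

Hypothesis Hsym : forall k, k < m ->
  nth 0 inp (5 + n * (2 - tag) + k) = nth 0 (encode_regexp R) k.
Hypothesis mL : m < L.

Definition regex_env (s : state) : Prop :=
  [/\ sv s vTag = tag, sv s vN = n, sv s vM = m,
      forall k, k < m -> sa s aLo k = (nd k).2 &
      forall k, k < m -> sa s aNul k = nullable (nd k).1].

Lemma regex_env_same c s s' : same c s s' ->
  all (fun x => x \notin modv c) [:: vTag; vN; vM] ->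
  all (fun a => a \notin moda c) [:: aLo; aNul] ->
  regex_env s -> regex_env s'.
Proof.
move=> h /= /and4P[h1 h2 h3 _] /and3P[h4 h5 _] [e1 e2 e3 e4 e5].
by split; rewrite ?(same_v h) ?(same_a h).
Qed.

Lemma nth_rpos s e : sv s vTag = tag -> sv s vN = n -> eval inp s e < m ->
  nth 0 inp (eval inp s (rpos e)) = symbol (nd (eval inp s e)).1.
Proof.
move=> e1 e2 lt; rewrite /rpos /= e1 e2 Hsym //.
by rewrite (code_node (@codes_R _ R)).
Qed.

Lemma input_symbol s e : regex_env s -> eval inp s e < m ->
  nth 0 inp (eval inp s (rpos e)) = symbol (nd (eval inp s e)).1.
Proof. by move=> [e1 e2 _ _ _]; apply: nth_rpos. Qed.

#[local] Opaque rpos.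

(** Of [aLo] only the entry at [k.-1] is assumed, so that the lemma also applies while [build_regex]
    is still filling this array. *)
Lemma children_spec s k (d : bool) :
  sa s aLo k.-1 = (nd k.-1).2 -> sv s vK = k -> 0 < k < m -> sv s vD = d ->
  spec children s (fun s' => [/\ tm s' <= tm s + 5, same children s s',
    sv s' vP = k.-1, sv s' vQ = (nd k.-1).2.-1 &
    sv s' vF = (if d then (nd k.-1).2.-1 else k.-1) /\
    sv s' vS = (if d then k.-1 else (nd k.-1).2.-1)]).
Proof.
move=> hlo hk km hd; apply: spec_frame.
apply: spec_seq; apply: spec_assign => //=.
apply: spec_seq; apply: spec_assign => //=; first by lia.
rewrite hk subn1 hlo ?subn1.
apply: spec_if => //=; rewrite hd => hd';
  apply: spec_seq; apply: spec_assign => //=; apply: spec_assign => //= sm;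
  by split=> //=; [lia|case: (d) hd'].
Qed.

Lemma symbol_cases (R' : regexp 'I_sigma) : symbol R' <= 2 ->
  [\/ exists R1 R2, R' = Cat R1 R2, exists R1 R2, R' = Alt R1 R2 |
      exists R1, R' = Star R1].
Proof.
case: R' => //= [R1 R2|R1 R2|R1] _.
- by constructor 1; exists R1, R2.
- by constructor 2; exists R1, R2.
- by constructor 3; exists R1.
Qed.

Lemma up_body_spec s k (d : bool) (V : nat -> bool) :
  regex_env s -> sv s vK = k -> k < m -> sv s vD = d ->
  (forall j, j < k -> sa s aV j = fend d (nd j).1 (nd j).2 V) ->
  (forall j, k <= j < m -> sa s aV j = V j) ->
  spec up_body s (fun s' => [/\ tm s' <= tm s + 12,
    forall j, j <= k -> sa s' aV j = fend d (nd j).1 (nd j).2 V &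
    forall j, k < j < m -> sa s' aV j = V j]).
Proof.
move=> env ek km hd hl hr.
case E: (nd k) => [R' o']; have hk : 0 <= k < 0 + m by nlia.
have [_] := node_size hk; rewrite E /= => sz'.
have hN j : j <= k -> j = k \/ j < k by nlia.
apply: spec_seq; apply: spec_assign => //=.
rewrite input_symbol //=; last by rewrite ek.
rewrite ek E /=.
apply: spec_if => //= hx.
  apply: spec_skip; split=> /= [|j /hN[->|jk]|j hj];
    rewrite ?E /=; [nlia| |exact: hl|apply: hr; nlia].
  case: R' E hx sz' => //= a E _ sz'; rewrite hr; first by congr V; nlia.
  by nlia.
have {}hx : symbol R' <= 2 by nlia.
have k0 : 0 < k.
  have := re_length_gt0 R'; case: R' E sz' hx => //= [R1 R2|R1 R2|R1] _ sz' _ _.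
  - by have := re_length_gt0 R1; nlia.
  - by have := re_length_gt0 R1; nlia.
  - by have := re_length_gt0 R1; nlia.
apply: spec_seq; set s1 := tick _.
have hk1 : 0 < k < m by nlia.
have hlo : sa s1 aLo k.-1 = (nd k.-1).2.
  by case: env => _ _ _ h _; apply: h; nlia.
apply: spec_conseq (children_spec (s := s1) hlo ek hk1 hd) _.
move=> s2 [t2 sm2 hP hQ [hF hS]].
have env2 : regex_env s2 by exact: regex_env_same sm2 isT isT env.
have hV2 : sa s2 aV = sa s aV by rewrite (same_a sm2).
have hX2 : sv s2 vX = symbol R' by rewrite (same_v sm2).
have hK2 : sv s2 vK = k by rewrite (same_v sm2).
have hnul := let: And5 _ _ _ _ h := env2 in h.
have fin (v t : nat) : t <= tm s2 + 3 ->
    v = fend d R' o' V -> [/\ t <= tm s + 12,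
    forall j, j <= k -> (if j == k then v else sa s2 aV j) = fend d (nd j).1 (nd j).2 V &
    forall j, k < j < m -> (if j == k then v else sa s2 aV j) = V j].
  move=> ht ev; split; first by move: t2 => /=; nlia.
    move=> j /hN[->|jk]; first by rewrite eqxx E ev.
    by rewrite ifN ?hV2 ?hl //; nlia.
  by move=> j hj; rewrite ifN ?hV2 ?hr //; nlia.
have km1 : k.-1 < L by nlia.
have [[R1 [R2 eR]]|[R1 [R2 eR]]|[R1 eR]] := symbol_cases hx.
- have [n1 n2 _] := node_cat_alt hk E (or_introl eR).
  have s1gt := re_length_gt0 R1; move: sz'; rewrite eR /= => sz'.
  have s2gt := re_length_gt0 R2.
  have ql : (o' + re_length R1).-1 < k by nlia.
  have pl : k.-1 < k by nlia.
  rewrite n1 /= in hQ hF hS.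
  apply: spec_if => /=; rewrite ?hX2 ?eR //= => _.
  apply: spec_if => /=; rewrite ?hX2 ?eR //= => _.
  apply: spec_store; rewrite /= ?hK2 ?hS ?hF //; first by case: (d); nlia.
    by nlia.
  apply: fin; rewrite ?addn3 // hV2 eR /=.
  by move: hl; case: (d) => hl'; rewrite !hl' // hnul ?n1 ?n2 /= ?lt0b //; nlia.
- have [n1 n2 _] := node_cat_alt hk E (or_intror eR).
  have s1gt := re_length_gt0 R1; move: sz'; rewrite eR /= => sz'.
  have s2gt := re_length_gt0 R2.
  have ql : (o' + re_length R1).-1 < k by nlia.
  have pl : k.-1 < k by nlia.
  rewrite n1 /= in hQ.
  apply: spec_if => /=; rewrite ?hX2 ?eR //= => _.
  apply: spec_if => /=; rewrite ?hX2 ?eR //= => _.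
  apply: spec_store; rewrite /= ?hK2 ?hP ?hQ //; try nlia.
  apply: fin; rewrite ?addn3 // hV2 eR /=.
  by rewrite !hl // n1 n2 /= !lt0b orbC.
have [n1 _] := node_star hk (etrans E (congr1 (pair^~ o') eR)).
have pl : k.-1 < k by nlia.
apply: spec_if => /=; rewrite ?hX2 ?eR //= => _.
apply: spec_store; rewrite /= ?hK2 ?hP //; try nlia.
by apply: fin; [nlia|rewrite hV2 eR /= hl ?n1].
Qed.

(** The positions with a valid flag in [aF] after [i] rounds of the downward pass: the root, and the
    children of the positions visited. *)
Definition flagged (i j : nat) : Prop :=
  j = m.-1 \/ exists k, m - i <= k < m /\ child (nd k) j.

Lemma down_body_spec s i (d b : bool) (V : nat -> bool) :
  regex_env s -> sv s vK' = i -> i < m -> sv s vD = d ->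
  (forall j, j < m - i -> sa s aV j = fend d (nd j).1 (nd j).2 V) ->
  (forall j, m - i <= j < m -> sa s aV j = fol d R 0 V b j) ->
  (forall j, flagged i j -> sa s aF j = flag d R 0 V b j) ->
  spec down_body s (fun s' => [/\ tm s' <= tm s + 16,
    forall j, j < m - i.+1 -> sa s' aV j = fend d (nd j).1 (nd j).2 V,
    forall j, m - i.+1 <= j < m -> sa s' aV j = fol d R 0 V b j &
    forall j, flagged i.+1 j -> sa s' aF j = flag d R 0 V b j]).
Proof.
move=> env ei im hd hV hW hF.
have hm : sv s vM = m by case: env.
have [k ek] : exists k, k = m - i - 1 by eexists.
have km : k < m by nlia.
have kL : k < L by nlia.
case E: (nd k) => [R' o']; have hk : 0 <= k < 0 + m by nlia.
have [_] := node_size hk; rewrite E /= => sz'.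
have hlow j : j < m - i.+1 -> j < m - i /\ (j == k) = false by nlia.
have hhigh j : m - i.+1 <= j < m -> j = k \/ (m - i <= j < m /\ (j == k) = false) by nlia.
have hfl j : flagged i.+1 j -> flagged i j \/ child (nd k) j.
  case=> [->|[k1 [hk1 c1]]]; first by left; left.
  case: (eqVneq k1 k) => [<-|ne]; first by right.
  by left; right; exists k1; split=> //; nlia.
(* The current position is the root, or [parent] gives a larger position, already visited, of which
   it is a child. *)
have Fk : sa s aF k = flag d R 0 V b k.
  apply: hF; case: (eqVneq k m.-1) => [->|ne]; first by left.
  have [|k1 [hk1 c1]] := @parent _ R 0 k; first by nlia.
  by right; exists k1; split=> //; nlia.
have folk := fol_flag d V b hk; rewrite E /= in folk.
apply: spec_seq; apply: spec_assign => //=.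
rewrite hm ei -ek.
apply: spec_seq; apply: spec_assign => //=.
rewrite input_symbol //= E /=.
apply: spec_if => //= hx.
  apply: spec_store => //=.
  split=> /= [|j /hlow[lt ->]|j /hhigh[->|[hj ->]]|j /hfl[h|]]; first by nlia.
  - exact: hV.
  - by rewrite eqxx Fk folk; case: ltnP hx => //=.
  - exact: hW.
  - exact: hF.
  - by rewrite E; case: (R') hx.
have {}hx : symbol R' <= 2 by nlia.
have k0 : 0 < k.
  have := re_length_gt0 R'; case: R' E sz' hx folk => //= [R1 R2|R1 R2|R1] _ sz' _ _ _.
  - by have := re_length_gt0 R1; nlia.
  - by have := re_length_gt0 R1; nlia.
  - by have := re_length_gt0 R1; nlia.
apply: spec_seq; set s1 := tick _.
have hk1 : 0 < k < m by nlia.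
have hlo : sa s1 aLo k.-1 = (nd k.-1).2.
  by case: env => _ _ _ h _; apply: h; nlia.
apply: spec_conseq (children_spec hlo (erefl : sv s1 vK = k) hk1 hd) _.
move=> s2 [t2 sm2 hP hQ [hFF hS]].
have hV2 : sa s2 aV = sa s aV by rewrite (same_a sm2).
have hF2 : sa s2 aF = sa s aF by rewrite (same_a sm2).
have hX2 : sv s2 vX = symbol R' by rewrite (same_v sm2).
have hK2 : sv s2 vK = k by rewrite (same_v sm2).
have hnul j : j < m -> sa s2 aNul j = nullable (nd j).1.
  by rewrite (same_a sm2) //; case: env => _ _ _ _ h; apply: h.
have fin s3 : tm s3 <= tm s2 + 4 -> sv s3 vK = k -> sa s3 aV = sa s aV ->
    (forall j, flagged i j \/ child (nd k) j -> sa s3 aF j = flag d R 0 V b j) ->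
    spec (Store aV (EV vK) (EC 0)) s3 (fun s' => [/\ tm s' <= tm s + 16,
      forall j, j < m - i.+1 -> sa s' aV j = fend d (nd j).1 (nd j).2 V,
      forall j, m - i.+1 <= j < m -> sa s' aV j = fol d R 0 V b j &
      forall j, flagged i.+1 j -> sa s' aF j = flag d R 0 V b j]).
  move=> t3 hK3 hV3 hF3; apply: spec_store => //=; first by rewrite hK3.
  rewrite hK3 hV3.
  split=> /= [|j /hlow[lt ->]|j /hhigh[->|[hj ->]]|j /hfl h].
  - by move: t2 => /=; nlia.
  - exact: hV.
  - by rewrite eqxx folk; case: ltnP hx => //=; nlia.
  - exact: hW.
  - exact: hF3.
apply: spec_seq.
have [[R1 [R2 eR]]|[R1 [R2 eR]]|[R1 eR]] := symbol_cases hx.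
- have [n1 n2 f12] := node_cat_alt hk E (or_introl eR).
  have s1gt := re_length_gt0 R1; move: sz'; rewrite eR /= => sz'.
  have s2gt := re_length_gt0 R2.
  have ql : (o' + re_length R1).-1 < k by nlia.
  have pl : k.-1 < k by nlia.
  have qp : ((o' + re_length R1).-1 == k.-1) = false by nlia.
  have pq : (k.-1 == (o' + re_length R1).-1) = false by nlia.
  rewrite n1 /= in hQ hFF hS.
  have Fl : sv s2 vF < L by rewrite hFF; case: (d); nlia.
  have Sl : sv s2 vS < L by rewrite hS; case: (d); nlia.
  apply: spec_if => /=; rewrite ?hX2 ?eR //= => _.
  apply: spec_if => /=; rewrite ?hX2 ?eR //= => _.
  apply: spec_seq; apply: spec_store; rewrite /= ?hK2 //; try nlia.
  apply: spec_store; rewrite /= ?hK2 //; try nlia.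
  apply: fin => //=; first by nlia.
  rewrite hF2 hV2 => j hj.
  have [fq fp] := f12 d V b; rewrite eR in fq fp.
  have Vq : sa s aV (o' + re_length R1).-1 = fend d R1 o' V.
    by rewrite hV ?n2 //; nlia.
  have Vp : sa s aV k.-1 = fend d R2 (o' + re_length R1) V.
    by rewrite hV ?n1 //; nlia.
  have nulp := hnul k.-1; have nulq := hnul (o' + re_length R1).-1.
  rewrite n1 n2 /= in nulp nulq.
  (* The second store reads the flag at [k] after the first one has changed [aF]. *)
  have kF : (k == sv s2 vF) = false by rewrite hFF; case: (d); nlia.
  rewrite kF Fk hS hFF.
  case: (eqVneq j k.-1) => [->|jp].
    rewrite fp; case: (d) Vq => Vq; rewrite ?eqxx ?pq ?Fk //.
    by rewrite Vq nulq ?lt0b //; nlia.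
  case: (eqVneq j (o' + re_length R1).-1) => [->|jq].
    rewrite fq; case: (d) Vp => Vp; rewrite ?eqxx ?qp ?Fk //.
    by rewrite Vp nulp ?lt0b //; nlia.
  have -> : (j == (if d then k.-1 else (o' + re_length R1).-1)) = false.
    by case: (d); apply/negbTE.
  have -> : (j == (if d then (o' + re_length R1).-1 else k.-1)) = false.
    by case: (d); apply/negbTE.
  case: hj => [|]; first exact: hF.
  rewrite E eR /child /= => -[]; first by move/eqP; rewrite (negPf jq).
  by move/eqP; rewrite (_ : _.-1 = k.-1) ?(negPf jp) //; nlia.
- have [n1 n2 f12] := node_cat_alt hk E (or_intror eR).
  have s1gt := re_length_gt0 R1; move: sz'; rewrite eR /= => sz'.
  have s2gt := re_length_gt0 R2.
  have ql : (o' + re_length R1).-1 < k by nlia.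
  have pl : k.-1 < k by nlia.
  have kp : (k == k.-1) = false by nlia.
  rewrite n1 /= in hQ.
  apply: spec_if => /=; rewrite ?hX2 ?eR //= => _.
  apply: spec_if => /=; rewrite ?hX2 ?eR //= => _.
  apply: spec_seq; apply: spec_store; rewrite /= ?hK2 ?hP //; try nlia.
  apply: spec_store; rewrite /= ?hK2 ?hQ //; try nlia.
  apply: fin => //=; first by nlia.
  rewrite hF2 kp Fk => j hj.
  have [fq fp] := f12 d V b; rewrite eR in fq fp.
  case: (eqVneq j (o' + re_length R1).-1) => [->|jq]; first by rewrite fq.
  case: (eqVneq j k.-1) => [->|jp]; first by rewrite fp.
  case: hj => [|]; first exact: hF.
  rewrite E eR /child /= => -[]; first by move/eqP; rewrite (negPf jq).
  by move/eqP; rewrite (_ : _.-1 = k.-1) ?(negPf jp) //; nlia.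
have [n1 f1] := node_star hk (etrans E (congr1 (pair^~ o') eR)).
have pl : k.-1 < k by nlia.
have s1gt := re_length_gt0 R1; move: sz'; rewrite eR /= => sz'.
apply: spec_if => /=; rewrite ?hX2 ?eR //= => _.
apply: spec_store; rewrite /= ?hK2 ?hP //; try nlia.
apply: fin => //=; first by nlia.
rewrite hF2 hV2 => j hj; case: (eqVneq j k.-1) => [->|jp].
  by rewrite f1 Fk hV ?n1 ?lt0b //; nlia.
case: hj => [|]; first exact: hF.
by rewrite E eR /child /= => /eqP; rewrite (_ : _.-1 = k.-1) ?(negPf jp) //; nlia.
Qed.

Lemma follow_spec s (d b : bool) (V : nat -> bool) :
  regex_env s -> (forall k, k < m -> sa s aV k = V k) ->
  sv s vD = d -> sv s vB = b ->
  spec follow s (fun s' => [/\ tm s' <= tm s + 40 * m,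
    forall k, k < m -> sa s' aV k = fol d R 0 V b k &
    sv s' vE = fend d R 0 V]).
Proof.
move=> env hV hd hb; have m0 := re_length_gt0 R.
apply: spec_seq.
(* The body takes 12 ticks, the test and the increment one each. Likewise 16 + 2 = 18 for the second
   loop. *)
apply: (@spec_for _ _ _ _ _ _ m (fun k s' =>
  [/\ tm s' <= tm s + 1 + 14 * k,
      forall j, j < k -> sa s' aV j = fend d (nd j).1 (nd j).2 V &
      forall j, k <= j < m -> sa s' aV j = V j])) => //.
- by move=> s' sm; have [] := regex_env_same sm isT isT env.
- by split=> /= [|//|j jm]; [nlia|rewrite hV].
- move=> k s1 km sm ek [ht hl hr].
  have env1 : regex_env (tick s1) := regex_env_same sm isT isT env.
  have hd1 : sv (tick s1) vD = d by rewrite /= (same_v sm).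
  apply: spec_conseq (up_body_spec env1 ek km hd1 hl hr) _ => s2 [t2 hl2 hr2].
  by split=> /=; [move: t2 => /=; nlia| |].
move=> s1 sm1 _ [t1 hl1 _].
have env1 := regex_env_same sm1 isT isT env.
have root1 : nd m.-1 = (R, 0) by exact: node_root R 0.
have hm1 : sv s1 vM = m by case: env1.
have m1 : m.-1 < L by nlia.
apply: spec_seq; apply: spec_assign => //=.
  by rewrite hm1 subn1.
apply: spec_seq; apply: spec_store => //=; rewrite ?hm1 ?subn1 //.
set s2 := seta _ _ _ _.
have env2 : regex_env s2 by [].
apply: (@spec_for _ _ _ _ _ _ m (fun i s' =>
  [/\ tm s' <= tm s + 5 + 14 * m + 18 * i,
      forall j, j < m - i -> sa s' aV j = fend d (nd j).1 (nd j).2 V,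
      forall j, m - i <= j < m -> sa s' aV j = fol d R 0 V b j &
      forall j, flagged i j -> sa s' aF j = flag d R 0 V b j])) => //.
- by move=> s' sm; have [] := regex_env_same sm isT isT env2.
- split=> /= [|j jm|j jm|j]; first by nlia.
  + by rewrite hl1 //; nlia.
  + by nlia.
  + case=> [->|[k [hk _]]]; last by nlia.
    by rewrite eqxx (same_v sm1) // hb -[m.-1]/(0 + m).-1 flag_root.
- move=> i s3 im sm ei [t3 h1 h2 h3].
  have env3 : regex_env (tick s3) := regex_env_same sm isT isT env2.
  have hd3 : sv (tick s3) vD = d by rewrite /= (same_v sm) //= (same_v sm1).
  apply: spec_conseq (down_body_spec env3 ei im hd3 h1 h2 h3) _.
  by move=> s4 [t4 g1 g2 g3]; split=> //=; move: t4 => /=; nlia.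
move=> s3 sm3 _ [t3 _ h3 _]; split=> /= [|k km|]; first by nlia.
  by rewrite h3 //; nlia.
by rewrite (same_v sm3) //= hl1 ?root1 //; nlia.
Qed.

End Follow.

Definition inc (x : nat) : cmd := x <:- EV x [+] EC 1.

(** [aPath] lists labels from the node upwards, so a forward run reads it from its end and
    [bwd_path] from its beginning. *)
Definition fwd_path : cmd :=
  vD <:- EC 1 ;;
  For vJ (EV vLen)
    (vC <:- EArr aPath (EV vLen [-] EC 1 [-] EV vJ) ;; follow ;; filter_letter).

Definition bwd_path : cmd :=
  vD <:- EC 0 ;; vB <:- EC 0 ;; vT <:- EC 0 ;;
  For vJ (EV vLen)
    (vC <:- EArr aPath (EV vJ) ;; filter_letter ;; follow ;;
     vT <:- EOr (EV vT) (EV vE)).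

Definition not_base : expr :=
  EAnd (EV vBase)
    (EEq (EEq (EArr aDep (EV vBase) [%] EV vStep) (EV vRes)) (EC 0)).

(* Stores the labels from vNode up to, but not including, the next base vBase. *)
Definition climb : cmd :=
  Store aPath (EC 0) (EArr aLab (EV vNode)) ;;
  vLen <:- EC 1 ;; vBase <:- EArr aPar (EV vNode) ;;
  While not_base
    (Store aPath (EV vLen) (EArr aLab (EV vBase)) ;; inc vLen ;;
     vBase <:- EArr aPar (EV vBase)).

(** Row-major order, with m + 1 rows but m columns: the start state is a source, and it is reached
    from itself only. *)
Definition mat_index (e : expr) : expr :=
  (e [*] (EV vM [+] EC 1) [+] EV vRow) [*] EV vM [+] EV vK.

Definition get_mat : cmd :=
  If (EV vBase) (vG <:- EArr aMat (mat_index (EArr aMid (EV vBase))))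
    (vG <:- EEq (EV vRow) (EV vK)).

Definition load_row : cmd := For vK (EV vM) (get_mat ;; Store aV (EV vK) (EV vG)).

(** Matrices are numbered consecutively by [vCnt] rather than by node, so that room for n / t of
    them suffices. *)
Definition matrix : cmd :=
  For vRow (EV vM [+] EC 1) (
    load_row ;;
    vB <:- EEq (EV vRow) (EV vM) ;;
    fwd_path ;;
    For vK (EV vM) (Store aMat (mat_index (EV vCnt)) (EArr aV (EV vK)))) ;;
  Store aMid (EV vNode) (EV vCnt) ;; inc vCnt.

Definition tab_index (e : expr) : expr := e [*] (EV vM [+] EC 1).

Definition scan_row : cmd :=
  For vK (EV vM)
    (get_mat ;; vA <:- EOr (EV vA) (EAnd (EV vG) (EArr aV (EV vK)))).

(** After the backward run each entry costs one inner product with a row of the base. Row m also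
    receives [vT], since the start state is still active at the base. *)
Definition table : cmd :=
  For vK (EV vM) (Store aV (EV vK) (EArr aLst (EV vK))) ;;
  bwd_path ;;
  For vRow (EV vM [+] EC 1) (
    vA <:- EAnd (EEq (EV vRow) (EV vM)) (EV vT) ;;
    scan_row ;;
    If (EV vA)
      (Store aM (tab_index (EV vNode) [+] EV vRow) (EV vNode))
      (Store aM (tab_index (EV vNode) [+] EV vRow)
        (EArr aM (tab_index (EArr aPar (EV vNode)) [+] EV vRow)))).

Definition best_match : cmd :=
  vBest <:- EArr aM (tab_index (EV vCur) [+] EV vM) ;;
  For vK (EV vM)
    (If (EAnd (EArr aS (EV vK))
           (ELt (EV vBest) (EArr aM (tab_index (EV vCur) [+] EV vK))))
       (vBest <:- EArr aM (tab_index (EV vCur) [+] EV vK)) Skip).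

(** Within a phrase the positions come out in decreasing order. When no match is left, [vBest] is
    the root, which is its own parent, and the loop stops. *)
Definition report : cmd :=
  vCur <:- EV vNode ;;
  While (EV vCur) (
    best_match ;;
    If (EV vBest) (Out (EV vPos [+] EArr aDep (EV vBest))) Skip ;;
    vCur <:- EArr aPar (EV vBest)).

(** Row m is always included, because the start state is always active. *)
Definition gather : cmd :=
  vRow <:- EV vM ;; get_mat ;; vA <:- EV vG ;;
  For vRow (EV vM)
    (If (EArr aS (EV vRow)) (get_mat ;; vA <:- EOr (EV vA) (EV vG)) Skip).

Definition advance : cmd :=
  For vK (EV vM) (gather ;; Store aV (EV vK) (EV vA)) ;;
  vB <:- EC 1 ;; fwd_path ;;
  For vK (EV vM) (Store aS (EV vK) (EArr aV (EV vK))).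

Definition main_body : cmd :=
  vNode <:- EV vI [+] EC 1 ;;
  climb ;;
  If (EEq (EArr aDep (EV vNode) [%] EV vStep) (EV vRes)) matrix Skip ;;
  table ;; report ;; advance ;;
  vPos <:- EV vPos [+] EArr aDep (EV vNode).

Definition main_loop : cmd := For vI (EV vN) main_body.

(** * Correctness and cost of the parts of the main loop *)

Section Algorithm.

Variables (sigma : nat) (R : regexp 'I_sigma) (inp : seq nat) (L B n tag : nat).
Variables (par lab : nat -> nat) (t r : nat).
Notation m := (re_length R).
Notation code := (nth 0 (encode_regexp R)).
Notation spec := (spec inp L B).
Notation dep := (dep par).
Notation phrase := (phrase par lab).
Notation base := (base par t r).
Notation regex_env := (regex_env R n tag).

Hypothesis Hsym : forall k, k < m ->
  nth 0 inp (5 + n * (2 - tag) + k) = code k.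
Hypotheses (mL : m < L) (nL : n < L) (nmL : n.+1 * m.+1 <= L)
  (matL : n %/ t * (m.+1 * m) <= L).
Hypotheses (par0 : par 0 = 0) (par_lt : forall v, 0 < v -> par v < v) (r_lt : r < t).

Lemma filter_spec s c (V : nat -> bool) :
  regex_env s -> (forall k, k < m -> sa s aV k = V k) -> sv s vC = c ->
  spec filter_letter s (fun s' => tm s' <= tm s + 8 * m /\
    forall k, k < m -> sa s' aV k = filt code c V k).
Proof.
move=> env hV hc; have m0 := re_length_gt0 R.
apply: (@spec_for _ _ _ _ _ _ m (fun k s' =>
  [/\ tm s' <= tm s + 1 + 3 * k,
      forall j, j < k -> sa s' aV j = filt code c V j &
      forall j, k <= j < m -> sa s' aV j = V j])) => //.
- by move=> s' sm; have [] := regex_env_same sm isT isT env.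
- by split=> /= [|//|j jm]; [lia|rewrite hV].
- move=> k s1 km sm ek [ht hl hr].
  have env1 : regex_env (tick s1) := regex_env_same sm isT isT env.
  have kL : k < L by lia.
  have hc1 : sv s1 vC = c by rewrite (same_v sm).
  apply: spec_store; rewrite //= ek //.
  have [e1 e2 _ _ _] := env1; rewrite /= in e1 e2.
  rewrite e1 e2 Hsym // hr ?leqnn // lt0b hc1 addn3.
  split=> /= [|j|j hj]; first by lia.
    by case: (eqVneq j k) => [->|ne] hj; [rewrite /filt lt0b|apply: hl; lia].
  by rewrite ifN; [apply: hr; lia|lia].
by move=> s' _ _ [ht hl _]; split=> /=; [lia|].
Qed.

Lemma fwd_path_spec s p (b : bool) (V : nat -> bool) :
  regex_env s -> (forall k, k < m -> sa s aV k = V k) -> sv s vB = b ->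
  sv s vLen = size p -> size p <= L ->
  (forall j, j < size p -> sa s aPath j = nth 0 p j) ->
  spec fwd_path s (fun s' => tm s' <= tm s + 5 + 55 * m * size p /\
    forall k, k < m -> sa s' aV k = fwd R b V (rev p) k).
Proof.
move=> env hV hb hlen hpL hp; have m0 := re_length_gt0 R.
apply: spec_seq; apply: spec_assign => //=.
apply: (@spec_for _ _ _ _ _ _ (size p) (fun j s' =>
  [/\ tm s' <= tm s + 2 + 55 * m * j &
      forall k, k < m -> sa s' aV k = fwd R b V (take j (rev p)) k])) => //.
- by move=> s' sm; rewrite /= (same_v sm).
- by split=> /=; [lia|rewrite take0].
- move=> j s1 jp sm ej [ht hk].
  have env1 : regex_env s1 := regex_env_same sm isT isT env.
  have hl1 : sv s1 vLen = size p by rewrite (same_v sm).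
  have hP1 : sa s1 aPath = sa s aPath by rewrite (same_a sm).
  have hb1 : sv s1 vB = b by rewrite (same_v sm).
  have hd1 : sv s1 vD = true by rewrite (same_v sm).
  apply: spec_seq; apply: spec_assign => //=; first by rewrite hl1; lia.
  rewrite hP1 hl1 ej hp; last by lia.
  set c := nth 0 p _; set s2 := setv _ _ _.
  apply: spec_seq; apply: spec_frame.
  have env2 : regex_env s2 by [].
  have F := follow_spec (s := s2) (d := true) (V := fwd R b V (take j (rev p)))
    B Hsym mL env2 hk hd1 hb1.
  apply: spec_conseq F _.
  move=> s3 [t3 h3 _] sm3.
  have env3 := regex_env_same sm3 isT isT env2.
  have hc3 : sv s3 vC = c by rewrite (same_v sm3).
  apply: spec_conseq (filter_spec env3 h3 hc3) _ => s4 [t4 h4].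
  split=> /= [|k km]; first by move: t4 t3 => /=; nlia.
  rewrite h4 // (take_nth 0) ?size_rev // /fwd foldl_rcons nth_rev //.
  by rewrite /c (_ : size p - 1 - j = size p - j.+1) //; lia.
move=> s' _ _ [ht h]; split=> /= [|k km]; first by lia.
by rewrite h // -{1}(size_rev p) take_size.
Qed.

Lemma bwd_path_spec s p (T : nat -> bool) :
  regex_env s -> (forall k, k < m -> sa s aV k = T k) ->
  sv s vLen = size p -> size p <= L ->
  (forall j, j < size p -> sa s aPath j = nth 0 p j) ->
  spec bwd_path s (fun s' => [/\ tm s' <= tm s + 6 + 55 * m * size p,
    forall k, k < m -> sa s' aV k = (bwd R (T, false) p).1 k &
    sv s' vT = (bwd R (T, false) p).2]).
Proof.
move=> env hT hlen hpL hp; have m0 := re_length_gt0 R.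
do 3 (apply: spec_seq; apply: spec_assign => //=).
apply: (@spec_for _ _ _ _ _ _ (size p) (fun j s' =>
  [/\ tm s' <= tm s + 4 + 55 * m * j,
      forall k, k < m -> sa s' aV k = (bwd R (T, false) (take j p)).1 k &
      sv s' vT = (bwd R (T, false) (take j p)).2])) => //.
- by move=> s' sm; rewrite /= (same_v sm).
- by split=> /=; rewrite ?take0 //; lia.
- move=> j s1 jp sm ej [ht hk hvt].
  have env1 : regex_env s1 := regex_env_same sm isT isT env.
  have hP1 : sa s1 aPath = sa s aPath by rewrite (same_a sm).
  have hb1 : sv s1 vB = false by rewrite (same_v sm).
  have hd1 : sv s1 vD = false by rewrite (same_v sm).
  apply: spec_seq; apply: spec_assign => //=; first by rewrite ej; lia.
  rewrite hP1 ej hp //.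
  set c := nth 0 p _; set s2 := setv _ _ _.
  apply: spec_seq; apply: spec_frame.
  have env2 : regex_env s2 by [].
  apply: spec_conseq (@filter_spec s2 c _ env2 hk erefl) _.
  move=> s3 [t3 h3] sm3.
  have env3 := regex_env_same sm3 isT isT env2.
  have hd3 : sv s3 vD = false by rewrite (same_v sm3).
  have hb3 : sv s3 vB = false by rewrite (same_v sm3).
  apply: spec_seq; apply: spec_frame.
  apply: spec_conseq (follow_spec (d := false) (b := false) B Hsym mL env3 h3 hd3 hb3) _ => s4 [t4 h4 h4'] sm4.
  apply: spec_assign => //=.
  rewrite h4' lt0b (same_v sm4) // (same_v sm3) //= hvt lt0b.
  rewrite (take_nth 0) // /bwd foldl_rcons.
  by split=> //=; move: t4 t3 => /=; nlia.
move=> s' _ _ [ht h h']; split=> /= [|k km|]; first by lia.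
  by rewrite h // take_size.
by rewrite h' take_size.
Qed.

Definition trie_env (s : state) : Prop :=
  [/\ regex_env s, sv s vStep = t /\ sv s vRes = r,
      forall v, v <= n -> sa s aPar v = par v,
      forall v, 0 < v <= n -> sa s aLab v = lab v &
      (forall v, v <= n -> sa s aDep v = dep v) /\
      (forall k, k < m -> sa s aLst k = lasts R k)].

Lemma trie_env_same c s s' : same c s s' ->
  all (fun x => x \notin modv c) [:: vTag; vN; vM; vStep; vRes] ->
  all (fun a => a \notin moda c) [:: aLo; aNul; aPar; aLab; aDep; aLst] ->
  trie_env s -> trie_env s'.
Proof.
move=> h /= /and5P[h1 h2 h3 h4 /andP[h5 _]] /and5P[g1 g2 g3 g4 /and3P[g5 g6 _]].
move=> [e1 [e2 e2'] e3 e4 [e5 e6]].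
have e1' : regex_env s'.
  by apply: regex_env_same h _ _ e1; rewrite /= ?h1 ?h2 ?h3 ?g1 ?g2.
by split=> //; rewrite ?(same_v h) ?(same_a h).
Qed.

(* The cells of aPath hold the labels p from node i up to its nearest base v. *)
Definition path_env (i : nat) (p : seq nat) (v : nat) (s : state) : Prop :=
  [/\ [/\ base v, v < i, size p <= t & size p <= n],
      phrase i = phrase v ++ rev p,
      sv s vBase = v, sv s vLen = size p &
      forall j, j < size p -> sa s aPath j = nth 0 p j].

Lemma path_env_same i p v c s s' : same c s s' ->
  all (fun x => x \notin modv c) [:: vBase; vLen] -> aPath \notin moda c ->
  path_env i p v s -> path_env i p v s'.
Proof.
move=> h /= /and3P[h1 h2 _] h3 [e1 e2 e3 e4 e5].
by split; rewrite ?(same_v h) ?(same_a h).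
Qed.

(** [dist] is the variant of the loop, and the labels collected plus [dist] never exceed [t]. That
    the path fits into its array follows from its being no longer than the phrase. *)
Lemma climb_spec s i : trie_env s -> sv s vNode = i -> 0 < i <= n ->
  spec climb s (fun s' => tm s' <= tm s + 4 * t + 4 /\
    exists p v, path_env i p v s').
Proof.
move=> env ei hi.
have [_ [ht hr] hpar hlab [hdep _]] := env.
have t0 : 0 < t by lia.
apply: spec_seq; apply: spec_store => //=; try lia.
apply: spec_seq; apply: spec_assign => //=.
apply: spec_seq; apply: spec_assign => //=; first by rewrite ei; lia.
set s1 := setv _ _ _.
have plt := par_lt (proj1 (andP hi)).
pose I j s' := exists p v, [/\ j = dist par t r v, same climb s s',
  tm s' < tm s + 4 * size p,
  [/\ v < i, size p + dist par t r v <= t, 0 < size p & phrase i = phrase v ++ rev p] &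
  [/\ sv s' vBase = v, sv s' vLen = size p &
      forall j, j < size p -> sa s' aPath j = nth 0 p j]].
have dlt v : dist par t r v < t by rewrite ltn_mod.
have sizes p v : phrase i = phrase v ++ rev p -> size p <= n.
  move/(congr1 size); rewrite size_cat size_rev !size_phrase.
  by have := dep_le par_lt i; lia.
apply: (@spec_while _ _ _ _ _ I (dist par t r (par i))).
  exists [:: lab i], (par i); split=> //=; [|by lia| |].
  - apply: same_trans; last by apply: same_setv.
    apply: same_trans; last by apply: same_setv.
    exact: same_seta.
  - split=> //.
    by rewrite (phraseE lab par_lt (proj1 (andP hi))) -cats1.
  - by rewrite ei hpar ?hlab //; [split=> // -[]|lia].
move=> j s2 [p [v [-> sm t2 [vi szd p0 ph] [hv hl hp]]]].
have env2 : trie_env s2 := trie_env_same sm isT isT env.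
have [_ [ht2 hr2] hpar2 hlab2 [hdep2 _]] := env2.
have vn : v <= n by lia.
have pn := sizes _ _ ph.
have enb : eval inp s2 not_base = ~~ base v :> nat.
  rewrite /not_base /= hv hdep2 // ht2 hr2 /base lt0n.
  by case: (v == 0) => //; case: (_ == r).
rewrite enb; split; first by rewrite /not_base /= hv; lia.
  move=> hb; split=> /=; first by lia.
  exists p, v; split=> //; split=> //; [by case: (base v) hb|lia].
move=> hb; have {}hb : ~~ base v by case: (base v) hb.
have v0 : 0 < v by rewrite lt0n; apply: contra hb => /eqP ->.
have dv := dist_par par_lt r_lt v0 hb.
apply: spec_frame; apply: spec_seq; apply: spec_store; rewrite //= ?hv ?hl; try lia.
apply: spec_seq; apply: spec_assign; rewrite //= ?hv ?hl; try lia.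
apply: spec_assign; rewrite //= ?hv ?hl; try lia.
have plt' := par_lt v0.
move=> smb; exists (dist par t r (par v)); first by lia.
exists (rcons p (lab v)), (par v); rewrite size_rcons; split=> //=.
- apply: same_trans sm _; apply: same_trans (same_tick _ s2) _.
  exact: same_incl smb.
- by lia.
- split=> //; [by lia|by lia|].
  by rewrite ph rev_rcons -cat_rcons -phraseE.
- rewrite hpar2 ?hlab2 ?v0 //; split=> // [|j']; first by rewrite addn1.
  rewrite nth_rcons; case: (eqVneq j' (size p)) => [->|ne] hj.
    by rewrite ltnn.
  by rewrite ifT ?hp //; lia.
Qed.

(** A number below [c] ensures that storing matrix number [c] leaves this one intact. The root has
    no stored matrix, since [get_mat] supplies the identity. *)
Definition mat_env (c v : nat) (s : state) : Prop :=
  v = 0 \/ sa s aMid v < c /\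
    forall row k, row <= m -> k < m ->
      sa s aMat ((sa s aMid v * m.+1 + row) * m + k) = reach R row (phrase v) k.

Lemma mat_index_lt c row k : c < n %/ t -> row <= m -> k < m ->
  (c * m.+1 + row) * m + k < L.
Proof.
move=> hc hr hk; apply: leq_trans matL.
have h1 : c.+1 * (m.+1 * m) <= n %/ t * (m.+1 * m) by rewrite leq_mul2r hc orbT.
apply: leq_trans h1; rewrite mulnA.
have h2 : (c * m.+1 + row).+1 * m <= c.+1 * m.+1 * m.
  by rewrite leq_mul2r; apply/orP; right; rewrite [c.+1 * _]mulSn; lia.
by apply: leq_trans h2; rewrite mulSn; lia.
Qed.

Lemma get_mat_spec s c v row k (Q : state -> Prop) :
  sv s vBase = v -> sv s vRow = row -> sv s vK = k -> sv s vM = m ->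
  v <= n -> row <= m -> k < m -> c <= n %/ t -> mat_env c v s ->
  Q (setv (tick s) vG (reach R row (phrase v) k)) -> spec get_mat s Q.
Proof.
move=> hv hr hk hm vn rm km cn hmat q.
apply: spec_if => //=; rewrite hv => hv0.
  case: hmat => [h|[hmid hmat]]; first by rewrite h in hv0.
  have hc : sa s aMid v < n %/ t by lia.
  apply: spec_assign => //=; rewrite hv hr hk hm addn1.
    by have := mat_index_lt hc rm km; do !split => //; lia.
  by rewrite hmat.
apply: spec_assign => //=; rewrite hr hk.
by move: q; rewrite hv0 /reach /fwd /single /= eq_sym.
Qed.

Lemma load_row_spec s c v row :
  sv s vBase = v -> sv s vRow = row -> sv s vM = m ->
  v <= n -> row <= m -> c <= n %/ t -> mat_env c v s ->
  spec load_row s (fun s' => tm s' <= tm s + 7 * m /\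
    forall k, k < m -> sa s' aV k = reach R row (phrase v) k).
Proof.
move=> hv hr hm vn rm cn hmat; have m0 := re_length_gt0 R.
apply: (@spec_for _ _ _ _ _ _ m (fun k s' =>
  [/\ tm s' <= tm s + 1 + 5 * k &
      forall j, j < k -> sa s' aV j = reach R row (phrase v) j])) => //.
- by move=> s' sm; rewrite /= (same_v sm).
- by split=> //=; lia.
- move=> k s1 km sm ek [ht hl]; apply: spec_seq.
  apply: (@get_mat_spec _ c v row k) => //=; try by rewrite (same_v sm).
    case: hmat => [->|hmat]; first by left.
    by right; rewrite /= !(same_a sm).
  apply: spec_store => //=; rewrite ek; first by lia.
  split=> /=; first by lia.
  by move=> j jk; case: (eqVneq j k) => [->//|ne]; rewrite hl //; lia.
by move=> s' _ _ [ht hl]; split=> /=; [lia|].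
Qed.

Lemma matrix_spec s i p v c :
  trie_env s -> path_env i p v s -> sv s vNode = i -> 0 < i <= n ->
  sv s vCnt = c -> c < n %/ t -> mat_env c v s ->
  spec matrix s (fun s' => [/\ tm s' <= tm s + 170 * m * m * t,
    sv s' vCnt = c.+1, mat_env c.+1 i s' &
    forall u, u <> i -> mat_env c u s -> mat_env c.+1 u s']).
Proof.
move=> env penv ei hi ec cn hmat.
have m0 := re_length_gt0 R; have t0 : 0 < t by lia.
have [[hb vi pt pn] hph hv hl hp] := penv.
have hm : sv s vM = m by case: env => -[].
apply: spec_seq; apply: spec_frame.
apply: (@spec_for _ _ _ _ _ _ m.+1 (fun row s' =>
  [/\ tm s' <= tm s + 1 + (80 * m * t) * row,
      forall row' k, row' < row -> k < m ->
        sa s' aMat ((c * m.+1 + row') * m + k) = reach R row' (phrase i) k &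
      forall x, x < c * m.+1 * m -> sa s' aMat x = sa s aMat x])) => //.
- by move=> s' sm; rewrite /= (same_v sm) // hm addn1.
- by split=> //=; lia.
- move=> row s1 rm sm er [ht hl1 hlo].
  (* All writes so far lie in the block of matrix [c], beyond every matrix with a smaller number. *)
  have keep u : mat_env c u s -> mat_env c u s1.
    case=> [->|[hu hu']]; first by left.
    right; rewrite (same_a sm) //; split=> // row' k hr hk.
    rewrite hlo ?hu' //.
    have h2 : (sa s aMid u * m.+1 + row').+1 * m <= c * m.+1 * m.
      rewrite leq_mul2r; apply/orP; right.
      have : (sa s aMid u).+1 * m.+1 <= c * m.+1 by rewrite leq_mul2r hu orbT.
      by rewrite mulSn; lia.
    by apply: leq_trans h2; rewrite mulSn; lia.
  have env1 : trie_env s1 := trie_env_same sm isT isT env.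
  have [_ _ hv1 hl2 hp1] : path_env i p v s1 := path_env_same sm isT isT penv.
  have hm1 : sv s1 vM = m by case: env1 => -[].
  apply: spec_seq; apply: spec_frame.
  have LR := load_row_spec (s := tick s1) hv1 er hm1 (ltnW (leq_trans vi _))
    rm (ltnW cn) (keep _ hmat : mat_env c v (tick s1)).
  apply: spec_conseq (LR _) _ => [|s2 [t2 h2] sm2]; first by case/andP: hi.
  apply: spec_seq; apply: spec_assign => //=.
  rewrite (same_v sm2) //= er (same_v sm2) //= hm1.
  set s3 := setv _ _ _.
  have env3 : trie_env s3 := trie_env_same sm2 isT isT env1.
  have [_ _ _ hl3 hp3] : path_env i p v s3.
    by apply: (path_env_same sm2 isT isT (i := i) (p := p) (v := v)); split.
  have [env3' _ _ _ _] := env3.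
  have pL : size p <= L by lia.
  have F := fwd_path_spec (s := s3) (b := row == m) env3' h2 (erefl _) hl3 pL hp3.
  apply: spec_seq; apply: spec_frame.
  apply: spec_conseq F _ => s4 [t4 h4] sm4.
  have cnt4 : sv s4 vCnt = c.
    by rewrite (same_v sm4) //= (same_v sm2) //= (same_v sm).
  have row4 : sv s4 vRow = row.
    by rewrite (same_v sm4) //= (same_v sm2) //=.
  have m4 : sv s4 vM = m.
    by rewrite (same_v sm4) //= (same_v sm2) //=.
  have mat4 : sa s4 aMat = sa s1 aMat.
    by rewrite (same_a sm4) //= (same_a sm2).
  have h4' k : k < m -> sa s4 aV k = reach R row (phrase i) k.
    by move=> km; rewrite h4 // hph reach_cat.
  apply: (@spec_for _ _ _ _ _ _ m (fun k s' =>
    [/\ tm s' <= tm s4 + 1 + 3 * k,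
        forall j, j < k ->
          sa s' aMat ((c * m.+1 + row) * m + j) = reach R row (phrase i) j &
        forall x, x < (c * m.+1 + row) * m -> sa s' aMat x = sa s1 aMat x])) => //.
  + by move=> s' sm5; rewrite /= (same_v sm5).
  + by split=> /= [|//|x _]; [lia|rewrite mat4].
  + move=> k s5 km sm5 ek [t5 h5 h5'].
    have cnt5 : sv s5 vCnt = c by rewrite (same_v sm5).
    have row5 : sv s5 vRow = row by rewrite (same_v sm5).
    have m5 : sv s5 vM = m by rewrite (same_v sm5).
    have v5 : sa s5 aV = sa s4 aV by rewrite (same_a sm5).
    have il := mat_index_lt cn (rm : row <= m) km.
    have kL : k < L by lia.
    apply: spec_store; rewrite //= ?cnt5 ?row5 ?m5 ?ek ?addn1 //.
    rewrite v5 h4' //; split=> /= [|j jk|x xl]; first by lia.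
      by rewrite eqn_add2l; case: (eqVneq j k) => [->|ne] //; rewrite h5 //; lia.
    by rewrite ifN ?h5' //; lia.
  move=> s5 sm5 _ [t5 h5 h5']; split=> /=.
  + have : tm s2 <= tm s1 + 1 + 7 * m by move: t2 => /=; lia.
    have : tm s4 <= tm s2 + 1 + 5 + 55 * m * size p by move: t4 => /=; lia.
    have : m * size p <= m * t by rewrite leq_mul2l pt orbT.
    have : m <= m * t by rewrite leq_pmulr.
    by move: ht; rewrite -!mulnA; nlia.
  + move=> row' k hr km; case: (eqVneq row' row) => [->|ne]; first exact: h5.
    rewrite h5' ?hl1 //; first by lia.
    have h6 : (c * m.+1 + row').+1 * m <= (c * m.+1 + row) * m.
      by rewrite leq_mul2r; apply/orP; right; lia.
    by apply: leq_trans h6; rewrite mulSn; lia.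
  + move=> x xl; rewrite h5' ?hlo //.
    by apply: leq_trans xl _; rewrite leq_mul2r leq_addr orbT.
move=> s1 sm _ [t1 h1 h1'] smt.
have e1 : sv s1 vNode = i by rewrite (same_v sm).
have c1 : sv s1 vCnt = c by rewrite (same_v sm).
apply: spec_seq; apply: spec_store => //=; rewrite e1; first by lia.
apply: spec_assign => //=; rewrite c1; split=> //=.
- have : m <= m * m * t by rewrite -mulnA leq_pmulr // muln_gt0 m0.
  have : m * t <= m * m * t by rewrite -mulnA leq_pmull.
  by move: t1; nlia.
- by rewrite addn1.
- by right; rewrite /= eqxx; split=> // row k hr hk; apply: h1.
move=> u ui [->|[hu hu']]; first by left.
right => /=; rewrite (introF eqP ui) (same_a sm) //; split; first by lia.
move=> row k hr hk; rewrite h1' ?hu' //.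
have h2 : (sa s aMid u * m.+1 + row).+1 * m <= c * m.+1 * m.
  rewrite leq_mul2r; apply/orP; right.
  have : (sa s aMid u).+1 * m.+1 <= c * m.+1 by rewrite leq_mul2r hu orbT.
  by rewrite mulSn; lia.
by apply: leq_trans h2; rewrite mulSn; lia.
Qed.

Lemma tab_index_lt v row : v <= n -> row <= m -> v * m.+1 + row < L.
Proof.
move=> vn rm; apply: leq_trans nmL; rewrite mulSn.
have : v * m.+1 <= n * m.+1 by rewrite leq_mul2r vn orbT.
by lia.
Qed.

Lemma dotS (V T : nat -> bool) k :
  dot V T 0 k.+1 = dot V T 0 k || V k && T k.
Proof. by rewrite -addn1 dotD /dot /= orbF. Qed.

Definition first_hit (row v : nat) : nat :=
  lowest par (fun x => acc R row (phrase x)) v.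

Lemma table_spec s i p v c :
  trie_env s -> path_env i p v s -> sv s vNode = i -> 0 < i <= n ->
  c <= n %/ t -> mat_env c v s ->
  (forall row, row <= m -> sa s aM (par i * m.+1 + row) = first_hit row (par i)) ->
  spec table s (fun s' => [/\ tm s' <= tm s + 80 * m * t + 40 * m * m,
    forall row, row <= m -> sa s' aM (i * m.+1 + row) = first_hit row i &
    forall x, x < i * m.+1 -> sa s' aM x = sa s aM x]).
Proof.
move=> env penv ei hi cn hmat hpm.
have m0 := re_length_gt0 R; have t0 : 0 < t by lia.
have i0 : 0 < i by lia.
have pi := par_lt i0.
have [[hb vi pt pn] hph hv hl hp] := penv.
have hm : sv s vM = m by case: env => -[].
apply: spec_seq; apply: spec_frame.
apply: (@spec_for _ _ _ _ _ _ m (fun k s' =>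
  tm s' <= tm s + 1 + 3 * k /\
  forall j, j < k -> sa s' aV j = lasts R j)) => //.
- by move=> s' sm; rewrite /= (same_v sm).
- by split=> /=; lia.
- move=> k s1 km sm ek [ht h].
  have [_ _ _ _ [_ hlst]] := trie_env_same sm isT isT env.
  have kL : k < L by lia.
  apply: spec_store; rewrite //= ek //; split=> /= [|j jk]; first by lia.
  by case: (eqVneq j k) => [->|ne]; [rewrite hlst|rewrite h //; lia].
move=> s1 sm1 _ [t1 h1] smt.
have env1 : trie_env (tick s1) := trie_env_same sm1 isT isT env.
have [_ _ hv1 hl1 hp1] : path_env i p v (tick s1) := path_env_same sm1 isT isT penv.
have [env1' _ _ _ _] := env1.
have pL : size p <= L by lia.
apply: spec_seq; apply: spec_frame.
apply: spec_conseq (bwd_path_spec env1' h1 hl1 pL hp1) _ => s2 [t2 h2 h2'] sm2.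
set Tt := bwd R (lasts R, false) p in h2 h2'.
have env2 : trie_env s2 := trie_env_same sm2 isT isT env1.
have v2 : sv s2 vBase = v by rewrite (same_v sm2).
have i2 : sv s2 vNode = i by rewrite (same_v sm2) //= (same_v sm1).
have m2 : sv s2 vM = m by case: env2 => -[].
have M2 : sa s2 aM = sa s aM by rewrite (same_a sm2) //= (same_a sm1).
have mat2 : mat_env c v s2.
  case: hmat => [->|hmat]; first by left.
  by right; rewrite !(same_a sm2) //= !(same_a sm1).
(* The path is stored from the node upwards and is thus already reversed for the backward run. *)
have accE row : row <= m ->
    acc R row (phrase i) = dot (reach R row (phrase v)) Tt.1 0 m || (row == m) && Tt.2.
  by move=> _; rewrite hph acc_bwd revK.
apply: (@spec_for _ _ _ _ _ _ m.+1 (fun row s' =>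
  [/\ tm s' <= tm s2 + 1 + (16 * m) * row,
      forall row', row' < row -> sa s' aM (i * m.+1 + row') = first_hit row' i &
      forall x, x < i * m.+1 -> sa s' aM x = sa s aM x])) => //.
- by move=> s' sm; rewrite /= (same_v sm) // m2 addn1.
- by split=> //= [|x _]; [lia|rewrite M2].
- move=> row s3 rm sm er [ht hlo hold].
  have v3 : sv s3 vBase = v by rewrite (same_v sm).
  have m3 : sv s3 vM = m by rewrite (same_v sm).
  have T3 : sv s3 vT = Tt.2 by rewrite (same_v sm).
  have V3 k : k < m -> sa s3 aV k = Tt.1 k by rewrite (same_a sm) //; apply: h2.
  have mat3 : mat_env c v s3.
    case: mat2 => [->|mat2]; first by left.
    by right; rewrite !(same_a sm).
  have vn : v <= n by lia.
  apply: spec_seq; apply: spec_assign => //=; rewrite er m3 T3.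
  apply: spec_seq; apply: spec_frame.
  set s4 := setv _ _ _.
  apply: (@spec_for _ _ _ _ _ _ m (fun k s' => tm s' <= tm s4 + 1 + 5 * k /\
     sv s' vA = dot (reach R row (phrase v)) Tt.1 0 k || (row == m) && Tt.2)) => //.
  + by move=> s' sm4; rewrite /= (same_v sm4).
  + by split=> /=; [lia|case: (row == m) => //; case: Tt.2].
  + move=> k s5 km sm5 ek [t5 h5]; apply: spec_seq.
    apply: (@get_mat_spec _ c v row k) => //=; try by rewrite (same_v sm5).
      case: mat3 => [->|mat3]; first by left.
      by right; rewrite /= !(same_a sm5).
    have kL : k < L by lia.
    apply: spec_assign; rewrite //= ek //; split=> /=.
      by move: t5; rewrite /s4 /=; nlia.
    rewrite h5 (same_a sm5) //= V3 // dotS !lt0b.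
    by case: (dot _ _ _ _); case: (_ && Tt.2); case: (_ && _).
  move=> s5 sm5 _ [t5 h5] smt5.
  have i5 : sv s5 vNode = i.
    by rewrite (same_v sm5) //= (same_v sm).
  have m5 : sv s5 vM = m by rewrite (same_v sm5).
  have er5 : sv s5 vRow = row by rewrite (same_v sm5).
  have M5 : sa s5 aM = sa s3 aM by rewrite (same_a sm5).
  have par5 : sa s5 aPar i = par i.
    rewrite (same_a sm5) //= (same_a sm) //.
    by case: env2 => _ _ -> //; lia.
  have iL : i < L by lia.
  have eqr : row <= m by lia.
  have inL := tab_index_lt (proj2 (andP hi)) eqr.
  have pn' : par i <= n by lia.
  have ipL := tab_index_lt pn' eqr.
  have fin x t' : x = first_hit row i -> t' <= tm s5 + 4 ->
      [/\ t' < tm s2 + 1 + (16 * m) * row.+1,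
      forall row', row' < row.+1 -> (if i * m.+1 + row' == i * m.+1 + row then x
        else sa s5 aM (i * m.+1 + row')) = first_hit row' i &
      forall y, y < i * m.+1 -> (if y == i * m.+1 + row then x
        else sa s5 aM y) = sa s aM y].
    move=> -> tt; split; first by move: t5; rewrite /s4 /=; nlia.
      move=> row' hr; rewrite eqn_add2l; case: (eqVneq row' row) => [->//|ne].
      by rewrite M5 hlo //; lia.
    by move=> y hy; rewrite ifN ?M5 ?hold //; lia.
  apply: spec_if => //=; rewrite h5 -accE // => ha.
    apply: spec_store; rewrite //= ?i5 ?m5 ?er5 ?(addn1 m) //.
    apply: fin; last by lia.
    by rewrite /first_hit lowestE //; case: (acc _ _ _) ha.
  apply: spec_store; rewrite //= ?i5 ?m5 ?er5 ?(addn1 m) ?par5 //.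
  apply: fin; last by lia.
  (* The row of the parent precedes the row being written, so its entries are the original ones. *)
  rewrite M5 hold; last first.
    have : (par i).+1 * m.+1 <= i * m.+1 by rewrite leq_mul2r pi orbT.
    by rewrite mulSn; lia.
  by rewrite hpm // {2}/first_hit (lowestE par_lt) //; case: (acc _ _ _) ha.
move=> s3 sm3 _ [t3 h3 h3']; split=> //=.
have : m * size p <= m * t by rewrite leq_mul2l pt orbT.
have : m <= m * t by rewrite leq_pmulr.
have : m <= m * m by rewrite leq_pmulr.
by move: t3 t2 t1; rewrite mulnS /= -!mulnA; nlia.
Qed.

Implicit Types (S : nat -> bool).

Lemma iotaS_rcons j i : iota j i.+1 = iota j i ++ [:: j + i].
Proof. by rewrite -[i.+1]addn1 iotaD. Qed.

Lemma has_iotaS (a : pred nat) k : has a (iota 0 k.+1) = has a (iota 0 k) || a k.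
Proof. by rewrite iotaS_rcons has_cat /= orbF. Qed.

(* Reading the phrase of x from the start state or from a state s < k of S ends
   in acceptance. *)
Definition hit (S : nat -> bool) (k x : nat) : bool :=
  has (fun s => S s && acc R s (phrase x)) (iota 0 k) || acc R m (phrase x).

Definition table_env (i : nat) (s : state) : Prop :=
  forall v row, v <= i -> row <= m -> sa s aM (v * m.+1 + row) = first_hit row v.

Lemma best_match_spec s i cur S :
  trie_env s -> table_env i s -> sv s vCur = cur -> cur <= i <= n ->
  (forall k, k < m -> sa s aS k = S k) ->
  spec best_match s (fun s' => tm s' <= tm s + 7 * m /\
    sv s' vBest = lowest par (hit S m) cur).
Proof.
move=> env tenv ecur hi hS; have m0 := re_length_gt0 R.
have hm : sv s vM = m by case: env => -[].
have cn : cur <= n by lia.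
have iL row := tab_index_lt (row := row) cn.
apply: spec_seq; apply: spec_assign; rewrite //= ?ecur ?hm ?(addn1 m).
  by have := iL m (leqnn _); do !split.
rewrite tenv //; last by case/andP: hi.
apply: (@spec_for _ _ _ _ _ _ m (fun k s' => tm s' <= tm s + 2 + 4 * k /\
     sv s' vBest = lowest par (hit S k) cur)) => //.
- by move=> s' sm; rewrite /= (same_v sm).
- by split=> //=; lia.
- move=> k s1 km sm ek [ht hbest].
  have cur1 : sv s1 vCur = cur by rewrite (same_v sm).
  have m1 : sv s1 vM = m by rewrite (same_v sm).
  have S1 : sa s1 aS k = S k by rewrite (same_a sm) //= hS.
  have M1 : sa s1 aM (cur * m.+1 + k) = first_hit k cur.
    by rewrite (same_a sm) //= tenv //; lia.
  have kL : k < L by lia.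
  have ckL : cur * m.+1 + k < L by apply: iL; lia.
  (* State [k] adds one disjunct to the predicate; by [lowestU] this is a maximum. *)
  have step : lowest par (hit S k.+1) cur =
      maxn (lowest par (hit S k) cur) (if S k then first_hit k cur else 0).
    have -> : lowest par (hit S k.+1) cur =
        lowest par (predU (hit S k) (fun x => S k && acc R k (phrase x))) cur.
      apply: eq_lowest => x; rewrite /hit has_iotaS [RHS]/=.
      by case: (has _ _); case: (acc R m _); case: (_ && _).
    rewrite lowestU //; congr maxn; rewrite /first_hit; case: (S k) => //.
    by rewrite /lowest (eq_filter (a2 := pred0)) ?filter_pred0.
  apply: spec_if => /=; rewrite ?cur1 ?m1 ?ek ?(addn1 m) ?S1 ?M1 ?hbest ?lt0b.
  + by do !split.
  + move=> hc; apply: spec_assign; rewrite //= ?cur1 ?m1 ?ek ?(addn1 m) ?M1 //.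
    rewrite step; split; first by lia.
    by case: (S k) hc => //=; case: ltnP => // lt _; rewrite (maxn_idPr (ltnW lt)).
  + move=> hc; apply: spec_skip => /=; rewrite step hbest; split; first by lia.
    case: (S k) hc => /=; last by rewrite maxn0.
    by case: ltnP => // le _; rewrite (maxn_idPl le).
by move=> s' _ _ [ht h]; split=> /=; [lia|].
Qed.

Lemma report_spec s i S pos :
  trie_env s -> table_env i s -> sv s vNode = i -> 0 < i <= n ->
  sv s vPos = pos -> (forall k, k < m -> sa s aS k = S k) ->
  let out := [seq pos + dep x | x <- chain par i & hit S m x] in
  spec report s (fun s' => tm s' <= tm s + 16 * m * (size out).+1 /\
    so s' = so s ++ out).
Proof.
move=> env tenv ei hi epos hS out; have m0 := re_length_gt0 R.
apply: spec_seq; apply: spec_assign => //=; rewrite ei.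
set s1 := setv _ _ _.
pose rest cur := [seq x <- chain par cur | hit S m x].
(* Each remaining hit pays for the round that reports it, and the summand [0 < cur] for a last round
   that finds nothing. The variant is [cur], because the parent of the best node is smaller. *)
pose I j s' := exists cur, [/\ j = cur /\ cur <= i, same report s s',
  sv s' vCur = cur,
  tm s' + 14 * m * (size (rest cur) + (0 < cur)) <= tm s1 + 14 * m * (size out).+1 &
  so s' ++ [seq pos + dep x | x <- rest cur] = so s ++ out].
apply: (@spec_while _ _ _ _ _ I i).
  exists i; split=> //.
  - exact: same_setv.
  - by rewrite /out size_map (proj1 (andP hi)) addn1.
move=> j s2 [cur [[-> ci] sm ecur ht ho]]; rewrite /= ecur; split=> // [c0|c0].
  split=> /=.
    by move: ht; rewrite c0 /s1 /=; nlia.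
  by move: ho; rewrite c0 cats0.
have {}c0 : 0 < cur by lia.
have env2 : trie_env s2 := trie_env_same sm isT isT env.
have pos2 : sv s2 vPos = pos by rewrite (same_v sm).
have S2 k : k < m -> sa s2 aS k = S k by rewrite (same_a sm) //; apply: hS.
have tenv2 : table_env i s2 by rewrite /table_env (same_a sm).
have hci : cur <= i <= n by lia.
apply: spec_frame; apply: spec_seq; apply: spec_frame.
apply: spec_conseq (best_match_spec (s := tick s2) env2 tenv2 ecur hci S2) _.
move=> s3 [t3 h3] sm3.
have := filter_chain par_lt (hit S m) cur; rewrite -/(rest _) -h3 => hrest.
have best_le : sv s3 vBest <= cur by rewrite h3 lowest_le.
have pos3 : sv s3 vPos = pos by rewrite (same_v sm3).
have o3 : so s3 = so s2 by case: sm3 => _ _ ->.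
have [_ _ par3 _ [dep3 _]] : trie_env s3 := trie_env_same sm3 isT isT env2.
set b := sv s3 vBest in hrest best_le.
have bn : b <= n by lia.
have bL : b < L by lia.
have b_par : par b < cur.
  case: (posnP b) => [->|b0]; first by rewrite par0.
  by have := par_lt b0; lia.
apply: spec_seq.
apply: spec_if => //=; rewrite -/b => hb.
  apply: spec_out => //=; rewrite -/b pos3 dep3 //.
  apply: spec_assign => //=; rewrite -/b par3 // => smb.
  exists (par b) => //; exists (par b); split=> //=.
  - by split=> //; lia.
  - by apply: same_trans sm _; apply: same_trans (same_tick _ s2) _; exact: same_incl smb.
  - have : m * (0 < par b) <= m by case: (0 < par b); lia.
    by move: ht t3; rewrite hrest (negPf hb) /= c0 -/(rest _); nlia.
  - by rewrite cat_rcons -ho hrest (negPf hb) o3.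
apply: spec_skip; apply: spec_assign => //=; rewrite -/b par3 // => smb.
exists (par b) => //; exists (par b); split=> //=.
- by split=> //; lia.
- by apply: same_trans sm _; apply: same_trans (same_tick _ s2) _; exact: same_incl smb.
- by move: ht t3; rewrite hrest hb /= c0 par0 /= /rest /=; nlia.
- by rewrite hb par0 o3 -ho hrest hb.
Qed.

Lemma gather_spec s c k v S :
  sv s vBase = v -> sv s vK = k -> sv s vM = m -> v <= n -> k < m ->
  c <= n %/ t -> mat_env c v s -> (forall j, j < m -> sa s aS j = S j) ->
  spec gather s (fun s' => tm s' <= tm s + 14 * m /\
    sv s' vA = fwd R true S (phrase v) k).
Proof.
move=> hv hk hm vn km cn hmat hS; have m0 := re_length_gt0 R.
apply: spec_seq; apply: spec_assign => //=; rewrite hm.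
apply: spec_seq; apply: (@get_mat_spec _ c v m k) => //=.
apply: spec_seq; apply: spec_assign => //=.
apply: (@spec_for _ _ _ _ _ _ m (fun j s' => tm s' <= tm s + 5 + 7 * j /\
  sv s' vA = has (fun q => S q && reach R q (phrase v) k) (iota 0 j) ||
             reach R m (phrase v) k)) => //.
- by move=> s' sm; rewrite /= (same_v sm).
- by split=> //=; lia.
- move=> j s1 jm sm ej [ht hA].
  have S1 : sa s1 aS j = S j by rewrite (same_a sm) //= hS.
  have jL : j < L by lia.
  have E : has (fun q => S q && reach R q (phrase v) k) (iota 0 j.+1) =
    has (fun q => S q && reach R q (phrase v) k) (iota 0 j) ||
    S j && reach R j (phrase v) k.
    exact: has_iotaS.
  cbv beta; rewrite E.
  apply: spec_if => /=; rewrite ?ej ?S1 // => hSj.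
    apply: spec_seq; apply: (@get_mat_spec _ c v j k) => //=.
    + by rewrite (same_v sm).
    + by rewrite (same_v sm).
    + by rewrite (same_v sm).
    + by lia.
    + case: hmat => [->|hmat]; first by left.
      by right; rewrite /= !(same_a sm).
    apply: spec_assign => //; split=> /=; first by lia.
    rewrite hA !lt0b; case: (S j) hSj => //= _.
    by case: (has _ _); case: (reach _ j _ _); case: (reach _ m _ _).
  apply: spec_skip; split=> /=; first by lia.
  rewrite hA; by case: (S j) hSj => //= _; rewrite orbF.
move=> s' _ _ [ht h]; split=> /=; first by lia.
by rewrite h fwd_reach.
Qed.

Lemma advance_spec s i p v c S :
  trie_env s -> path_env i p v s -> i <= n -> c <= n %/ t -> mat_env c v s ->
  (forall j, j < m -> sa s aS j = S j) ->
  spec advance s (fun s' => tm s' <= tm s + 22 * m * m + 75 * m * t /\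
    forall k, k < m -> sa s' aS k = fwd R true S (phrase i) k).
Proof.
move=> env penv hi cn hmat hS; have m0 := re_length_gt0 R; have t0 : 0 < t by lia.
have [[hb vi pt pn] hph hv hl hp] := penv.
have hm : sv s vM = m by case: env => -[].
have vn : v <= n by lia.
apply: spec_seq; apply: spec_frame.
apply: (@spec_for _ _ _ _ _ _ m (fun k s' => tm s' <= tm s + 1 + 18 * m * k /\
  forall j, j < k -> sa s' aV j = fwd R true S (phrase v) j)) => //.
- by move=> s' sm; rewrite /= (same_v sm).
- by split=> //=; lia.
- move=> k s1 km sm ek [ht hV].
  apply: spec_seq; apply: spec_frame.
  have G : spec gather (tick s1) (fun s' => tm s' <= tm (tick s1) + 14 * m /\
      sv s' vA = fwd R true S (phrase v) k).
    apply: (@gather_spec _ c k v S) => //=; try by rewrite (same_v sm).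
      case: hmat => [->|hmat]; first by left.
      by right; rewrite /= !(same_a sm).
    by move=> j jm; rewrite (same_a sm) //; apply: hS.
  apply: spec_conseq G _ => s2 [t2 h2] sm2.
  have ek2 : sv s2 vK = k by rewrite (same_v sm2).
  have kL : k < L by lia.
  apply: spec_store; rewrite //= ek2 //; split=> /=; first by move: t2 => /=; nlia.
  move=> j jk; case: (eqVneq j k) => [->//|ne].
  by rewrite (same_a sm2) //= hV //; lia.
move=> s1 sm1 _ [t1 h1] smt.
apply: spec_seq; apply: spec_assign => //=.
set s2 := setv _ _ _.
have env2 : trie_env s2 := trie_env_same sm1 isT isT env.
have [_ _ _ hl2 hp2] : path_env i p v s2 := path_env_same sm1 isT isT penv.
have [env2' _ _ _ _] := env2.
have pL : size p <= L by lia.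
apply: spec_seq; apply: spec_frame.
have F := fwd_path_spec (s := s2) (b := true) env2' h1 (erefl _) hl2 pL hp2.
apply: spec_conseq F _ => s3 [t3 h3] sm3.
have m3 : sv s3 vM = m by rewrite (same_v sm3) //= (same_v sm1).
apply: (@spec_for _ _ _ _ _ _ m (fun k s' => tm s' <= tm s3 + 1 + 3 * k /\
  forall j, j < k -> sa s' aS j = fwd R true S (phrase i) j)) => //.
- by move=> s' sm; rewrite /= (same_v sm).
- by split=> //=; lia.
- move=> k s4 km sm ek [ht hV].
  have kL : k < L by lia.
  apply: spec_store; rewrite //= ek //; split=> /=; first by lia.
  move=> j jk; case: (eqVneq j k) => [->|ne]; last by rewrite hV //; lia.
  by rewrite (same_a sm) //= h3 // hph fwd_cat.
move=> s4 _ _ [t4 h4]; split=> //=.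
have : m * size p <= m * t by rewrite leq_mul2l pt orbT.
have : m <= m * t by rewrite leq_pmulr.
have : m <= m * m by rewrite leq_pmulr.
by move: t4 t3 t1; rewrite /s2 /=; nlia.
Qed.

(** * Invariant and cost of the main loop *)

Definition text (i : nat) : seq nat := flatten [seq phrase v | v <- iota 1 i].

Definition active (i : nat) : nat -> bool := fwd R true (fun=> false) (text i).

(** The value of [vCnt] after [i] rounds. The count starts at node 1, as the root is a base without
    a stored matrix. *)
Definition selected (i : nat) : nat := count base (iota 1 i).

Definition found (i : nat) : seq nat :=
  [seq size (text i) + dep x | x <- chain par i.+1 & hit (active i) m x].

Definition matches (i : nat) : seq nat := flatten [seq found v | v <- iota 0 i].

Lemma textS i : text i.+1 = text i ++ phrase i.+1.
Proof.
by rewrite /text iotaS_rcons map_cat flatten_cat /= cats0 add1n.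
Qed.

Lemma activeS i : active i.+1 = fwd R true (active i) (phrase i.+1).
Proof. by rewrite /active textS fwd_cat. Qed.

Lemma selectedS i : selected i.+1 = selected i + base i.+1.
Proof. by rewrite /selected iotaS_rcons count_cat /= addn0 add1n. Qed.

Lemma matchesS i : matches i.+1 = matches i ++ found i.
Proof.
by rewrite /matches iotaS_rcons map_cat flatten_cat /= cats0 add0n.
Qed.

Lemma selected_le i : i <= n -> selected i <= selected n.
Proof.
move=> /subnKC <-; elim: (n - i) => [|d IH]; first by rewrite addn0.
by rewrite addnS selectedS; lia.
Qed.

Lemma size_text_le i : i <= n -> size (text i) <= size (text n).
Proof.
move=> /subnKC <-; elim: (n - i) => [|d IH]; first by rewrite addn0.
by rewrite addnS textS size_cat; lia.
Qed.

Hypotheses (sel_le : selected n <= n %/ t) (text_le : size (text n) <= B).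

Definition loop_env (i : nat) (s : state) : Prop :=
  [/\ trie_env s /\ table_env i s,
      sv s vPos = size (text i) /\ sv s vCnt = selected i,
      forall k, k < m -> sa s aS k = active i k,
      forall v, v <= i -> base v -> mat_env (selected i) v s &
      so s = matches i].

Lemma mat_env_same c v cm s s' : same cm s s' ->
  all (fun a => a \notin moda cm) [:: aMid; aMat] ->
  mat_env c v s -> mat_env c v s'.
Proof.
move=> h /= /and3P[h1 h2 _] [->|hmat]; first by left.
by right; rewrite !(same_a h).
Qed.

(** The cost of a matrix is kept as a separate term with factor [base i.+1]: it is too large for a
    single round and only its sum over all rounds is small. *)
Lemma main_body_spec s i : loop_env i s -> sv s vI = i -> i < n ->
  spec main_body s (fun s' => loop_env i.+1 s' /\
    tm s' <= tm s + 200 * m * (m + t) + 180 * m * m * t * base i.+1 +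
             16 * m * size (found i)).
Proof.
move=> [[env tenv] [epos ecnt] hS hmat ho] ei lt.
have m0 := re_length_gt0 R; have t0 : 0 < t by lia.
have hi : 0 < i.+1 <= n by lia.
apply: spec_seq; apply: spec_assign => //=; rewrite ei addn1.
set s1 := setv _ _ _.
have env1 : trie_env s1 by [].
apply: spec_seq; apply: spec_frame.
apply: spec_conseq (climb_spec (s := s1) env1 erefl hi) _.
move=> s2 [t2 [p [v penv2]]] sm2.
have env2 : trie_env s2 := trie_env_same sm2 isT isT env1.
have i2 : sv s2 vNode = i.+1 by rewrite (same_v sm2).
have [[hb vi pt pn] _ _ _ _] := penv2.
have c2 : sv s2 vCnt = selected i by rewrite (same_v sm2).
have mat2 u : u <= i -> base u -> mat_env (selected i) u s2.
  by move=> ui bu; apply: mat_env_same sm2 isT (hmat u ui bu).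
have le1 := selected_le lt; have le0 := selected_le (ltnW lt).
have dep2 : sa s2 aDep i.+1 = dep i.+1 by case: env2 => _ _ _ _ [-> //].
have [st2 re2] : sv s2 vStep = t /\ sv s2 vRes = r by case: env2.
have iL : i.+1 < L by lia.
pose P3 s3 := [/\ tm s3 <= tm s2 + 1 + 170 * m * m * t * base i.+1 + 1,
  sv s3 vCnt = selected i.+1 &
  forall u, u <= i.+1 -> base u -> mat_env (selected i.+1) u s3].
apply: spec_seq; apply: spec_frame.
have S3 : spec (If (EEq (EArr aDep (EV vNode) [%] EV vStep) (EV vRes)) matrix Skip)
    s2 P3.
  have bE : base i.+1 = (dep i.+1 %% t == r) by [].
  apply: spec_if => /=; rewrite i2 // dep2 st2 re2 -bE => hc.
    have {}hc : base i.+1 by case: (base _) hc.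
    have cn : selected i < n %/ t by move: le1; rewrite selectedS hc; lia.
    have penv2' : path_env i.+1 p v (tick s2) by [].
    apply: spec_conseq (matrix_spec (s := tick s2) env2 penv2' i2 hi c2 cn
      (mat2 _ vi hb : mat_env _ v (tick s2))) _.
    move=> s3 [t3 c3 hi3 hu3]; rewrite /P3 selectedS hc /= muln1 (addn1 (selected i)).
    split=> //; first by move: t3 => /=; lia.
    move=> u; rewrite leq_eqVlt => /orP[/eqP -> //|ui bu].
    by apply: hu3; [lia|apply: (mat2 u ui bu)].
  have {}hc : base i.+1 = false by case: (base _) hc.
  apply: spec_skip; rewrite /P3 selectedS hc /= muln0 !addn0; split=> //=; first by lia.
  move=> u; rewrite leq_eqVlt => /orP[/eqP ->|ui bu]; first by rewrite hc.
  exact: (mat2 u ui bu).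
apply: spec_conseq S3 _ => s3 [t3 c3 mat3] sm3.
have env3 : trie_env s3 := trie_env_same sm3 isT isT env2.
have penv3 : path_env i.+1 p v s3 := path_env_same sm3 isT isT penv2.
have i3 : sv s3 vNode = i.+1 by rewrite (same_v sm3).
have M3 : sa s3 aM = sa s aM by rewrite (same_a sm3) // (same_a sm2).
have vi1 : v <= i.+1 by exact: ltnW.
have pi : par i.+1 <= i by rewrite -ltnS; apply: par_lt.
apply: spec_seq; apply: spec_frame.
apply: spec_conseq (table_spec env3 penv3 i3 hi (leq_trans le1 sel_le)
  (mat3 v vi1 hb) _) _.
  by move=> row rm; rewrite M3 tenv.
move=> s4 [t4 row4 old4] sm4.
have env4 : trie_env s4 := trie_env_same sm4 isT isT env3.
have tenv4 : table_env i.+1 s4.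
  move=> u row; rewrite leq_eqVlt => /orP[/eqP -> rm|ui rm]; first exact: row4.
  rewrite old4 ?M3 ?tenv //.
  have : u.+1 * m.+1 <= i.+1 * m.+1 by rewrite leq_mul2r ui orbT.
  by rewrite mulSn; lia.
have i4 : sv s4 vNode = i.+1 by rewrite (same_v sm4).
have pos4 : sv s4 vPos = size (text i).
  by rewrite (same_v sm4) // (same_v sm3) // (same_v sm2).
have S4 k : k < m -> sa s4 aS k = active i k.
  by move=> km; rewrite (same_a sm4) // (same_a sm3) // (same_a sm2) //; apply: hS.
have mat4 : mat_env (selected i.+1) v s4 := mat_env_same sm4 isT (mat3 v vi1 hb).
have penv4 : path_env i.+1 p v s4 := path_env_same sm4 isT isT penv3.
have o4 : so s4 = matches i.
  case: sm4 => _ _ -> //; case: sm3 => _ _ -> //; case: sm2 => _ _ -> //.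
apply: spec_seq; apply: spec_frame.
apply: spec_conseq (report_spec env4 tenv4 i4 hi pos4 S4) _.
move=> s5 [t5 o5] sm5.
have env5 : trie_env s5 := trie_env_same sm5 isT isT env4.
have penv5 : path_env i.+1 p v s5 := path_env_same sm5 isT isT penv4.
have mat5 : mat_env (selected i.+1) v s5 := mat_env_same sm5 isT mat4.
have S5 k : k < m -> sa s5 aS k = active i k.
  by move=> km; rewrite (same_a sm5) //; apply: S4.
apply: spec_seq; apply: spec_frame.
apply: spec_conseq (advance_spec env5 penv5 lt (leq_trans le1 sel_le) mat5 S5) _.
move=> s6 [t6 S6] sm6.
have env6 : trie_env s6 := trie_env_same sm6 isT isT env5.
have i6 : sv s6 vNode = i.+1 by rewrite (same_v sm6) // (same_v sm5).
have pos6 : sv s6 vPos = size (text i) by rewrite (same_v sm6) // (same_v sm5).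
have dep6 : sa s6 aDep i.+1 = dep i.+1 by case: env6 => _ _ _ _ [-> //].
have pos' : size (text i) + dep i.+1 = size (text i.+1).
  by rewrite textS size_cat size_phrase.
(* A sum of two stored values is not [small], so [okval] requires an explicit bound, here the length
   of the text. *)
apply: spec_assign => /=; rewrite ?i6 //.
  rewrite /okval /= i6 pos6 dep6 pos'; apply: leq_trans (size_text_le lt) text_le.
rewrite pos6 dep6 pos'; split.
  split=> //=.
  - split=> //; rewrite /table_env /= (same_a sm6) // (same_a sm5) //.
  - split=> //; rewrite (same_v sm6) // (same_v sm5) // (same_v sm4) //.
  - by move=> k km; rewrite S6 // activeS.
  - move=> u ui bu.
    exact: (mat_env_same sm6 isT (mat_env_same sm5 isT
      (mat_env_same sm4 isT (mat3 u ui bu)))).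
  - by case: sm6 => _ _ -> //; rewrite o5 o4 matchesS.
have fE : size [seq size (text i) + dep x | x <- chain par i.+1 & hit (active i) m x]
  = size (found i) by [].
rewrite fE in t5.
have h1 : m <= m * t by rewrite leq_pmulr.
have h2 : m <= m * m by rewrite leq_pmulr.
have h3 : t <= m * t by rewrite leq_pmull.
move: t6 t5 t4 t3 t2 => /=; move: h1 h2 h3; rewrite /s1 /=.
by case: (base i.+1) => /=; rewrite ?muln1 ?muln0; nlia.
Qed.

Lemma main_loop_spec s :
  trie_env s -> sv s vPos = 0 -> sv s vCnt = 0 -> so s = [::] ->
  (forall k, k < m -> sa s aS k = 0) -> (forall k, k <= m -> sa s aM k = 0) ->
  spec main_loop s (fun s' => so s' = matches n /\
    tm s' <= tm s + 3 + 203 * n * m * (m + t) + 180 * m * m * t * selected n +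
             16 * m * size (matches n)).
Proof.
move=> env epos ecnt eso hS hM.
have m0 := re_length_gt0 R; have t0 : 0 < t by lia.
apply: (@spec_for _ _ _ _ _ _ n (fun i s' => loop_env i s' /\
  tm s' <= tm s + 1 + 203 * m * (m + t) * i + 180 * m * m * t * selected i +
             16 * m * size (matches i))) => //.
- by move=> s' sm; have [[_ h _ _ _] _ _ _ _] := trie_env_same sm isT isT env.
- split=> /=; last by lia.
  split=> //=; last by move=> v; rewrite leqn0 => /eqP -> _; left.
  split=> // v row; rewrite leqn0 => /eqP -> rm.
  by rewrite mul0n add0n /= hM.
- move=> i s1 lt sm ei [lenv ht].
  apply: spec_conseq (main_body_spec (s := tick s1) lenv ei lt) _.
  move=> s2 [lenv2 t2]; split; first exact: lenv2.
  rewrite selectedS matchesS size_cat /=.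
  have : 1 <= m * t by rewrite muln_gt0 m0.
  move: t2 ht => /=.
  by case: (base i.+1); rewrite ?muln1 ?muln0; nlia.
move=> s1 _ _ [[_ _ _ _ ho] ht]; split=> //=.
by move: ht; nlia.
Qed.

End Algorithm.

(** * Preprocessing and the complete program *)

Definition header : cmd :=
  vTag <:- EIn (EC 0) ;; vSig <:- EIn (EC 1) ;; vN <:- EIn (EC 2) ;;
  vM <:- EIn (EC 3) ;; vTau <:- EIn (EC 4).

(** The first letter is stored before the label: when [vP] + 1 is [vX], the label is the first
    letter of the phrase just being entered. *)
Definition read_zlw : cmd :=
  vC <:- EIn (EC 5 [+] EV vI) ;;
  If (ELt (EV vC) (EV vSig))
    (Store aPar (EV vX) (EC 0) ;; Store aLab (EV vX) (EV vC) ;;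
     Store aFst (EV vX) (EV vC))
    (vP <:- EV vC [-] EV vSig [+] EC 1 ;;
     Store aPar (EV vX) (EV vP) ;;
     Store aFst (EV vX) (EArr aFst (EV vP)) ;;
     Store aLab (EV vX) (EArr aFst (EV vP [+] EC 1))).

Definition read_zl78 : cmd :=
  Store aPar (EV vX) (EIn (EC 5 [+] EC 2 [*] EV vI)) ;;
  Store aLab (EV vX) (EIn (EC 6 [+] EC 2 [*] EV vI)).

Definition build_trie : cmd :=
  For vI (EV vN) (
    vX <:- EV vI [+] EC 1 ;;
    If (EV vTag) read_zlw read_zl78 ;;
    Store aDep (EV vX) (EArr aDep (EArr aPar (EV vX)) [+] EC 1)).

Definition build_regex : cmd :=
  For vK (EV vM) (
    vX <:- EIn (rpos (EV vK)) ;;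
    If (ELt (EC 2) (EV vX))
      (Store aLo (EV vK) (EV vK) ;; Store aNul (EV vK) (EC 0))
      (children ;;
       If (EEq (EV vX) (EC 2))
         (Store aLo (EV vK) (EArr aLo (EV vP)) ;; Store aNul (EV vK) (EC 1))
         (Store aLo (EV vK) (EArr aLo (EV vQ)) ;;
          If (EV vX)
            (Store aNul (EV vK) (EOr (EArr aNul (EV vP)) (EArr aNul (EV vQ))))
            (Store aNul (EV vK) (EAnd (EArr aNul (EV vP)) (EArr aNul (EV vQ))))))).

Definition count_residue : cmd :=
  vCnt <:- EC 0 ;;
  For vK (EV vN)
    (If (EEq (EArr aDep (EV vK [+] EC 1) [%] EV vStep) (EV vI)) (inc vCnt) Skip).

(** Counting anew for each residue costs O(nt), which the time bound allows. The product of count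
    and step is compared without being stored, so it needs no [okval]. *)
Definition choose_residue : cmd :=
  If (ELt (EV vN) (EV vTau)) (vStep <:- EV vN [+] EC 1) (vStep <:- EV vTau) ;;
  vRes <:- EC 0 ;;
  For vI (EV vStep)
    (count_residue ;;
     If (ELt (EV vN) (EV vCnt [*] EV vStep)) Skip (vRes <:- EV vI)).

Definition compute_last : cmd :=
  For vK (EV vM) (Store aV (EV vK) (EC 0)) ;;
  vD <:- EC 0 ;; vB <:- EC 1 ;; follow ;;
  For vK (EV vM) (Store aLst (EV vK) (EArr aV (EV vK))).

(** For n = 0 the arrays have length 0 and no cell of them may be touched, so this case is
    skipped. *)
Definition matcher : cmd :=
  header ;;
  If (EV vN)
    (build_trie ;; build_regex ;; choose_residue ;; compute_last ;;
     vCnt <:- EC 0 ;; main_loop)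
    Skip.

Section Residues.

Variables (n t : nat) (f : nat -> nat).
Hypothesis t0 : 0 < t.

Lemma sum_residues (l : seq nat) :
  \sum_(r < t) count (fun v => f v %% t == r) l = size l.
Proof.
elim: l => [|v l IH] /=; first by rewrite big1.
rewrite big_split /= IH -add1n; congr (_ + _).
have lt : f v %% t < t by rewrite ltn_mod.
rewrite (bigD1 (Ordinal lt)) //= eqxx big1 ?addn0 // => r ne.
by rewrite (_ : _ == _ = false) //; apply: contraNF ne => /eqP e; apply/eqP/val_inj.
Qed.

(* The average of the t residue class sizes is n / t. *)
Lemma light_residue (l : seq nat) : size l = n ->
  exists2 r, r < t & count (fun v => f v %% t == r) l * t <= n.
Proof.
move=> sz; case: (boolP [exists r : 'I_t, count (fun v => f v %% t == r) l * t <= n]).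
  by move=> /existsP[r h]; exists r.
rewrite negb_exists => /forallP h.
have : t * n < \sum_(r < t) count (fun v => f v %% t == r) l * t.
  have : \sum_(r < t) n.+1 <= \sum_(r < t) count (fun v => f v %% t == r) l * t.
    by apply: leq_sum => r _; rewrite ltnNge h.
  by rewrite sum_nat_const card_ord; lia.
by rewrite -big_distrl /= sum_residues sz mulnC ltnn.
Qed.

End Residues.

(** * Correctness of the preprocessing and of the program *)

Section Setup.

Variables (sigma : nat) (R : regexp 'I_sigma) (inp : seq nat) (L B n tag tau : nat).
Variables (par lab fst : nat -> nat).
Notation m := (re_length R).
Notation nd k := (node R 0 k).
Notation spec := (spec inp L B).
Notation dep := (dep par).
Notation regex_env := (regex_env R n tag).

Hypothesis Hsym : forall k, k < m ->
  nth 0 inp (5 + n * (2 - tag) + k) = nth 0 (encode_regexp R) k.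
Hypotheses (mL : m < L) (nL : n < L).
Hypotheses (par0 : par 0 = 0) (par_lt : forall v, 0 < v -> par v < v).
Hypothesis Henc : forall i, i < n ->
  if tag == 0 then nth 0 inp (5 + 2 * i) = par i.+1 /\
                   nth 0 inp (6 + 2 * i) = lab i.+1
  else let c := nth 0 inp (5 + i) in
    if c < sigma then [/\ par i.+1 = 0, lab i.+1 = c & fst i.+1 = c]
    else [/\ par i.+1 = (c - sigma).+1, fst i.+1 = fst (par i.+1) &
             lab i.+1 = fst (par i.+1).+1].

Definition trie_upto (i : nat) (s : state) : Prop :=
  [/\ forall v, v <= i -> sa s aPar v = par v,
      forall v, 0 < v <= i -> sa s aLab v = lab v,
      forall v, v <= i -> sa s aDep v = dep v &
      tag != 0 -> forall v, 0 < v <= i -> sa s aFst v = fst v].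

Lemma build_trie_spec s :
  sv s vTag = tag -> sv s vSig = sigma -> sv s vN = n ->
  sa s aPar 0 = 0 -> sa s aDep 0 = 0 ->
  spec build_trie s (fun s' => tm s' <= tm s + 3 + 13 * n /\ trie_upto n s').
Proof.
move=> etag esig en p0 d0.
apply: (@spec_for _ _ _ _ _ _ n (fun i s' => tm s' <= tm s + 1 + 13 * i /\
  trie_upto i s')) => //.
- by move=> s' sm; rewrite /= (same_v sm).
- split; first by rewrite /=; lia.
  split=> /= [v|v|v|_ v]; [|by lia| |by lia].
    by rewrite leqn0 => /eqP ->; rewrite p0 par0.
  by rewrite leqn0 => /eqP ->.
- move=> i s1 lt sm ei [ht [hp hl hd hf]].
  have tag1 : sv s1 vTag = tag by rewrite (same_v sm).
  have sig1 : sv s1 vSig = sigma by rewrite (same_v sm).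
  have iL : i.+1 < L by lia.
  have plt := par_lt (ltn0Sn i).
  apply: spec_seq; apply: spec_assign => //=; rewrite ei addn1.
  set s2 := setv _ _ _.
  pose P3 s3 := [/\ tm s3 <= tm s2 + 7, sa s3 aDep = sa s1 aDep,
    sv s3 vX = i.+1,
    [/\ sa s3 aPar i.+1 = par i.+1, sa s3 aLab i.+1 = lab i.+1 &
      tag != 0 -> sa s3 aFst i.+1 = fst i.+1] &
    [/\ forall v, v <= i -> sa s3 aPar v = sa s1 aPar v,
      forall v, v <= i -> sa s3 aLab v = sa s1 aLab v &
      forall v, v <= i -> sa s3 aFst v = sa s1 aFst v]].
  have S3 : spec (If (EV vTag) read_zlw read_zl78) s2 P3.
    have ne v : v <= i -> (v == i.+1) = false by lia.
    have enc := Henc lt; apply: spec_if => //=; rewrite tag1 => htag.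
      move: enc; rewrite (negPf htag) => enc.
      apply: spec_seq; apply: spec_assign => //=; rewrite ei.
      move: enc; set c := nth 0 inp _ => /=.
      case: ifP => hc [e1 e2 e3]; apply: spec_if => //=; rewrite sig1 hc // => _.
        apply: spec_seq; apply: spec_store => //=.
        apply: spec_seq; apply: spec_store => //=.
        apply: spec_store => //=; split=> //=; first by lia.
          by rewrite eqxx; split.
        by split=> v /ne ->.
      apply: spec_seq; apply: spec_assign => //=; rewrite sig1.
      have ep : c - sigma + 1 = par i.+1 by rewrite e1 addn1.
      rewrite ep; have pL : par i.+1 < L by lia.
      have p0' : 0 < par i.+1 by rewrite e1.
      apply: spec_seq; apply: spec_store => //=.
      apply: spec_seq; apply: spec_store => //=.
      apply: spec_store => //=; first by rewrite addn1; lia.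
      have fp : sa s1 aFst (par i.+1) = fst i.+1 by rewrite hf // ?e2 //; lia.
      rewrite fp addn1 eqSS; split=> //=; first by lia.
        rewrite eqxx; split=> //; rewrite e3.
        (* Here the label refers to the first letter of node [i.+1] itself, which was stored just
           before. *)
        case: (eqVneq (par i.+1) i) => [->|np] //; rewrite hf //; lia.
      by split=> v /ne ->.
    move: enc; rewrite htag /= => -[e1 e2].
    apply: spec_seq; apply: spec_store => //=.
    apply: spec_store => //=; rewrite ei e1 e2; split=> //=; first by lia.
      by rewrite eqxx; split=> //; rewrite htag.
    by split=> v hv; rewrite ?(ne v hv).
  apply: spec_seq; apply: spec_conseq S3 _.
  move=> s3 [t3 dep3 x3 [p3 l3 f3] [op ol of_]].
  apply: spec_store; rewrite /= ?x3 ?p3 //.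
    by do !split=> //; lia.
  have di : dep i.+1 = (dep (par i.+1)).+1 by apply: depE.
  split=> /=; first by move: t3; rewrite /s2 /=; lia.
  rewrite dep3 hd //; split=> [v|v|v|htag v] /=.
  + by rewrite leq_eqVlt => /orP[/eqP -> //|vi]; rewrite op ?hp.
  + case/andP=> v0; rewrite leq_eqVlt => /orP[/eqP -> //|vi].
    by rewrite ol // hl // v0.
  + rewrite leq_eqVlt => /orP[/eqP ->|vi]; first by rewrite eqxx addn1 di.
    by rewrite ifN ?dep3 ?hd //; lia.
  + case/andP=> v0; rewrite leq_eqVlt => /orP[/eqP ->|vi]; first exact: f3.
    by rewrite of_ // hf // v0.
by move=> s' _ _ [ht h]; split=> //=; lia.
Qed.

#[local] Opaque rpos.

Lemma build_regex_spec s :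
  sv s vTag = tag -> sv s vN = n -> sv s vM = m -> sv s vD = 0 ->
  spec build_regex s (fun s' => tm s' <= tm s + 3 + 14 * m /\ regex_env s').
Proof.
move=> etag en em ed; have m0 := re_length_gt0 R; apply: spec_frame.
apply: (@spec_for _ _ _ _ _ _ m (fun k s' => [/\ tm s' <= tm s + 1 + 14 * k,
  forall j, j < k -> sa s' aLo j = (nd j).2 &
  forall j, j < k -> sa s' aNul j = nullable (nd j).1])) => //.
- by move=> s' sm; rewrite /= (same_v sm).
- by split=> //=; lia.
- move=> k s1 km sm ek [ht hl hn].
  have tag1 : sv s1 vTag = tag by rewrite (same_v sm).
  have n1 : sv s1 vN = n by rewrite (same_v sm).
  have d1 : sv s1 vD = false by rewrite (same_v sm).
  have kL : k < L by lia.
  case E: (nd k) => [R' o']; have hk : 0 <= k < 0 + m by lia.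
  have [_] := node_size hk; rewrite E /= => sz'.
  have hN j : j < k.+1 -> j = k \/ j < k /\ (j == k) = false by lia.
  have fin s2 (t' lo' nul' : nat) : t' <= tm s1 + 12 ->
      sa s2 aLo = sa s1 aLo -> sa s2 aNul = sa s1 aNul -> lo' = o' ->
      nul' = nullable R' ->
      [/\ t' < tm s + 1 + 14 * k.+1,
      forall j, j < k.+1 -> (if j == k then lo' else sa s2 aLo j) = (nd j).2 &
      forall j, j < k.+1 -> (if j == k then nul' else sa s2 aNul j) = nullable (nd j).1].
    move=> h1 h2 h3 -> ->; rewrite h2 h3; split; first by nlia.
      by move=> j /hN[->|[jk ->]]; [rewrite eqxx E|rewrite hl].
    by move=> j /hN[->|[jk ->]]; [rewrite eqxx E|rewrite hn].
  apply: spec_seq; apply: spec_assign => //=.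
  rewrite (nth_rpos Hsym) //=; last by rewrite ek.
  rewrite ek E /=.
  apply: spec_if => //= hx.
    have [a eR] : exists a, R' = Char a by case: (R') hx => // a _; exists a.
    apply: spec_seq; apply: spec_store; rewrite /= ?ek //.
    apply: spec_store; rewrite /= ?ek //; apply: (fin s1) => //=; last by rewrite eR.
      by nlia.
    by move: sz'; rewrite eR /=; lia.
  have {}hx : symbol R' <= 2 by nlia.
  have k0 : 0 < k.
    have := re_length_gt0 R'; case: R' E sz' hx fin => //= [R1 R2|R1 R2|R1] _ sz' _ _ _.
    - by have := re_length_gt0 R1; nlia.
    - by have := re_length_gt0 R1; nlia.
    - by have := re_length_gt0 R1; nlia.
  have hk1 : 0 < k < m by nlia.
  have lo1 : sa s1 aLo k.-1 = (nd k.-1).2 by apply: hl; nlia.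
  apply: spec_seq; set s2 := tick _.
  apply: spec_conseq (children_spec (s := s2) (d := false) inp B mL lo1 ek hk1 d1) _.
  move=> s3 [t3 sm3 hP hQ _]; move: t3; rewrite /s2 /= => t3.
  have lo3 : sa s3 aLo = sa s1 aLo by rewrite (same_a sm3).
  have nul3 : sa s3 aNul = sa s1 aNul by rewrite (same_a sm3).
  have X3 : sv s3 vX = symbol R' by rewrite (same_v sm3).
  have K3 : sv s3 vK = k by rewrite (same_v sm3).
  have pL : k.-1 < L by nlia.
  have pk : k.-1 < k by nlia.
  have kp : (k.-1 == k) = false by lia.
  have [[R1 [R2 eR]]|[R1 [R2 eR]]|[R1 eR]] := symbol_cases hx.
  + have [e1 e2 _] := node_cat_alt hk E (or_introl eR).
    have s1gt := re_length_gt0 R1; move: sz'; rewrite eR /= => sz'.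
    have qk : (o' + re_length R1).-1 < k by nlia.
    have qL : (o' + re_length R1).-1 < L by nlia.
    rewrite e1 /= in hQ.
    apply: spec_if; rewrite /= ?X3 ?eR //= => _.
    apply: spec_seq; apply: spec_store; rewrite /= ?K3 ?hQ //.
    apply: spec_if; rewrite /= ?X3 ?eR //= => _.
    apply: spec_store; rewrite /= ?K3 ?hP ?hQ //.
    apply: (fin s3) => //; first by nlia.
      by rewrite lo3 hl // e2.
    by rewrite nul3 !hn // e1 e2 eR /= !lt0b andbC.
  + have [e1 e2 _] := node_cat_alt hk E (or_intror eR).
    have s1gt := re_length_gt0 R1; move: sz'; rewrite eR /= => sz'.
    have qk : (o' + re_length R1).-1 < k by nlia.
    have qL : (o' + re_length R1).-1 < L by nlia.
    rewrite e1 /= in hQ.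
    apply: spec_if; rewrite /= ?X3 ?eR //= => _.
    apply: spec_seq; apply: spec_store; rewrite /= ?K3 ?hQ //.
    apply: spec_if; rewrite /= ?X3 ?eR //= => _.
    apply: spec_store; rewrite /= ?K3 ?hP ?hQ //.
    apply: (fin s3) => //; first by nlia.
      by rewrite lo3 hl // e2.
    by rewrite nul3 !hn // e1 e2 eR /= !lt0b orbC.
  have [e1 _] := node_star hk (etrans E (congr1 (pair^~ o') eR)).
  apply: spec_if; rewrite /= ?X3 ?eR //= => _.
  apply: spec_seq; apply: spec_store; rewrite /= ?K3 ?hP //.
  apply: spec_store; rewrite /= ?K3 //.
  apply: (fin s3) => //; first by nlia.
    by rewrite lo3 hl // e1.
  by rewrite eR.
move=> s1 _ _ [t1 h1 h2] sm; split=> /=; first by lia.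
by split; rewrite ?(same_v sm).
Qed.

Definition step_size : nat := if n < tau then n.+1 else tau.
Notation t := step_size.

Lemma choose_residue_spec s : 0 < tau ->
  sv s vN = n -> sv s vTau = tau -> (forall v, v <= n -> sa s aDep v = dep v) ->
  spec choose_residue s (fun s' => [/\ tm s' <= tm s + 7 + (5 * n + 8) * t,
    sv s' vStep = t, sv s' vRes < t &
    count (fun v => dep v %% t == sv s' vRes) (iota 1 n) * t <= n]).
Proof.
move=> tau0 en etau hdep.
have t0 : 0 < t by rewrite /step_size; case: ifP.
pose cnt q := count (fun v => dep v %% t == q) (iota 1 n).
pose P1 s1 := [/\ tm s1 <= tm s + 2, sv s1 vStep = t, sv s1 vN = n &
  sa s1 aDep = sa s aDep].
apply: spec_seq.
have S1 : spec (If (ELt (EV vN) (EV vTau)) (vStep <:- EV vN [+] EC 1) (vStep <:- EV vTau)) s P1.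
  apply: spec_if => //=; rewrite en etau => h; apply: spec_assign => //=.
    by split=> //=; [lia|rewrite en addn1 /step_size; case: ltnP h].
  by split=> //=; [lia|rewrite etau /step_size; case: ltnP h].
apply: spec_conseq S1 _ => s1 [t1 st1 n1 dep1].
apply: spec_seq; apply: spec_assign => //=.
apply: spec_frame.
(* The invariant is conditional: [vRes] is light once a light residue has been met. [light_residue]
   discharges the condition at the end. *)
apply: (@spec_for _ _ _ _ _ _ t (fun q s' => [/\ tm s' <= tm s + 4 + (5 * n + 8) * q,
  sv s' vRes < t & (exists2 q', q' < q & cnt q' * t <= n) -> cnt (sv s' vRes) * t <= n])) => //.
- by move=> s' sm; rewrite /= (same_v sm).
- by split=> //=; [nlia|case].
- move=> q s2 qt sm eq_ [t2 r2 h2].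
  have n2 : sv s2 vN = n by rewrite (same_v sm).
  have st2 : sv s2 vStep = t by rewrite (same_v sm).
  have dep2 v : v <= n -> sa s2 aDep v = dep v by rewrite (same_a sm) //= dep1; apply: hdep.
  apply: spec_seq; apply: spec_frame.
  have C : spec count_residue (tick s2) (fun s' =>
      tm s' <= tm s2 + 5 + 5 * n /\ sv s' vCnt = cnt q).
    apply: spec_seq; apply: spec_assign => //=.
    apply: (@spec_for _ _ _ _ _ _ n (fun k s' => tm s' <= tm s2 + 3 + 5 * k /\
      sv s' vCnt = count (fun v => dep v %% t == q) (iota 1 k))) => //.
    + by move=> s' sm3; rewrite /= (same_v sm3).
    + by split=> //=; lia.
    + move=> k s3 kn sm3 ek [t3 h3].
      have d3 : sa s3 aDep k.+1 = dep k.+1 by rewrite (same_a sm3) //= dep2.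
      have q3 : sv s3 vI = q by rewrite (same_v sm3).
      have st3 : sv s3 vStep = t by rewrite (same_v sm3).
      have kL : k.+1 < L by lia.
      have E : count (fun v => dep v %% t == q) (iota 1 k.+1) =
          count (fun v => dep v %% t == q) (iota 1 k) + (dep k.+1 %% t == q).
        by rewrite iotaS_rcons count_cat /= addn0 add1n.
      cbv beta; rewrite E.
      apply: spec_if; rewrite /= ?ek ?(addn1 k) ?d3 ?q3 ?st3.
      * by do !split.
      * move=> h; apply: spec_assign => //=; rewrite h3.
        by split; [nlia|case: (_ == q) h; rewrite ?addn0].
      * move=> h; apply: spec_skip; rewrite /= h3.
        by split; [nlia|case: (_ == q) h; rewrite ?addn0].
    by move=> s3 _ _ [t3 h3]; split=> //=; lia.
  apply: spec_conseq C _ => s3 [t3 c3] sm3.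
  have n3 : sv s3 vN = n by rewrite (same_v sm3).
  have st3 : sv s3 vStep = t by rewrite (same_v sm3).
  have q3 : sv s3 vI = q by rewrite (same_v sm3).
  have r3 : sv s3 vRes = sv s2 vRes by rewrite (same_v sm3).
  apply: spec_if; rewrite /= ?n3 ?c3 ?st3 //.
    move=> h; apply: spec_skip; rewrite /= r3; split=> //; first by nlia.
    case=> q'; rewrite ltnS leq_eqVlt => /orP[/eqP ->|lt] g; last by apply: h2; exists q'.
    by move: h; rewrite ltnNge g.
  move=> h; apply: spec_assign => //=; rewrite q3; split=> //; first by nlia.
  by move=> _; case: ltnP h.
move=> s2 _ _ [t2 r2 h2] sm; split=> //=; first by nlia.
  by rewrite (same_v sm).
apply: h2; have [q qt hq] := light_residue dep t0 (size_iota 1 n).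
by exists q.
Qed.

Lemma compute_last_spec s : regex_env s ->
  spec compute_last s (fun s' => tm s' <= tm s + 50 * m + 8 /\
    forall k, k < m -> sa s' aLst k = lasts R k).
Proof.
move=> env; have m0 := re_length_gt0 R.
have em : sv s vM = m by case: env.
apply: spec_seq; apply: spec_frame.
apply: (@spec_for _ _ _ _ _ _ m (fun k s' => tm s' <= tm s + 1 + 3 * k /\
  forall j, j < k -> sa s' aV j = 0)) => //.
- by move=> s' sm; rewrite /= (same_v sm).
- by split=> //=; lia.
- move=> k s1 km sm ek [ht h]; have kL : k < L by lia.
  apply: spec_store; rewrite //= ek //; split=> /= [|j jk]; first by lia.
  by case: eqP => // ne; apply: h; lia.
move=> s1 sm1 _ [t1 h1] smt.
apply: spec_seq; apply: spec_assign => //=.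
apply: spec_seq; apply: spec_assign => //=.
set s2 := setv _ _ _.
have env2 : regex_env s2 := regex_env_same sm1 isT isT env.
apply: spec_seq; apply: spec_frame.
have F := follow_spec (s := s2) (d := false) (b := true) (V := fun=> false)
  B Hsym mL env2 h1 erefl erefl.
apply: spec_conseq F _ => s3 [t3 h3 _] sm3.
have m3 : sv s3 vM = m by rewrite (same_v sm3) //= (same_v sm1).
apply: (@spec_for _ _ _ _ _ _ m (fun k s' => tm s' <= tm s3 + 1 + 3 * k /\
  forall j, j < k -> sa s' aLst j = lasts R j)) => //.
- by move=> s' sm; rewrite /= (same_v sm).
- by split=> //=; lia.
- move=> k s4 km sm ek [ht h]; have kL : k < L by lia.
  apply: spec_store; rewrite //= ek //; split=> /= [|j jk]; first by lia.
  case: eqP => [->|ne]; last by apply: h; lia.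
  by rewrite (same_a sm) //= h3.
by move=> s4 _ _ [t4 h4]; split=> //=; move: t3; rewrite /s2 /=; lia.
Qed.

Hypotheses (Hhead : [/\ nth 0 inp 0 = tag, nth 0 inp 1 = sigma, nth 0 inp 2 = n,
    nth 0 inp 3 = m & nth 0 inp 4 = tau]).

Lemma header_spec : spec header init_state (fun s' => [/\
  [/\ sv s' vTag = tag, sv s' vSig = sigma, sv s' vN = n, sv s' vM = m &
      sv s' vTau = tau], tm s' = 5, so s' = [::],
  forall x, 4 < x -> sv s' x = 0 & forall a i, sa s' a i = 0]).
Proof.
have [h0 h1 h2 h3 h4] := Hhead.
do 4 (apply: spec_seq; apply: spec_assign => //).
apply: spec_assign => //; split=> //.
by move=> x; do 5 (case: x => [//|x]).
Qed.

Lemma matcher_spec0 : n = 0 ->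
  spec matcher init_state (fun s' => so s' = [::] /\ tm s' = 7).
Proof.
move=> n0; apply: spec_seq; apply: spec_conseq header_spec _.
move=> s1 [[_ _ n1 _ _] t1 o1 _ _].
apply: spec_if => //=; rewrite n1 n0 // => _.
by apply: spec_skip; rewrite /= t1.
Qed.

Hypotheses (tau0 : 0 < tau) (n0 : 0 < n) (nmL : n.+1 * m.+1 <= L)
  (matL : n %/ tau * (m.+1 * m) <= L) (text_le : size (text par lab n) <= B).

(** If tau exceeds n, both quotients are 0; hence the room for matrices can be stated with tau. *)
Lemma divn_step_size : n %/ t = n %/ tau.
Proof. by rewrite /step_size; case: ltnP => // lt; rewrite !divn_small. Qed.

Lemma step_size_le : 0 < t <= tau.
Proof. by rewrite /step_size; case: (ltnP n tau) => h; [lia|rewrite tau0 leqnn]. Qed.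

Lemma matcher_spec :
  spec matcher init_state (fun s' =>
    so s' = matches R par lab n /\
    tm s' <= 600 * (n * m * (m + tau)) + 16 * m * size (matches R par lab n)).
Proof.
have m0 := re_length_gt0 R; have [t0 t_le] := andP step_size_le.
apply: spec_seq; apply: spec_conseq header_spec _.
move=> s1 [[tag1 sig1 n1 m1 tau1] t1 o1 v1 a1].
apply: spec_if => //=; rewrite n1; last by lia.
move=> _; set s1' := tick s1.
apply: spec_seq; apply: spec_frame.
apply: spec_conseq (build_trie_spec (s := s1') tag1 sig1 n1 (a1 _ _) (a1 _ _)) _.
move=> s2 [t2 [par2 lab2 dep2 _]] sm2.
have tag2 : sv s2 vTag = tag by rewrite (same_v sm2).
have n2 : sv s2 vN = n by rewrite (same_v sm2).
have m2 : sv s2 vM = m by rewrite (same_v sm2).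
have tau2 : sv s2 vTau = tau by rewrite (same_v sm2).
have d2 : sv s2 vD = 0 by rewrite (same_v sm2) //= v1.
apply: spec_seq; apply: spec_frame.
apply: spec_conseq (build_regex_spec tag2 n2 m2 d2) _ => s3 [t3 env3] sm3.
have n3 : sv s3 vN = n by rewrite (same_v sm3).
have tau3 : sv s3 vTau = tau by rewrite (same_v sm3).
have dep3 v : v <= n -> sa s3 aDep v = dep v by rewrite (same_a sm3) //; apply: dep2.
apply: spec_seq; apply: spec_frame.
apply: spec_conseq (choose_residue_spec tau0 n3 tau3 dep3) _.
move=> s4 [t4 st4 r4 c4] sm4.
have env4 : regex_env s4 := regex_env_same sm4 isT isT env3.
apply: spec_seq; apply: spec_frame.
apply: spec_conseq (compute_last_spec env4) _ => s5 [t5 l5] sm5.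
have env5 : regex_env s5 := regex_env_same sm5 isT isT env4.
have res5 : sv s5 vRes = sv s4 vRes by rewrite (same_v sm5).
have st5 : sv s5 vStep = t by rewrite (same_v sm5).
apply: spec_seq; apply: spec_assign => //=.
set s6 := setv _ _ _; set r := sv s4 vRes in r4 c4 res5.
have env6 : trie_env R n tag par lab t r s6.
  split=> //=; last split=> // v vn; last first.
  - by rewrite (same_a sm5) // (same_a sm4) //; apply: dep3.
  - by move=> v hv; rewrite (same_a sm5) // (same_a sm4) // (same_a sm3) //; apply: lab2.
  - by move=> v hv; rewrite (same_a sm5) // (same_a sm4) // (same_a sm3) //; apply: par2.
have sel : selected par t r n * t <= n.
  rewrite /selected; apply: leq_trans c4; rewrite leq_mul2r; apply/orP; right.
  rewrite eq_leq //; apply: eq_in_count => v; rewrite mem_iota /base.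
  by case: v.
have sel' : selected par t r n <= n %/ t by rewrite leq_divRL.
have matL' : n %/ t * (m.+1 * m) <= L by rewrite divn_step_size.
have F := main_loop_spec (s := s6) Hsym mL nL nmL matL' par0 par_lt r4 sel' text_le env6.
have pos6 : sv s6 vPos = 0.
  by rewrite /= (same_v sm5) // (same_v sm4) // (same_v sm3) // (same_v sm2) //= v1.
have o6 : so s6 = [::].
  rewrite /=; case: sm5 => _ _ -> //; case: sm4 => _ _ -> //; case: sm3 => _ _ -> //.
  by case: sm2 => _ _ -> //.
have S6 k : sa s6 aS k = 0.
  by rewrite /= (same_a sm5) // (same_a sm4) // (same_a sm3) // (same_a sm2) //= a1.
have M6 k : sa s6 aM k = 0.
  by rewrite /= (same_a sm5) // (same_a sm4) // (same_a sm3) // (same_a sm2) //= a1.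
apply: spec_conseq (F pos6 erefl o6 (fun k _ => S6 k) (fun k _ => M6 k)) _.
move=> s7 [o7 t7]; split=> //.
have e1 : 1 <= n * m * m by rewrite !muln_gt0 n0 m0.
have e2 : n <= n * m * m by rewrite -mulnA leq_pmulr // muln_gt0 m0.
have e3 : m <= n * m * m by rewrite leq_pmull // muln_gt0 n0.
have e4 : t <= n * m * tau.
  by apply: leq_trans t_le _; rewrite leq_pmull // muln_gt0 n0.
have e5 : n * t <= n * m * tau.
  by rewrite -mulnA leq_mul2l; apply/orP; right; apply: leq_trans t_le _; rewrite leq_pmull.
have e6 : n * m * t <= n * m * tau by rewrite leq_mul2l t_le orbT.
(* Matrices cost m^2 t each, and there are at most n / t of them. *)
have e7 : m * m * (selected par t r n * t) <= m * m * n by rewrite leq_mul2l sel orbT.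
move: t7 t5 t4 t3 t2; rewrite /s1' /s6 /= t1.
set occ := size _; clearbody occ; set q := selected par t r n in e7 *.
clearbody q; clear -e1 e2 e3 e4 e5 e6 e7.
by move: (tm s7) (tm s5) (tm s4) (tm s3) (tm s2) => a b c d e; lia.
Qed.

End Setup.

(** * The output is the set of ending positions, without repetition *)

Section Matches.

Variables (sigma : nat) (R : regexp 'I_sigma) (Q : seq 'I_sigma) (Z : compressed sigma).
Variables (par lab fst : nat -> nat).
Hypothesis trie : trie_of Q Z par lab fst.
Notation n := (compressed_length Z).
Notation m := (re_length R).
Notation text := (text par lab).
Notation matches := (matches R par lab).
Notation found := (found R par lab).
Notation dep := (dep par).
Let par_lt := trie_par trie.

Lemma text_Q : text n = map val Q.
Proof.
have [ps [sz <- hps]] := trie_Q trie.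
have text_take i : i <= n -> text i = map val (flatten (take i ps)).
  elim: i => [|i IH] lt; first by rewrite take0.
  have lt' : i < size ps by rewrite sz.
  rewrite textS IH 1?ltnW // (take_nth [::]) // -cats1 flatten_cat map_cat /= cats0.
  by rewrite hps.
by rewrite text_take // -sz take_size.
Qed.

Lemma text_prefix i : i <= n -> text i = take (size (text i)) (text n).
Proof.
move=> le; have : exists w, text n = text i ++ w.
  rewrite -(subnKC le); elim: (n - i) => [|d [w e]].
    by exists [::]; rewrite addn0 cats0.
  by exists (w ++ phrase par lab (i + d).+1); rewrite addnS textS e catA.
by case=> w ->; rewrite take_size_cat.
Qed.

Lemma size_textS i : size (text i.+1) = size (text i) + dep i.+1.
Proof. by rewrite textS size_cat size_phrase. Qed.

(** For a node [x] above [i.+1], the text before this phrase followed by the phrase of [x] is a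
    prefix of [Q]. By linearity ([fend_fwd]), [hit] is acceptance after this prefix. *)
Lemma foundE i : i < n ->
  found i = [seq j <- rev (iota (size (text i)).+1 (dep i.+1)) | ends R (take j Q)].
Proof.
move=> lt; have -> : rev (iota (size (text i)).+1 (dep i.+1)) =
    [seq size (text i) + dep x | x <- chain par i.+1].
  rewrite (map_comp (addn (size (text i)))) map_dep_chain // map_rev -iotaDl.
  by rewrite addn1.
rewrite /found filter_map; congr map; apply: eq_in_filter => x hx.
rewrite /hit -[acc R m _]andTb -fend_fwd /active -fwd_cat /= /ends map_take -text_Q.
have px := phrase_prefix lab par_lt hx.
have dx : dep x <= dep i.+1.
  have := map_f dep hx; rewrite map_dep_chain // mem_rev mem_iota; lia.
congr (fend _ _ _ (fwd _ _ _ _)); rewrite px.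
have := text_prefix lt; rewrite size_textS => e.
have -> : take (size (text i) + dep x) (text n) =
    take (size (text i) + dep x) (text i.+1) by rewrite e take_takel ?leq_add2l.
by rewrite textS takeD take_size_cat // drop_size_cat.
Qed.

(** Phrases occupy consecutive disjoint intervals of positions, so [found] never repeats an earlier
    position. *)
Lemma matchesP i : i <= n ->
  uniq (matches i) /\
  forall j, (j \in matches i) = (0 < j <= size (text i)) && ends R (take j Q).
Proof.
elim: i => [|i IH] lt; first by split=> // -[].
have [u h] := IH (ltnW lt).
have mem_found j : (j \in found i) =
    (size (text i) < j <= size (text i.+1)) && ends R (take j Q).
  by rewrite foundE // mem_filter andbC mem_rev mem_iota size_textS addSn ltnS.
split=> [|j]; rewrite matchesS.
  rewrite cat_uniq u foundE // filter_uniq ?rev_uniq ?iota_uniq // andbT.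
  apply/hasPn => j; rewrite -foundE // mem_found h; lia.
rewrite mem_cat h mem_found -andb_orl; congr (_ && _).
by rewrite size_textS; lia.
Qed.

Lemma size_matches_le i : i <= n -> size (matches i) <= size (text i).
Proof.
move=> le; have [u h] := matchesP le.
have := uniq_leq_size u (s2 := iota 1 (size (text i))); rewrite size_iota; apply.
by move=> j; rewrite h mem_iota; lia.
Qed.

Lemma size_text_sqr i : i <= n -> size (text i) <= i * n.
Proof.
elim: i => // i IH lt; rewrite size_textS mulSn.
by have := IH (ltnW lt); have := dep_le par_lt i.+1; lia.
Qed.

Lemma matches_ending : uniq (matches n) /\
  forall j, j \in matches n <-> ending_position R Q j.
Proof.
have [u h] := matchesP (leqnn n); split=> // j; rewrite h text_Q size_map.
split=> [/andP[hj /ends_ending_position]|ep]; first exact.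
have hj : 0 < j <= size Q.
  by case: ep => i [hi [jQ _]]; rewrite jQ andbT; lia.
by rewrite hj; apply/ends_ending_position.
Qed.

End Matches.

(** * Layout and size of the input *)

Section Encoding.

Variables (sigma : nat) (Q : seq 'I_sigma) (Z : compressed sigma).
Variables (R : regexp 'I_sigma) (tau : nat).
Notation n := (compressed_length Z).
Notation m := (re_length R).
Notation inp := (encode_input Z R tau).

Lemma size_encode_compressed : size (encode_compressed Z) = n * (2 - scheme_tag Z).
Proof.
case: Z => Z' /=; last by rewrite muln1.
by elim: Z' => //= z Z' ->; rewrite mulSn.
Qed.

Lemma nth_input_head : [/\ nth 0 inp 0 = scheme_tag Z, nth 0 inp 1 = sigma,
  nth 0 inp 2 = n, nth 0 inp 3 = m & nth 0 inp 4 = tau].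
Proof. by []. Qed.

Lemma nth_input k : nth 0 inp (5 + k) =
  if k < n * (2 - scheme_tag Z) then nth 0 (encode_compressed Z) k
  else nth 0 (encode_regexp R) (k - n * (2 - scheme_tag Z)).
Proof.
rewrite /encode_input nth_cat /= addKn nth_cat size_encode_compressed.
by [].
Qed.

Lemma nth_encode_regexp k : nth 0 (encode_regexp R) k <= sigma + 2.
Proof.
have : all (fun x => x <= sigma + 2) (encode_regexp R).
  elim: R => /= [a|R1 IH1 R2 IH2|R1 IH1 R2 IH2|R1 IH1]; rewrite ?all_cat /= ?IH1 ?IH2 //=.
  - by have := ltn_ord a; lia.
  - by lia.
  - by lia.
by move/all_nthP => h; case: (ltnP k (size (encode_regexp R))) => [/h ->|/(nth_default 0) ->].
Qed.

Lemma nth_input_le par lab fst k : trie_of Q Z par lab fst ->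
  nth 0 inp k <= n + m + tau + sigma + 2.
Proof.
move=> trie; case: k => [|[|[|[|[|k]]]]].
- by rewrite /=; case: Z => *; rewrite /=; lia.
- by rewrite /=; lia.
- by rewrite /=; lia.
- by rewrite /=; lia.
- by rewrite /=; lia.
rewrite -[k.+4.+1]/(5 + k) nth_input; case: ifP => _.
  by have := trie_bound trie k; lia.
by have := nth_encode_regexp (k - n * (2 - scheme_tag Z)); lia.
Qed.

End Encoding.

(** [X] bounds the words of the input, and [X ^ 2] the text, whose n phrases have at most n letters
    each. The array length has the factor 4 because (n + 1)(m + 1) <= 4nm for positive n and m; the
    7 ticks are the run for n = 0. *)
Lemma matcher_correct sigma (Q : seq 'I_sigma) (Z : compressed sigma)
    (R : regexp 'I_sigma) tau :
  1 <= tau -> compressed_into Q Z ->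
  let n := compressed_length Z in
  let m := re_length R in
  let X := n + m + tau + sigma + 2 in
  let inp := encode_input Z R tau in
  let L := 4 * (n * m ^ 2 %/ tau + n * m) in
  exists s', [/\ bigstep inp L (X ^ 2) matcher init_state s',
    forall i, nth 0 inp i <= X, uniq (so s') /\ size (so s') <= X ^ 2,
    forall j, j \in so s' <-> ending_position R Q j &
    tm s' <= 600 * (n * m * (m + tau)) + 16 * m * size (so s') + 7].
Proof.
move=> tau0 comp n m X inp L.
have [par [lab [fst trie]]] := compressed_trie comp.
have inpX i : nth 0 inp i <= X by exact: nth_input_le trie.
have head := nth_input_head Z R tau.
have m0 : 0 < m := re_length_gt0 R.
have [u hmem] := matches_ending R trie.
case: (posnP n) => [n0|n0].
  have [s' [b [o t]]] := matcher_spec0 L (X ^ 2) head n0.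
  have o' : so s' = matches R par lab n by rewrite n0.
  exists s'; split=> //; first by rewrite o.
  - by rewrite o'.
  - by rewrite t; lia.
have nm : n <= n * m by rewrite leq_pmulr.
have mn : m <= n * m by rewrite leq_pmull.
have [q eq_] : exists q, n * m ^ 2 %/ tau = q by eexists.
have LE : L = 4 * (q + n * m) by rewrite /L eq_.
have mL : m < L by rewrite LE; clearbody n m; lia.
have nL : n < L by rewrite LE; clearbody n m; lia.
have nmL : n.+1 * m.+1 <= L by rewrite LE; clearbody n m; lia.
have matL : n %/ tau * (m.+1 * m) <= L.
  have h1 : n %/ tau * m ^ 2 <= n * m ^ 2 %/ tau.
    by rewrite leq_divRL // mulnAC leq_mul2r leq_divM orbT.
  have h2 : m.+1 * m <= 2 * m ^ 2 by rewrite mulSn -mulnn; nia.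
  have h3 : n %/ tau * (m.+1 * m) <= n %/ tau * (2 * m ^ 2) by rewrite leq_mul2l h2 orbT.
  have h4 : n %/ tau * (2 * m ^ 2) <= 2 * q by rewrite mulnCA leq_mul2l -eq_ h1.
  by rewrite LE; apply: leq_trans h3 (leq_trans h4 _); lia.
have text_le : size (text par lab n) <= X ^ 2.
  have := size_text_sqr trie (leqnn _); rewrite -/n -mulnn.
  by move=> h; apply: leq_trans h _; rewrite leq_mul // /X; lia.
have Hsym k : k < m -> nth 0 inp (5 + n * (2 - scheme_tag Z) + k) =
    nth 0 (encode_regexp R) k.
  by move=> km; rewrite -addnA nth_input ifN ?addKn //; rewrite -leqNgt leq_addr.
have Henc i : i < n ->
    if scheme_tag Z == 0 then nth 0 inp (5 + 2 * i) = par i.+1 /\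
                              nth 0 inp (6 + 2 * i) = lab i.+1
    else let c := nth 0 inp (5 + i) in
      if c < sigma then [/\ par i.+1 = 0, lab i.+1 = c & fst i.+1 = c]
      else [/\ par i.+1 = (c - sigma).+1, fst i.+1 = fst (par i.+1) &
               lab i.+1 = fst (par i.+1).+1].
  have read k : k < n * (2 - scheme_tag Z) ->
      nth 0 inp (5 + k) = nth 0 (encode_compressed Z) k.
    by move=> lt; rewrite nth_input lt.
  move=> lt; have := trie_enc trie lt; case E: Z => [Z'|Z'] /=.
    have r1 := read (2 * i); have r2 := read (2 * i).+1.
    rewrite addnS -addSn E /= in r1 r2.
    by move=> [<- <-]; rewrite -r1 -?r2 //; move: lt; rewrite /n E /=; lia.
  have r1 := read i; rewrite E /= in r1.
  by rewrite -r1 //; move: lt; rewrite /n E /=; lia.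
have par0 := trie_par0 trie; have par_lt := trie_par trie.
have [s' [b [o t]]] := matcher_spec Hsym mL nL par0 par_lt Henc head tau0 n0 nmL matL text_le.
exists s'; rewrite o; split=> //; last by lia.
by split=> //; apply: leq_trans text_le; apply: size_matches_le trie _ (leqnn _).
Qed.

Theorem theorem2 :
  exists (P : program) (C : nat),
  forall (sigma : nat) (Q : seq 'I_sigma) (Z : compressed sigma)
         (R : regexp 'I_sigma) (tau : nat),
    1 <= tau -> compressed_into Q Z ->
    let n := compressed_length Z in
    let m := re_length R in
    exists (occs : seq nat) (time : nat),
    let occ := size occs in
    let space := C * (n * m ^ 2 %/ tau + n * m + 1) in
    let word := (n + m + tau + sigma + 2) ^ C in
    [/\ uniq occs,
        forall j : nat, j \in occs <-> ending_position R Q j,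
        ram_run space word P (encode_input Z R tau) time occs
      & time <= C * (n * m * (m + tau) + occ * (m * log m) + 1)].
Proof.
(* Variables are numbered 0 to 30. With [K = 40], cells 32 to 39 are left for temporaries, and the
   14 arrays have room. *)
exists (comp 31 40 matcher 0 ++ [:: Halt]).
have [kappa ekappa] : exists kappa, size (comp 31 40 matcher 0) = kappa by eexists.
(* The multiple of [kappa] serves the time bound. The 200 serves the space, as 40 (4x + 1) <= 200 (x
   + 1), and the words, which need X^128 < X^C. *)
have [C [C1 C2]] : exists C, 600 * kappa <= C /\ 200 <= C.
  by exists (600 * kappa + 200); lia.
exists C => sigma Q Z R tau tau0 cQZ n m.
have [s' [b inpX [u sz] hmem t]] := matcher_correct R tau0 cQZ.
rewrite -/n -/m in b inpX sz t; set X := n + m + tau + sigma + 2 in b inpX sz.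
set L := 4 * _ in b.
have m0 : 0 < m := re_length_gt0 R.
have X4 : 2 <= X by rewrite /X; lia.
have wX2 : X ^ 2 = X * X by rewrite mulnn.
have nX : n <= X by rewrite /X; lia.
have mX : m <= X by rewrite /X; lia.
have mtX : m + tau <= X by rewrite /X; lia.
have occX : m * size (so s') <= X ^ 3.
  by rewrite (expnS X 2) leq_mul.
have nmX : n * m * (m + tau) <= X ^ 3.
  by rewrite !expnS expn0 muln1 mulnA !leq_mul.
have qX : n * m ^ 2 %/ tau <= X ^ 3.
  apply: leq_trans (leq_div _ _) _; rewrite -mulnn (expnS X 2) wX2.
  by rewrite !leq_mul.
have nm2X : n * m <= X ^ 3.
  apply: leq_trans (_ : X ^ 2 <= _); first by rewrite wX2 leq_mul.
  by rewrite leq_pexp2l //; lia.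
have X1 : 1 <= X ^ 3 by rewrite expn_gt0; lia.
have XX3 : X ^ 2 <= X ^ 3 by rewrite leq_pexp2l //; lia.
have X8 : 8 <= X ^ 3 by rewrite -[8]/(2 ^ 3) leq_exp2r.
have X1024 : 1024 <= X ^ 10 by rewrite -[1024]/(2 ^ 10) leq_exp2r.
(* Stored values stay below X^2 plus 8 times the clock, hence below 8 * 1024 * X^3. As X >= 2,
   powers of X absorb the numerical factors. With expressions of weight at most 8, the exponent 16
   leads to X^128. *)
have A_big : 8 * (1024 * X ^ 3) <= X ^ 16.
  rewrite (_ : 16 = 3 + (10 + 3)) // (expnD X 3) (expnD X 10).
  by rewrite leq_mul // leq_mul.
have [t' r ht'] : exists2 t', ram_run (C * (n * m ^ 2 %/ tau + n * m + 1)) (X ^ C)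
    (comp 31 40 matcher 0 ++ [:: Halt]) (encode_input Z R tau) t' (so s') &
    t' <= kappa * tm s'.
  rewrite -ekappa.
  apply: (@ram_run_comp 31 40 8 8 (encode_input Z R tau) L (X ^ 2) (X ^ 16)) b => //.
  - by apply: leq_trans A_big; lia.
  - by apply: leq_trans A_big; lia.
  - apply: leq_trans A_big; rewrite /L.
    by move: (_ %/ tau) qX => q qX; lia.
  - by move=> i; apply: leq_trans (inpX i) _; rewrite wX2 leq_pmulr //; lia.
  - rewrite /L; move: (_ %/ tau) => q.
    apply: leq_trans (_ : 200 * (q + n * m + 1) <= _); first by lia.
    by rewrite leq_mul2r C2 orbT.
  - by rewrite -expnM ltn_exp2l //; lia.
  - apply: leq_trans A_big; move: t; rewrite -(mulnA 16).
    by move: (tm s') (n * m * (m + tau)) nmX (m * size (so s')) occX => a b' + d; lia.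
exists (so s'), t'; split=> //.
apply: leq_trans ht' _.
(* [log m] is at least 1, so the bound without the logarithm implies the stated one. *)
have hlog : m * size (so s') <= size (so s') * (m * log m).
  by rewrite mulnC mulnA leq_pmulr // /log leq_max.
apply: leq_trans (_ : 600 * kappa * (n * m * (m + tau) + size (so s') * (m * log m) + 1) <= _).
  rewrite (mulnC 600) -mulnA leq_mul2l; apply/orP; right.
  move: t hlog; rewrite -(mulnA 16).
  by move: (tm s') (n * m * (m + tau)) (m * size (so s')) (_ * (m * log m)) => a b' d e; lia.
by rewrite leq_mul2r C1 orbT.
Qed.
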